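(* Let $X$ be a reflexive Banach space, let $A:D(A)\subset X\to X$ be a closed linear operator such that $-A$ generates an exponentially stable and compact analytic semigroup $T(t)$ $(t\ge 0)$ on $X$, and let $\omega,\xi,\tau>0$. Let $\alpha\in[0,1)$, and let $G:\mathbb{R}\times X_\alpha\to X_1$ and $F:\mathbb{R}\times X_\alpha\times X_\alpha\to X$ be continuous functions such that for all $x,x_0,x_1\in X_\alpha$ the maps $t\mapsto G(t,x)$ and $t\mapsto F(t,x_0,x_1)$ are $\omega$-periodic. Assume: (H4$'$) there exists a constant $L_1>0$ such that $$\|F(t_2,x_0,x_1)-F(t_1,y_0,y_1)\|\le L_1\big(|t_2-t_1|+\|x_0-y_0\|_\alpha+\|x_1-y_1\|_\alpha\big)$$ for all $t_1,t_2\in\mathbb{R}$ and $x_0,x_1,y_0,y_1\in X_\alpha$; (H5$'$) $G(t,0)=0$ for all $t\in\mathbb{R}$, and there exists a constant $L_2$ such that $$\|AG(t_2,x)-AG(t_1,y)\|\le L_2\big(|t_2-t_1|+\|x-y\|_\alpha\big)$$ for all $t_1,t_2\in\mathbb{R}$ and $x,y\in X_\alpha$; (H6) $CM_\alpha(2L_1+L_2)\dfrac{\omega^{1-\alpha}}{1-\alpha}+C_{1-\alpha}L_2<1$, where $C=\|(I-T(\omega))^{-1}\|$. Then the neutral evolution equation with delays $$(u(t)-G(t,u(t-\xi)))'+Au(t)=F(t,u(t),u(t-\tau)),\qquad t\in\mathbb{R},$$ has an $\omega$-periodic strong solution $u$.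
   Context: Compact semigroup: $T(t)$ is a compact operator for every $t>0$. Exponentially stable: the growth exponent of $T(t)$ is negative, i.e. there are $M\ge1$, $\nu>0$ with $\|T(t)\|\le Me^{-\nu t}$ for all $t\ge0$; in particular $0\in\rho(A)$ and $I-T(\omega)$ has a bounded inverse. Fractional powers: for $\alpha>0$, $A^{-\alpha}=\frac1{\Gamma(\alpha)}\int_0^\infty t^{\alpha-1}T(t)\,dt$, an injective bounded operator on $X$, and $A^\alpha=(A^{-\alpha})^{-1}$; $A^0=I$. $X_\alpha$ is the Banach space $D(A^\alpha)$ with norm $\|x\|_\alpha=\|A^\alpha x\|$; thus $X_0=X$ and $X_1=D(A)$ with norm $\|Ax\|$. Constants: $C_\beta=\|A^{-\beta}\|$ (operator norm on $X$), so $C_{1-\alpha}=\|A^{\alpha-1}\|$; $M_\alpha>0$ denotes a constant such that $\|A^\alpha T(t)\|\le M_\alpha t^{-\alpha}$ for all $t>0$. $C_\omega(\mathbb{R},X_\alpha)$ is the space of continuous $\omega$-periodic functions $\mathbb{R}\to X_\alpha$ with the maximum norm. An $\omega$-periodic mild solution of the equation is a function $u\in C_\omega(\mathbb{R},X_\alpha)$ such that for all $t\in\mathbb{R}$ $$u(t)=G(t,u(t-\xi))+(I-T(\omega))^{-1}\int_{t-\omega}^{t}T(t-s)\big[F(s,u(s),u(s-\tau))-AG(s,u(s-\xi))\big]ds.$$ An $\omega$-periodic strong solution is an $\omega$-periodic mild solution $u$ that is differentiable a.e. on $\mathbb{R}$ (as an $X$-valued function) with $u'\in L^1_{loc}(\mathbb{R},X)$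 and that satisfies the neutral equation for a.e. $t\in\mathbb{R}$ (in particular, for a.e. $t$, $u(t)\in D(A)$ and $t\mapsto u(t)-G(t,u(t-\xi))$ is differentiable at $t$). *)

(* Defs.v *)
From HB Require Import structures.
From mathcomp Require Import all_boot all_order all_algebra.
From mathcomp Require Import complex.
From mathcomp Require Import all_classical all_reals all_analysis.

Set Implicit Arguments.
Unset Strict Implicit.
Unset Printing Implicit Defensive.

Import Order.TTheory GRing.Theory Num.Theory.
Import numFieldNormedType.Exports.

Local Open Scope classical_set_scope.
Local Open Scope ring_scope.

Section BoundedOperators.
Context {R : realType}.

Definition bounded_linear {V W : normedModType R} (f : V -> W) : Prop :=
  linear f /\ continuous f.

Definition opnorm {V W : normedModType R} (f : V -> W) : R :=
  sup [set `|f x| | x in [set x : V | `|x| <= 1]].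

Definition inverse_op {V : lmodType R} (f : V -> V) (y : V) : V :=
  xget 0 [set x | f x = y].

Definition compact_operator {V W : normedModType R} (f : V -> W) : Prop :=
  bounded_linear f /\
  (forall B : set V, bounded_set B -> precompact (f @` B)).

Definition dual (V : normedModType R) : set (V -> R^o) :=
  [set f | bounded_linear f].

(* [phi] ranges over the bidual: bounded linear functionals on [dual], whose
   values outside [dual] are irrelevant. *)
Definition reflexive_space (V : normedModType R) : Prop :=
  forall phi : (V -> R^o) -> R,
    (forall (a : R) (f g : V -> R^o), dual f -> dual g ->
       phi (a *: f + g) = a * phi f + phi g) ->
    (exists c : R, forall f : V -> R^o, dual f -> `|phi f| <= c * opnorm f) ->
    exists x : V, forall f : V -> R^o, dual f -> phi f = f x.

End BoundedOperators.

Section UnboundedOperators.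
Context {R : realType} {X : normedModType R}.
Implicit Types (DA : set X) (A : X -> X).

(* An operator A : D(A) -> X is a domain [DA] together with a total function
   [A], whose values outside [DA] are irrelevant. *)
Definition linear_operator DA A : Prop :=
  DA 0 /\
  forall (a : R) (x y : X), DA x -> DA y ->
    DA (a *: x + y) /\ A (a *: x + y) = a *: A x + A y.

Definition closed_operator DA A : Prop :=
  closed [set p : X * X | DA p.1 /\ p.2 = A p.1].

End UnboundedOperators.

Section BochnerIntegral.
Context {R : realType} {X : normedModType R}.
Notation mu := (@lebesgue_measure R).
Implicit Types (D : set R) (s f : R -> X).

Definition integrable_simple D s : Prop :=
  [/\ finite_set (range s),
      forall x, measurable (s @^-1` [set x]) &
      forall x, x != 0 -> (mu (D `&` s @^-1` [set x]) < +oo)%E].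

(* The term of x = 0, whose level set may have infinite measure, vanishes. *)
Definition simple_integral D s : X :=
  \sum_(x \in range s) fine (mu (D `&` s @^-1` [set x])) *: x.

Definition is_bochner D f (v : X) : Prop :=
  exists s : nat -> R -> X,
    [/\ forall n, integrable_simple D (s n),
        {ae mu, forall t, D t -> s n t @[n --> \oo] --> f t},
        (\int[mu]_(t in D) (`|f t - s n t|)%:E)%E @[n --> \oo] --> 0%E &
        simple_integral D (s n) @[n --> \oo] --> v].

Definition bochner_integrable D f : Prop := exists v : X, is_bochner D f v.

Definition bochner_integral D f : X := xget 0 [set v | is_bochner D f v].

Definition L1loc f : Prop :=
  forall a b : R, bochner_integrable `[a, b] f.

End BochnerIntegral.

Section Semigroups.
Context {R : realType} {X : normedModType R}.
Implicit Types (T : R -> X -> X) (DA : set X) (A : X -> X).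

Definition c0_semigroup T : Prop :=
  [/\ forall t, 0 <= t -> bounded_linear (T t),
      forall x, T 0 x = x,
      forall s t, 0 <= s -> 0 <= t -> forall x, T (s + t) x = T s (T t x) &
      forall x, T t x @[t --> 0^'+] --> x].

Definition neg_generates DA A T : Prop :=
  forall x y : X,
    (t^-1 *: (T t x - x) @[t --> 0^'+] --> y) <-> (DA x /\ y = - A x).

Definition exponentially_stable T : Prop :=
  exists M nu : R, [/\ 1 <= M, 0 < nu &
    forall t x, 0 <= t -> `|T t x| <= M * expR (- nu * t) * `|x|].

Definition compact_semigroup T : Prop :=
  forall t, 0 < t -> compact_operator (T t).

(* The complexification of the real space X is X * X, the pair (x, y) standing
   for x + iy; its max norm is equivalent to the usual complexification norms. *)
Definition cscale (z : R[i]) (p : X * X) : X * X :=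
  (complex.Re z *: p.1 - complex.Im z *: p.2,
   complex.Re z *: p.2 + complex.Im z *: p.1).

Definition sector (theta : R) : set R[i] :=
  [set z | 0 < complex.Re z /\
           `|complex.Im z| < tan theta * complex.Re z].

Definition clinear (S : X * X -> X * X) : Prop :=
  forall (c : R[i]) (p q : X * X), S (cscale c p + q) = cscale c (S p) + S q.

Definition holomorphic_at (S : R[i] -> X * X -> X * X) (z : R[i]) : Prop :=
  exists S' : X * X -> X * X, [/\ clinear S', continuous S' &
    forall eps : R, 0 < eps -> exists2 delta : R, 0 < delta &
      forall h : R[i], ComplexField.Normc.normc h < delta ->
        forall p : X * X, `|S (z + h) p - S z p - cscale h (S' p)|
                          <= eps * ComplexField.Normc.normc h * `|p|].

(* T extends, on the complexification, to a semigroup that is holomorphic on an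
   open sector of half-angle theta around the positive axis, and strongly
   continuous at 0 within that sector. *)
Definition analytic_semigroup T : Prop :=
  exists (theta : R) (S : R[i] -> X * X -> X * X),
    (0 < theta < pi / 2) /\
    [/\ forall z, sector theta z -> clinear (S z) /\ continuous (S z),
        forall t x y, 0 < t -> S (t%:C)%C (x, y) = (T t x, T t y),
        forall z w, sector theta z -> sector theta w ->
          forall p, S (z + w) p = S z (S w p),
        forall z, sector theta z -> holomorphic_at S z &
        forall (p : X * X) (eps : R), 0 < eps ->
          exists2 delta : R, 0 < delta &
            forall z, sector theta z -> ComplexField.Normc.normc z < delta ->
              `|S z p - p| < eps].

End Semigroups.

Section FractionalPowers.
Context {R : realType} {X : normedModType R}.
Variable T : R -> X -> X.

Definition Gamma (a : R) : R :=
  \int[@lebesgue_measure R]_(t in `]0, +oo[) (t `^ (a - 1) * expR (- t)).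

Definition fracpow_neg (a : R) (x : X) : X :=
  if a == 0 then x
  else (Gamma a)^-1 *:
       bochner_integral `]0, +oo[ (fun t : R => t `^ (a - 1) *: T t x).

Definition fracdom (a : R) : set X := range (fracpow_neg a).

Definition fracpow (a : R) : X -> X := inverse_op (fracpow_neg a).

Definition fracnorm (a : R) (x : X) : R := `|fracpow a x|.

End FractionalPowers.

Section NeutralEquation.
Context {R : realType} {X : normedModType R}.
Variables (DA : set X) (A : X -> X) (T : R -> X -> X) (alpha : R).
(* Functions on X_alpha are total functions on X whose values outside D(A^alpha)
   are irrelevant. *)
Variables (G : R -> X -> X) (F : R -> X -> X -> X).
Variables (omega xi tau : R).

Let Xa := fracdom T alpha.
Let na := fracnorm T alpha.

Definition maps_into_X1 : Prop := forall t x, Xa x -> DA (G t x).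

Definition continuous_Xa_X1 : Prop :=
  forall t x, Xa x -> forall eps : R, 0 < eps ->
    exists2 delta : R, 0 < delta &
      forall s y, Xa y -> `|s - t| < delta -> na (y - x) < delta ->
        `|A (G s y - G t x)| < eps.

Definition continuous_XaXa_X : Prop :=
  forall t x0 x1, Xa x0 -> Xa x1 -> forall eps : R, 0 < eps ->
    exists2 delta : R, 0 < delta &
      forall s y0 y1, Xa y0 -> Xa y1 -> `|s - t| < delta ->
        na (y0 - x0) < delta -> na (y1 - x1) < delta ->
        `|F s y0 y1 - F t x0 x1| < eps.

Definition periodic_continuous (u : R -> X) : Prop :=
  [/\ forall t, Xa (u t),
      forall t, na (u s - u t) @[s --> t] --> (0 : R) &
      forall t, u (t + omega) = u t].

Definition mild_solution (u : R -> X) : Prop :=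
  periodic_continuous u /\
  forall t, exists2 v : X,
    is_bochner `[t - omega, t]
      (fun s => T (t - s) (F s (u s) (u (s - tau)) - A (G s (u (s - xi))))) v &
    u t = G t (u (t - xi)) + inverse_op (fun x => x - T omega x) v.

Definition strong_solution (u : R -> X) : Prop :=
  [/\ mild_solution u,
      {ae (@lebesgue_measure R), forall t, derivable u t 1},
      L1loc (derive1 u) &
      {ae (@lebesgue_measure R), forall t,
         [/\ DA (u t),
             derivable (fun s => u s - G s (u (s - xi))) t 1 &
             derive1 (fun s => u s - G s (u (s - xi))) t + A (u t)
             = F t (u t) (u (t - tau))]}].

End NeutralEquation.

(* Main.v *)
Require Import Defs.
From HB Require Import structures.
From mathcomp Require Import all_boot all_order all_algebra.
From mathcomp Require Import complex.
From mathcomp Require Import all_classical all_reals all_analysis.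
From mathcomp Require Import measurable_realfun zify ring lra.

Set Implicit Arguments.
Unset Strict Implicit.
Unset Printing Implicit Defensive.

Import Order.TTheory GRing.Theory Num.Theory.
Import numFieldNormedType.Exports.

Local Open Scope classical_set_scope.
Local Open Scope ring_scope.

(* In the unknown y = A^alpha u the mild equation is a fixed point equation, and
   (H6) makes its right-hand side both a contraction and a self-map of the
   omega-periodic functions with a fixed Lipschitz constant; so the Picard
   iteration yields a Lipschitz mild solution u = g + p with g = A^{-1} w, w
   Lipschitz, and p = (I - T(omega))^{-1} v, v the integral of T(s) f(t - s) over
   ]0, omega], f Lipschitz. The passage to strong solutions usually invokes
   reflexivity (Lipschitz functions are differentiable a.e.); compactness of the
   semigroup does it too, since up to a small error the difference quotients of g
   and p are values of the compact operator T(eps) on a bounded set, and a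
   Lipschitz function with such quotients is differentiable a.e. by the scalar
   Rademacher theorem applied to countably many functionals. Finally
   T(h) p(t) = p(t + h) - \int_0^h T(s) f(t + h - s) ds, so that wherever p is
   differentiable p(t) lies in D(A) and p' + A p = f. *)

(** * Norming functionals *)

(** [A^alpha] is given only as a chosen preimage under the integral operator [A^{-alpha}], so the
    argument is carried by the bounded operators [A^{-alpha}], [A^{alpha-1}], [A^{-1}] and [T(t)].
    With u = A^{-alpha} y the norm of X_alpha becomes that of X, and F and AG become Lipschitz maps
    on all of X. One law of exponents, A^{-alpha} A^{alpha-1} = A^{-1}, supplies the rest: it writes
    G as A^{-alpha} A^{alpha-1} AG, the origin of the term C_{1-alpha} L_2 in (H6); it makes
    A^{-alpha} injective; and with analyticity it puts T(t) x in the range of A^{-alpha}. The other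
    term of (H6) is M_alpha s^{-alpha} integrated over ]0, omega]. Identities between vector
    integrals are tested against functionals, where scalar integration theory applies; norming
    functionals bring the results back to X. The error in the compactness argument has a single
    source: an integral of T(s) over ]0, eps] is of order eps, and the part beyond eps carries a
    factor T(eps). *)

Section HahnBanach.
Context {R : realType} {X : normedModType R}.
Implicit Types (g : set (X * R)) (x y : X).

(** Partial functionals are represented by their graphs, so that extension is inclusion and chains
    are bounded by unions. Single-valuedness follows from domination: (0, r) and (0, -r) in a
    dominated linear graph force r = 0. *)
Definition linear_graph g := forall (a : R) (p q : X * R), g p -> g q ->
  g (a *: p.1 + q.1, a * p.2 + q.2).

Definition dominated_graph g := forall p, g p -> p.2 <= `|p.1|.

(** The one-dimensional step of Hahn-Banach. A value [c] at [v] must satisfy r - |x - v| <= c <= |y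
    + v| - s for all (x, r) and (y, s) in [g]; the triangle inequality makes the supremum of the
    left-hand sides admissible, and homogeneity carries the two bounds to all multiples of [v]. *)
Lemma extend_dominated_graph g v : linear_graph g -> dominated_graph g ->
  g (0, 0) -> (forall r, ~ g (v, r)) ->
  exists h, [/\ linear_graph h, dominated_graph h & g `<` h].
Proof.
move=> lg dg g0 gv.
pose S := [set r : R | exists p, g p /\ r = p.2 - `|p.1 - v|].
have S0 : S !=set0 by exists (0 - `|0 - v|), (0, 0).
have ubS y s : g (y, s) -> ubound S (`|y + v| - s).
  move=> gys _ [[x r]] /= [gxr ->].
  have /dg/= := lg 1 _ _ gxr gys; rewrite scale1r mul1r => rs.
  have : `|x + y| <= `|x - v| + `|y + v|.
    rewrite (_ : x + y = (x - v) + (y + v)) ?ler_normD//.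
    by rewrite addrACA addNr addr0.
  by lra.
pose c := sup S.
have cub y s : g (y, s) -> s + c <= `|y + v|.
  by move=> /ubS/(ge_sup S0); rewrite -/c lerBrDl.
have clb x r : g (x, r) -> r - c <= `|x - v|.
  move=> gxr; rewrite lerBlDr -lerBlDl; apply: ub_le_sup.
    by exists (`|0 + v| - 0); exact: ubS.
  by exists (x, r).
have gZ a x r : g (x, r) -> g (a *: x, a * r).
  by move=> gxr; have := lg a _ _ gxr g0; rewrite /= !addr0.
exists [set p | exists x r t, g (x, r) /\ p = (x + t *: v, r + t * c)].
split.
- move=> a _ _ [x [r [t [gxr ->]]]] [y [s [u [gys ->]]]] /=.
  exists (a *: x + y), (a * r + s), (a * t + u); split.
    by have := lg a _ _ gxr gys.
  congr (_, _); last by ring.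
  by rewrite scalerDr scalerDl scalerA addrACA.
- move=> _ [x [r [t [gxr ->]]]] /=.
  have [t0|t0|->] := ltgtP t 0.
  + have := clb _ _ (gZ (- t)^-1 _ _ gxr).
    rewrite -(@ler_pM2l _ (- t)) ?oppr_gt0//.
    rewrite -[X in X * `|_|]gtr0_norm ?oppr_gt0// -normrZ scalerBr scalerA.
    rewrite mulrBr mulrA divff ?oppr_eq0 ?lt_eqF// mul1r scale1r.
    by rewrite scaleNr opprK mulNr opprK.
  + have := cub _ _ (gZ t^-1 _ _ gxr).
    rewrite -(@ler_pM2l _ t)//.
    rewrite -[X in X * `|_|]gtr0_norm// -normrZ scalerDr scalerA.
    by rewrite mulrDr mulrA divff ?gt_eqF// mul1r scale1r.
  + by rewrite mul0r scale0r !addr0; exact: dg gxr.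
- split=> [[x r] gxr|hg].
    by exists x, r, 0; split=> //; rewrite mul0r scale0r !addr0.
  apply: (gv (0 + 1 * c)); apply: hg; exists 0, 0, 1; split=> //.
  by rewrite scale1r !add0r.
Qed.

Lemma maximal_dominated_graph (g0 : set (X * R)) :
  linear_graph g0 -> dominated_graph g0 -> g0 (0, 0) ->
  exists g, [/\ linear_graph g, dominated_graph g, g0 `<=` g &
    forall x, exists r, g (x, r)].
Proof.
move=> lg0 dg0 g00.
(* The empty chain has empty union, so [set0] must satisfy [P]. A maximal element is not [set0],
   because [g0] lies strictly above it. *)
pose P g := [/\ linear_graph g, dominated_graph g & g = set0 \/ g0 `<=` g].
have [F FP Ftot|g [[lg dg g_0] gmax]] := @Zorn_bigcup _ P.
  split.
  - move=> a p q [B FB Bp] [B' FB' B'q].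
    have [BB'|B'B] := Ftot _ _ FB FB'.
      by exists B' => //; have [lB _ _] := FP _ FB'; apply: lB => //; exact: BB'.
    by exists B => //; have [lB _ _] := FP _ FB; apply: lB => //; exact: B'B.
  - by move=> p [B FB Bp]; have [_ dB _] := FP _ FB; exact: dB.
  - have [[B [FB g0B]]|nB] := pselect (exists B, F B /\ g0 `<=` B).
      by right => p g0p; exists B => //; exact: g0B.
    left; rewrite -subset0 => p [B FB Bp]; have [_ _ [B0|g0B]] := FP _ FB.
      by rewrite B0 in Bp.
    by apply: nB; exists B.
have {}g_0 : g0 `<=` g.
  case: g_0 => // gE; exfalso; apply: (gmax g0); last by split => //; right.
  by rewrite gE; split=> [//|/(_ _ g00)].
exists g; split=> // v; apply: contrapT => gv.
have [||h [lh dh gh]] := extend_dominated_graph lg dg (v := v).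
- exact: g_0.
- by move=> r gvr; apply: gv; exists r.
- by apply: (gmax h gh); split => //; right; apply: subset_trans g_0 (properW gh).
Qed.

(** Extension of t x |-> t |x| from the line through [x]. Domination applied to y and -y gives the
    two-sided bound. *)
Lemma norming_functional (x : X) :
  exists phi : X -> R^o,
    [/\ dual phi, phi x = `|x| & forall y, `|phi y| <= `|y|].
Proof.
pose g0 := [set p : X * R | exists t, p = (t *: x, t * `|x|)].
have [|||g [lg dg g0g gT]] := @maximal_dominated_graph g0.
- move=> a _ _ [t ->] [u ->]; exists (a * t + u) => /=.
  by rewrite scalerA -scalerDl; congr (_, _); ring.
- move=> _ [t ->] /=; rewrite normrZ ler_wpM2r//; exact: ler_norm.
- by exists 0; rewrite scale0r mul0r.
have gZ a y r : g (y, r) -> g (a *: y, a * r).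
  move=> gyr; have := lg a _ _ gyr (g0g (0, 0) _); rewrite /= !addr0; apply.
  by exists 0; rewrite scale0r mul0r.
have gE y r s : g (y, r) -> g (y, s) -> r = s.
  move=> gyr gys; apply/eqP; rewrite eq_le; apply/andP; split.
    by have /dg/= := lg (-1) _ _ gys gyr;
       rewrite scaleN1r addNr normr0 mulN1r; lra.
  by have /dg/= := lg (-1) _ _ gyr gys;
     rewrite scaleN1r addNr normr0 mulN1r; lra.
have /choice[phi phiP] := gT.
have phile y : `|phi y| <= `|y|.
  rewrite ler_norml; apply/andP; split; last exact: dg (phiP y).
  by have /dg/= := gZ (-1) _ _ (phiP y); rewrite scaleN1r normrN mulN1r; lra.
have lphi : linear (phi : X -> R^o).
  move=> a y z; apply: (gE (a *: y + z)); first exact: phiP.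
  exact: lg (phiP y) (phiP z).
exists phi; split => //; last first.
  by apply: (gE x); [exact: phiP|apply: g0g; exists 1; rewrite scale1r mul1r].
split => // y; apply/cvgrPdist_le => e e0.
apply: filterS (nbhsx_ballx y e e0) => z; rewrite -ball_normE /= => /ltW yz; apply: le_trans yz.
have -> : phi y - phi z = phi (y - z).
  by rewrite addrC -scaleN1r -lphi scaleN1r addrC.
exact: phile.
Qed.

End HahnBanach.

(** * Lipschitz functions of a real variable *)

Section ScalarRademacher.
Context {R : realType}.
Notation mu := (@lebesgue_measure R).
Implicit Types h : R -> R.

Lemma aeS (P Q : R -> Prop) : (forall t, P t -> Q t) ->
  {ae mu, forall t, P t} -> {ae mu, forall t, Q t}.
Proof. by move=> PQ; apply: (@filterS _ _ (ae_filter_ringOfSetsType mu)). Qed.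

Lemma aeI (P Q : R -> Prop) : {ae mu, forall t, P t} -> {ae mu, forall t, Q t} ->
  {ae mu, forall t, P t /\ Q t}.
Proof. exact: (@filterI _ _ (ae_filter_ringOfSetsType mu)). Qed.

Lemma derivable_affine (f : R -> R) (a b c t : R) : derivable f t 1 ->
  derivable (fun y => a * f y + b + c * y) t 1.
Proof.
by move=> /derivableP df; exact: ex_derive.
Qed.

(* The Stieltjes measures of (x + h x) / 2 and (x - h x) / 2 add up to the
   Lebesgue measure, so the former is absolutely continuous. *)
Lemma half_lipschitz_cumulative h : (forall x y, `|h x - h y| <= `|x - y|) ->
  exists F : cumulative R R, F = (fun x => (x + h x) / 2) :> (R -> R).
Proof.
move=> hlip.
pose f x := (x + h x) / 2.
have fnd : nondecreasing f.
  move=> x y xy; rewrite /f ler_pM2r ?invr_gt0//.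
  by have := hlip y x; rewrite [leRHS]ger0_norm ?subr_ge0// ler_norml; lra.
have frc : right_continuous f.
  move=> x; apply: cvg_at_right_filter; apply: cvgM; last exact: cvg_cst.
  apply: cvgD.
    exact: cvg_id.
  apply/cvgrPdist_le => e e0; apply: filterS (nbhsx_ballx x e e0) => z.
  by rewrite -ball_normE /= => /ltW; apply: le_trans.
pose F : cumulative R R := HB.pack f (isCumulative.Build R _ R f fnd frc).
by exists F.
Qed.

(** Absolute continuity of the Stieltjes measure of F = (x + h x) / 2 yields a Radon-Nikodym density
    on bounded intervals. Its primitive is F up to a constant and, by Lebesgue differentiation,
    derivable a.e.; then h = 2 F - id. *)
Lemma lipschitz1_ae_derivable h : (forall x y, `|h x - h y| <= `|x - y|) ->
  {ae mu, forall t, derivable h t 1}.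
Proof.
move=> hlip.
have [F FE] := half_lipschitz_cumulative hlip.
have [G GE] : exists G : cumulative R R, G = (fun x => (x - h x) / 2) :> (R -> R).
  by apply: (@half_lipschitz_cumulative (fun x => - h x)) => x y; rewrite -opprD normrN.
pose nu : {measure set (measurableTypeR R) -> \bar R} := lebesgue_stieltjes_measure F.
have nuE a b : a <= b -> nu `]a, b]%classic = (F b - F a)%:E.
  move=> ab; rewrite /nu/= /lebesgue_stieltjes_measure /measure_extension.
  by rewrite measurable_mu_extE/= ?wlength_itv_bnd//; exact: is_ocitv.
have nuGE a b : a <= b ->
    lebesgue_stieltjes_measure G `]a, b]%classic = (G b - G a)%:E.
  move=> ab; rewrite /lebesgue_stieltjes_measure /measure_extension.
  by rewrite measurable_mu_extE/= ?wlength_itv_bnd//; exact: is_ocitv.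
have [m mE] : exists m : {measure set (measurableTypeR R) -> \bar R},
    forall A, m A = (nu A + lebesgue_stieltjes_measure G A)%E.
  by exists (measure_add nu (lebesgue_stieltjes_measure G)) => A; exact: measure_addE.
have muE A : measurable A -> mu A = m A.
  apply: lebesgue_measure_unique => _ [[a b] _ <-].
  rewrite mE /=.
  have [ab|ba] := leP a b; last by rewrite set_itv_ge ?measure0 ?adde0// -leNgt bnd_simp ltW.
  rewrite nuE// nuGE// lebesgue_measure_itv/= lte_fin FE GE.
  case: ltgtP ab => // [ab _|-> _].
    by rewrite -!EFinD; congr EFin; field.
  by rewrite -!EFinD; congr EFin; lra.
have numu : nu `<< mu.
  apply/null_content_dominatesP => A mA muA0.
  have /eqP := etrans (esym (muE A mA)) muA0; rewrite mE.
  by rewrite padde_eq0// => /andP[/eqP].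
(* Restricting to []-n, n[] makes the Stieltjes measure finite and hence its density integrable. The
   countably many exceptional sets are joined at the end. *)
have derN (n : nat) : {ae mu, forall t, - n%:R < t < n%:R -> derivable h t 1}.
  pose D : set (measurableTypeR R) := `]- n%:R, n%:R]%classic.
  have Dfin : (nu D < +oo)%E by rewrite /D nuE ?ltry// (@le_trans _ _ 0)// oppr_le0.
  have mD : measurable D by exact: measurable_itv.
  pose nuD : {finite_measure set _ -> \bar R} := mfrestr mD Dfin.
  have nuDmu : nuD `<< mu.
    apply/null_content_dominatesP => A mA A0.
    have /null_content_dominatesP/(_ A mA A0) nuA0 := numu.
    apply/eqP; rewrite -measure_le0 -nuA0 /nuD /mfrestr /mrestr.
    exact: measureIl.
  have [f [f0 ffin fi fE]] := radon_nikodym_sigma_finite nuDmu.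
  pose g := fine \o f.
  have fg : f = EFin \o g by apply/funext => x /=; rewrite fineK.
  have gi : mu.-integrable setT (EFin \o g) by rewrite -fg.
  have locg : locally_integrable setT g.
    by apply: open_integrable_locally => //; exact: openT.
  have intg y : mu.-integrable [set` Interval (BRight (- n%:R)) (BRight y)] (EFin \o g).
    exact: integrableS gi.
  have := FTC1 intg locg; apply: aeS => t dt /andP[nt tn].
  have {dt}[dt _] := dt nt.
  pose g' y := \int[mu]_(z in [set` Interval (BRight (- n%:R)) (BRight y)]) g z.
  have {dt} : derivable g' t 1 by [].
  have gE y : - n%:R < y < n%:R -> g' y = F y - F (- n%:R).
    move=> /andP[ny yn]; rewrite /g' /Rintegral.
    transitivity (fine (nuD `]- n%:R, y]%classic)).
      by rewrite fE// fg.
    rewrite /nuD /= /mfrestr /mrestr setIidl ?nuE ?ltW//.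
    by apply: subset_itvl; rewrite bnd_simp ltW.
  move: g' gE => g' gE dt.
  have nearE : {near t, (fun y => 2 * g' y + 2 * F (- n%:R) + -1 * y) =1 h}.
    have : \near t, t \in `](- n%:R : R), n%:R[.
      by apply: near_in_itvoo; rewrite in_itv/= nt.
    by apply: filterS => y; rewrite in_itv/= => /gE ->; rewrite FE; field.
  by apply: near_eq_derivable nearE _; exact: derivable_affine dt.
have : {ae mu, forall t, forall n : nat, - n%:R < t < n%:R -> derivable h t 1}.
  exact/ae_foralln.
apply: aeS => t /(_ (Num.bound `|t|)); apply.
by rewrite -ltr_norml archi_boundP.
Qed.

Lemma lipschitz_ae_derivable (L : R) h :
  (forall x y, `|h x - h y| <= L * `|x - y|) ->
  {ae mu, forall t, derivable h t 1}.
Proof.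
move=> hL; pose K := Num.max 1 L; have K0 : 0 < K by rewrite lt_max ltr01.
have hK x y : `|K^-1 * h x - K^-1 * h y| <= `|x - y|.
  rewrite -mulrBr normrM gtr0_norm ?invr_gt0// ler_pdivrMl//.
  by rewrite (le_trans (hL x y))// ler_wpM2r// le_max lexx orbT.
have := lipschitz1_ae_derivable hK; apply: aeS => t dt.
have hE : (fun y => K * (K^-1 * h y) + 0 + 0 * y) = h.
  by apply/funext => x; rewrite mulrA divff ?gt_eqF// mul1r mul0r !addr0.
by rewrite -hE; exact: derivable_affine dt.
Qed.

End ScalarRademacher.

(** * Bochner and Pettis integrals *)

Section WeakIntegral.
Context {R : realType}.
Notation mu := (@lebesgue_measure R).

(** The integral of a nonnegative function is a supremum over the simple functions below it, so
    monotonicity extends to non-measurable functions. It is applied to t |-> |f t - s n t|, where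
    only the composites of [f] with functionals are known to be measurable. *)
Lemma ge0_le_lower_integral (D : set R) (f g : R -> \bar R) :
  (forall t, D t -> (0 <= f t <= g t)%E) ->
  (\int[mu]_(t in D) f t <= \int[mu]_(t in D) g t)%E.
Proof.
move=> fg.
have f0 t : D t -> (0 <= f t)%E by move=> /fg/andP[].
have g0 t : D t -> (0 <= g t)%E by move=> /fg/andP[/le_trans]; apply.
rewrite !ge0_integralE//; apply: ge_ereal_sup => _ [h hf <-].
apply: ereal_sup_ubound; exists h => // t; apply: le_trans (hf t) _.
by apply: lee_restrict => u /fg/andP[].
Qed.

Context {X : normedModType R}.
Implicit Types (D : set R) (f g : R -> X) (v w : X) (phi : X -> R^o).

Lemma bounded_linear_bound {V W : normedModType R} (K : V -> W) :
  bounded_linear K -> exists2 c, 0 < c & forall x, `|K x| <= c * `|x|.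
Proof.
move=> [lK cK].
pose K' : {linear V -> W} := HB.pack K (GRing.isLinear.Build _ _ _ _ K lK).
have [c c0 cP] := @linear_lipschitz _ _ _ K' cK.
by exists c.
Qed.

Lemma bounded_linear_intro {V W : normedModType R} (K : V -> W) c :
  linear K -> (forall x, `|K x| <= c * `|x|) -> bounded_linear K.
Proof.
move=> lK cP; split => // x; apply/cvgrPdist_le => e e0.
pose c' := Num.max 1 c; have c'0 : 0 < c' by rewrite lt_max ltr01.
have ec : 0 < e / c' by rewrite divr_gt0.
apply: filterS (nbhsx_ballx x (e / c') ec) => z.
rewrite -ball_normE /= ltr_pdivlMr// mulrC => /ltW xz; apply: le_trans xz.
have -> : K x - K z = K (x - z).
  by rewrite addrC -scaleN1r -lK scaleN1r addrC.
by rewrite (le_trans (cP _))// ler_wpM2r// le_max lexx orbT.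
Qed.

Lemma bounded_linear_comp {V W Z : normedModType R} (K : V -> W) (L : W -> Z) :
  bounded_linear K -> bounded_linear L -> bounded_linear (L \o K).
Proof.
move=> [lK cK] [lL cL]; split; first by move=> a x y /=; rewrite lK lL.
by move=> x; apply: continuous_comp; [exact: cK|exact: cL].
Qed.

Lemma lin0 {V W : lmodType R} (K : V -> W) : linear K -> K 0 = 0.
Proof. by move=> lK; have := lK (-1) 0 0; rewrite scaleN1r oppr0 addr0 => ->; rewrite scaleN1r addNr. Qed.

Lemma linD {V W : lmodType R} (K : V -> W) x y : linear K -> K (x + y) = K x + K y.
Proof. by move=> lK; have := lK 1 x y; rewrite !scale1r. Qed.

Lemma linZ {V W : lmodType R} (K : V -> W) a x : linear K -> K (a *: x) = a *: K x.
Proof. by move=> lK; have := lK a x 0; rewrite !addr0 lin0// addr0. Qed.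

Lemma linN {V W : lmodType R} (K : V -> W) x : linear K -> K (- x) = - K x.
Proof. by move=> lK; rewrite -scaleN1r linZ// scaleN1r. Qed.

Lemma linB {V W : lmodType R} (K : V -> W) x y : linear K -> K (x - y) = K x - K y.
Proof. by move=> lK; rewrite linD// linN. Qed.

(* The Pettis integral of [f] over [D]: all identities between Bochner integrals
   are checked against bounded functionals. *)
Definition weak_integral D f v := forall phi, dual phi ->
  mu.-integrable D (EFin \o (phi \o f)) /\
  (\int[mu]_(t in D) (phi (f t))%:E)%E = (phi v)%:E.

Lemma norm_le_functional v c : (forall phi, dual phi ->
  (forall y, `|phi y| <= `|y|) -> phi v <= c) -> `|v| <= c.
Proof.
by have [phi [dphi <- phile]] := norming_functional v; apply.
Qed.

Lemma eq_functional v w : (forall phi, dual phi -> phi v = phi w) -> v = w.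
Proof.
move=> vw; apply/eqP; rewrite -subr_eq0 -normr_le0.
apply: norm_le_functional => phi [lphi cphi] _.
by rewrite linB// vw ?subrr.
Qed.

Lemma weak_integral_unique D f v w :
  weak_integral D f v -> weak_integral D f w -> v = w.
Proof.
move=> fv fw; apply: eq_functional => phi dphi.
have [_ pv] := fv _ dphi; have [_] := fw _ dphi.
by rewrite pv => -[].
Qed.

Lemma eq_weak_integral D f g v : measurable D -> (forall t, D t -> f t = g t) ->
  weak_integral D f v -> weak_integral D g v.
Proof.
move=> mD fg fv phi dphi; have [fi <-] := fv _ dphi; split.
  by apply: eq_integrable fi => // t /[!inE] /fg /= ->.
by apply: eq_integral => t /[!inE] /fg ->.
Qed.

Lemma weak_integral_linear (K : X -> X) D f v : bounded_linear K ->
  weak_integral D f v -> weak_integral D (K \o f) (K v).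
Proof.
by move=> bK fv phi dphi; exact: fv (phi \o K) (bounded_linear_comp bK dphi).
Qed.

Lemma weak_integralD D f g v w : measurable D ->
  weak_integral D f v -> weak_integral D g w ->
  weak_integral D (fun t => f t + g t) (v + w).
Proof.
move=> mD fv gw phi dphi; have [lphi _] := dphi.
have [fi fE] := fv _ dphi; have [gi gE] := gw _ dphi; split.
  by apply: eq_integrable (integrableD _ fi gi) => // t _ /=; rewrite linD.
under eq_integral do rewrite linD//.
by rewrite integralD_EFin// fE gE -EFinD -linD.
Qed.

Lemma weak_integralZ D f a v : measurable D ->
  weak_integral D f v -> weak_integral D (fun t => a *: f t) (a *: v).
Proof.
move=> mD fv phi dphi; have [lphi _] := dphi.
have [fi fE] := fv _ dphi; split.
  by apply: eq_integrable (integrableZl _ a fi) => // t _ /=; rewrite linZ.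
under eq_integral do rewrite linZ// EFinM.
by rewrite integralZl// fE -EFinM linZ.
Qed.

Lemma weak_integralB D f g v w : measurable D ->
  weak_integral D f v -> weak_integral D g w ->
  weak_integral D (fun t => f t - g t) (v - w).
Proof.
move=> mD fv gw; have := weak_integralD mD fv (weak_integralZ (-1) mD gw).
by rewrite scaleN1r; apply: eq_weak_integral => // t _; rewrite scaleN1r.
Qed.

Lemma weak_integral_setU D E f u v w : measurable D -> measurable E ->
  [disjoint D & E] ->
  weak_integral (D `|` E) f u -> weak_integral D f v -> weak_integral E f w ->
  u = v + w.
Proof.
move=> mD mE DE fu fv fw; apply: eq_functional => phi dphi.
have [ui uE] := fu _ dphi; have [vi vE] := fv _ dphi; have [wi wE] := fw _ dphi.
have [lphi _] := dphi; apply: EFin_inj; rewrite linD// EFinD -uE -vE -wE.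
apply: integral_setU => //; first exact: measurable_int ui.
Qed.

Lemma weak_integral_norm_le D f v k c : measurable D ->
  (forall t, D t -> `|f t| <= k t) -> mu.-integrable D (EFin \o k) ->
  (\int[mu]_(t in D) (k t)%:E <= c%:E)%E ->
  weak_integral D f v -> `|v| <= c.
Proof.
move=> mD fk ki kc fv; apply: norm_le_functional => phi dphi phile.
have [fi fE] := fv _ dphi; rewrite -lee_fin -fE (le_trans _ kc)//.
apply: le_integral => // t /[!inE] Dt; rewrite lee_fin.
by rewrite (le_trans (ler_norm _))// (le_trans (phile _))// fk.
Qed.

End WeakIntegral.

(** * From Bochner to Pettis integrals *)

Section BochnerWeak.
Context {R : realType} {X : normedModType R}.
Notation mu := (@lebesgue_measure R).
Implicit Types (D : set R) (f s : R -> X) (v w : X) (phi : X -> R^o).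

Lemma eq_is_bochner D f g v : (forall t, D t -> f t = g t) ->
  is_bochner D f v -> is_bochner D g v.
Proof.
move=> fg [s [si sf fs sv]]; exists s; split => //.
  by apply: aeS sf => t h Dt; rewrite -fg//; exact: h.
rewrite (_ : (fun n => _) = (fun n => (\int[mu]_(t in D) (`|f t - s n t|)%:E)%E))//.
by apply/funext => n; apply: eq_integral => t /[!inE] /fg ->.
Qed.

Section simple.
Variables (D : set R) (s : R -> X).
Hypothesis (si : integrable_simple D s).

Lemma simple_measurable (P : set X) : measurable (s @^-1` P).
Proof.
have [sfin sm _] := si.
rewrite (_ : _ @^-1` _ = \bigcup_(x in range s `&` P) s @^-1` [set x]).
  by apply: fin_bigcup_measurable => //; exact: finite_setIl.
apply/seteqP; split => [t Pt|t [x [_ Px] /= ->]//].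
by exists (s t) => //; split => //; exists t.
Qed.

Lemma simple_measurable_fun {d} {T : measurableType d} (h : X -> T) :
  measurable_fun setT (h \o s).
Proof. by move=> _ B mB; rewrite setTI comp_preimage; exact: simple_measurable. Qed.

(** phi o s is the finite sum of phi(x) times the indicators of the level sets. The level set of 0
    may have infinite measure, but phi 0 = 0 removes its term. *)
Lemma simple_weak_integral : measurable D -> weak_integral D s (simple_integral D s).
Proof.
move=> mD phi [lphi _]; have [sfin sm slty] := si.
have phi0 : (phi 0 : R) = 0 := lin0 lphi.
pose F : seq X := finmap.enum_fset (fset_set (range s)).
pose g x t : R := (phi x : R) * \1_(s @^-1` [set x]) t.
have sE t : phi (s t) = (\sum_(x <- F) g x t)%R.
  rewrite (bigD1_seq (s t)) ?finmap.fset_uniq//=; last first.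
    have -> : (s t \in F) = (s t \in range s) := in_fset_set sfin (s t).
    by rewrite inE; exists t.
  rewrite /g indicE mem_set// mulr1 big1 ?addr0// => x xs.
  by rewrite indicE memNset ?mulr0//= => /eqP; rewrite eq_sym; exact/negP.
have indi x : x != 0 -> mu.-integrable D (EFin \o \1_(s @^-1` [set x])).
  move=> x0; apply/integrableP; split.
    by apply/measurable_EFinP; apply: measurable_indic; exact: sm.
  under eq_integral do rewrite /= ger0_norm//.
  by rewrite integral_indic ?[_ `&` D]setIC//; [exact: slty|exact: sm].
have gi x : mu.-integrable D (EFin \o g x).
  have [->|x0] := eqVneq x 0.
    apply: eq_integrable (integrable0 _ _) => // t _.
    by rewrite /g /= phi0 mul0r.
  apply: eq_integrable (integrableZl _ (phi x) (indi _ x0)) => //.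
have gE x : (\int[mu]_(t in D) (g x t)%:E)%E =
    (phi x * fine (mu (D `&` s @^-1` [set x])))%:E.
  have [->|x0] := eqVneq x 0.
    by rewrite phi0 mul0r; apply: integral0_eq => t _; rewrite /g phi0 mul0r.
  under eq_integral do rewrite EFinM.
  rewrite integralZl//; last exact: indi.
  rewrite integral_indic//; last exact: sm.
  rewrite setIC EFinM fineK//.
  by rewrite ge0_fin_numE//; exact: slty.
split.
  apply: eq_integrable (integrable_sum _ F (P := xpredT) (fun x _ => gi x)) => //.
  by move=> t _ /=; rewrite sumEFin sE.
under eq_integral do rewrite sE -sumEFin.
rewrite integral_sum//.
under eq_bigr do rewrite gE.
rewrite sumEFin /simple_integral fsbig_finite//=; congr EFin.
rewrite -/F; elim: F {sE} => [|x r IH]; first by rewrite !big_nil phi0.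
rewrite !big_cons (linD _ _ lphi) IH (linZ _ _ lphi).
exact: (congr1 (fun z : R => z + _) (mulrC (phi x : R) _)).
Qed.

End simple.

(** A functional is Lipschitz with some constant [c], so the integral of |phi f - phi s_n| is at
    most c times that of |f - s_n|. Hence phi of the simple integrals tends both to phi v and to the
    integral of phi o f. *)
Lemma is_bochner_weak_integral D f v : measurable D ->
  (forall phi, dual phi -> measurable_fun D (phi \o f)) ->
  is_bochner D f v -> weak_integral D f v.
Proof.
move=> mD mf [s [si sf fs sv]] phi dphi.
have [lphi cphi] := dphi; have [c c0 cP] := bounded_linear_bound dphi.
have sw n := simple_weak_integral (si n) mD dphi.
have mphif := mf _ dphi.
have dphis n : (\int[mu]_(t in D) (`|phi (f t) - phi (s n t)|)%:E <=
    c%:E * \int[mu]_(t in D) (`|f t - s n t|)%:E)%E.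
  rewrite -lee_pdivrMl// -ge0_integralZl_EFin ?invr_ge0 ?(ltW c0)//; last first.
    apply/measurable_EFinP; apply: measurableT_comp => //.
    apply: measurable_funB => //; apply: measurable_funTS.
    exact: (simple_measurable_fun (si n)).
  apply: ge0_le_lower_integral => t Dt; rewrite -EFinM !lee_fin.
  rewrite mulr_ge0 ?invr_ge0 ?(ltW c0)//= ler_pdivrMl// -linB//.
have fs0 : \forall n \near \oo, (\int[mu]_(t in D) (`|f t - s n t|)%:E)%E \is a fin_num.
  by have /fine_cvgP[] := fs.
have dphi_int n : (\int[mu]_(t in D) (`|f t - s n t|)%:E)%E \is a fin_num ->
    mu.-integrable D (EFin \o (fun t => phi (f t) - phi (s n t))).
  move=> fin; apply/integrableP; split.
    apply/measurable_EFinP; apply: measurable_funB => //; apply: measurable_funTS.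
    exact: (simple_measurable_fun (si n)).
  apply: le_lt_trans (dphis n) _; rewrite lte_mul_pinfty//.
    by rewrite lee_fin ltW.
  by rewrite ltey_eq fin.
have phifi : mu.-integrable D (EFin \o (phi \o f)).
  have [n _ /(_ n (leqnn n)) /dphi_int dn] := fs0.
  apply: eq_integrable (integrableD _ dn (sw n).1) => // t _ /=.
  by rewrite -EFinD subrK.
split => //.
have fphif : (\int[mu]_(t in D) (phi (f t))%:E)%E \is a fin_num.
  exact: integrable_fin_num.
rewrite -[LHS]fineK//; congr EFin.
apply: (@cvg_unique _ (@Rhausdorff R) (phi (simple_integral D (s n)) @[n --> \oo])); last first.
  by apply: continuous_cvg => //; exact: cphi.
apply/cvgrPdist_le => e e0.
have /fine_cvgP[_ /cvgrPdist_le/(_ (e / c))] := fs.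
rewrite divr_gt0// => /(_ isT) fse; near=> n.
have fsfin : (\int[mu]_(t in D) (`|f t - s n t|)%:E)%E \is a fin_num by near: n.
have fsn : `|0 - fine (\int[mu]_(t in D) (`|f t - s n t|)%:E)%E| <= e / c by near: n.
rewrite -lee_fin.
have -> : (`|fine (\int[mu]_(t in D) (phi (f t))%:E)%E - phi (simple_integral D (s n))|)%:E
   = (`|\int[mu]_(t in D) (phi (f t) - phi (s n t))%:E|)%E.
  rewrite integralB_EFin//; last exact: (sw n).1.
  by rewrite (sw n).2 -[in RHS](fineK fphif).
apply: le_trans (le_abse_integral _ _ _) _ => //.
  by apply: measurable_int (dphi_int _ fsfin).
apply: le_trans (dphis n) _; rewrite -(fineK fsfin) -EFinM lee_fin.
rewrite mulrC -ler_pdivlMr//; apply: le_trans fsn.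
by rewrite sub0r normrN ler_norm.
Unshelve. all: by end_near. Qed.

Lemma bochner_weak_integral D f v : measurable D ->
  (forall phi, dual phi -> measurable_fun D (phi \o f)) ->
  is_bochner D f v -> weak_integral D f (bochner_integral D f) .
Proof.
move=> mD mf fv; apply: is_bochner_weak_integral => //.
exact: (xgetPex 0 (ex_intro _ v fv)).
Qed.

End BochnerWeak.

(** * Existence of Bochner integrals by dominated convergence *)

Section BochnerExistence.
Context {R : realType} {X : completeNormedModType R}.
Notation mu := (@lebesgue_measure R).
Implicit Types (D : set R) (f : R -> X) (s : nat -> R -> X) (k : R -> R).

Lemma simple_measurable_fun2 {d} {T : measurableType d} D (s1 s2 : R -> X)
    (h : X -> X -> T) : integrable_simple D s1 -> integrable_simple D s2 ->
  measurable_fun setT (fun t => h (s1 t) (s2 t)).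
Proof.
move=> i1 i2 _ B mB; rewrite setTI.
rewrite (_ : _ @^-1` _ = \bigcup_(x in range s1)
    (s1 @^-1` [set x] `&` s2 @^-1` [set y | B (h x y)])).
  apply: fin_bigcup_measurable => [|x _]; first by have [] := i1.
  by apply: measurableI; [exact: (simple_measurable i1)|exact: (simple_measurable i2)].
apply/seteqP; split => [t Bt|t [x _ [/= <-]]//].
by exists (s1 t) => //; exists t.
Qed.

Section dominated.
Variables (D : set R) (s : nat -> R -> X) (f : R -> X) (k : R -> R).
Hypotheses (mD : measurable D) (si : forall n, integrable_simple D (s n)).
Hypothesis sf : {ae mu, forall t, D t -> s n t @[n --> \oo] --> f t}.
Hypothesis ki : mu.-integrable D (EFin \o k).
Hypothesis sk : forall n t, D t -> `|s n t| <= k t.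

(** The supremum of |s_m t - s_n t| over m >= n: a measurable majorant of |f - s_n| wherever s_m
    converges to f, whereas |f - s_n| itself may fail to be measurable. *)
Let G n t : \bar R := esups (fun m => (`|s m t - s n t|)%:E) n.

Let G0 n t : (0 <= G n t)%E.
Proof.
apply: (@le_trans _ _ (`|s n t - s n t|)%:E); first by rewrite lee_fin.
by apply: ereal_sup_ubound; exists n => //=.
Qed.

Let leG m n t : (n <= m)%N -> ((`|s m t - s n t|)%:E <= G n t)%E.
Proof. by move=> nm; apply: ereal_sup_ubound; exists m. Qed.

Let mG n : measurable_fun D (G n).
Proof.
apply: (measurable_fun_esups (f := fun m t => (`|s m t - s n t|)%:E)) => m.
apply/measurable_EFinP; apply: measurable_funTS.
exact: (simple_measurable_fun2 (fun x y => `|x - y|) (si m) (si n)).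
Qed.

Let Gle n t : D t -> (G n t <= (2 * k t)%:E)%E.
Proof.
move=> Dt; apply: ge_ereal_sup => _ [m _ <-].
rewrite lee_fin (le_trans (ler_normB _ _))// mulr_natl mulr2n.
by rewrite lerD// sk.
Qed.

Let intG0 : (\int[mu]_(t in D) G n t)%E @[n --> \oo] --> 0%E.
Proof.
have := @dominated_convergence _ _ _ mu D mD G (cst 0%E) (fun t => (2 * k t)%:E).
have -> : (\int[mu]_(t in D) cst 0%E t)%E = 0%E by exact: integral0.
case => //.
- apply: aeS sf => t st Dt; have /cvgrPdist_le sft := st Dt.
  apply/fine_cvgP; split.
    near=> n; rewrite ge0_fin_numE//; apply: le_lt_trans (Gle n Dt) _.
    exact: ltry.
  apply/cvgrPdist_le => e e0; have e2 : 0 < e / 2 by rewrite divr_gt0.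
  have [N _ sN] := sft _ e2; exists N => // n /= Nn.
  rewrite sub0r normrN ger0_norm ?fine_ge0//.
  rewrite -lee_fin fineK ?ge0_fin_numE//; last first.
    by apply: le_lt_trans (Gle n Dt) _; exact: ltry.
  apply: ge_ereal_sup => _ [m /= nm <-]; rewrite lee_fin.
  rewrite (_ : s m t - s n t = (f t - s n t) - (f t - s m t)); last first.
    by rewrite opprB addrC -addrA (addrC (f t)) !addrA addrNK.
  rewrite (le_trans (ler_normB _ _))// [leRHS]splitr lerD//; apply: sN => //=.
  exact: leq_trans nm.
- by apply: eq_integrable (integrableZl _ 2 ki) => // t _; rewrite /= EFinM.
- apply: aeW => t n Dt; rewrite gee0_abs//; exact: Gle.
Unshelve. all: by end_near. Qed.

Let intGle n : (\int[mu]_(t in D) (`|f t - s n t|)%:E <= \int[mu]_(t in D) G n t)%E.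
Proof.
have [N [mN N0 sN]] := sf.
(* Infinite on the null set [N], so that the bound holds at every point of [D], as monotonicity of
   lower integrals requires; the integral is that of [G n]. *)
pose H t := maxe (G n t) (+oo%E * (\1_N t)%:E)%E.
have mH : measurable_fun D H.
  apply: measurable_maxe => //; apply: emeasurable_funM; first exact: measurable_cst.
  by apply/measurable_EFinP; apply: measurable_indic.
have HG t : ~ N t -> H t = G n t.
  by move=> Nt; rewrite /H indicE memNset// mule0 max_l.
apply: (@le_trans _ _ (\int[mu]_(t in D) H t)%E).
  apply: ge0_le_lower_integral => t Dt; rewrite lee_fin normr_ge0/=.
  have [Nt|Nt] := pselect (N t).
    by rewrite /H indicE mem_set// mule1 maxey leey.
  rewrite HG//; have st : s n t @[n --> \oo] --> f t.
    by apply: contrapT => nst; apply: Nt; apply: sN => /= /(_ Dt).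
  have cvgE : (`|s m t - s n t|)%:E @[m --> \oo] --> (`|f t - s n t|)%:E.
    apply/fine_cvgP; split; first by near=> m.
    by apply: cvg_norm; apply: cvgB => //; exact: cvg_cst.
  rewrite -(cvg_lim _ cvgE)//; apply: lime_le; first by apply/cvg_ex; eexists; exact: cvgE.
  by near=> m; apply: leG; near: m; exists n.
rewrite le_eqVlt; apply/orP; left; apply/eqP.
apply: ae_eq_integral => //; first exact: mG.
exists N; split => // t /= /not_implyP[_ HGt]; apply: contrapT => /HG.
exact: HGt.
Unshelve. all: by end_near. Qed.

(** The integrals of [G n] tend to 0 by dominated convergence. They bound the integral of |f - s_n|
    as well as the distance of the n-th simple integral from all later ones, so completeness
    provides the value. *)
Lemma bochner_dominated : bochner_integrable D f.
Proof.
have Gfin n : (\int[mu]_(t in D) G n t)%E \is a fin_num.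
  rewrite ge0_fin_numE ?integral_ge0//.
  apply: (@le_lt_trans _ _ (\int[mu]_(t in D) (2 * k t)%:E)%E).
    apply: ge0_le_lower_integral => t Dt; rewrite G0/=; exact: Gle.
  apply: integrable_lty => //.
  by apply: eq_integrable (integrableZl _ 2 ki) => // t _; rewrite /= EFinM.
have Icauchy m n : (n <= m)%N ->
    `|simple_integral D (s m) - simple_integral D (s n)| <=
    fine (\int[mu]_(t in D) G n t)%E.
  move=> nm.
  apply: (@weak_integral_norm_le _ _ D (fun t => s m t - s n t) _
    (fun t => `|s m t - s n t|)) => //.
  - apply: le_integrable (integrableZl _ 2 ki) => //.
      apply/measurable_EFinP; apply: measurable_funTS.
      exact: (simple_measurable_fun2 (fun x y => `|x - y|) (si m) (si n)).
    move=> t Dt /=; rewrite lee_fin normr_id.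
    rewrite (le_trans (ler_normB _ _))// (le_trans _ (ler_norm _))//.
    by rewrite mulr_natl mulr2n lerD// sk.
  - rewrite fineK//; apply: ge0_le_lower_integral => t Dt.
    by rewrite lee_fin normr_ge0/=; exact: leG.
  - by apply: weak_integralB => //; exact: simple_weak_integral.
have /cauchy_cvg/cvg_ex[v Iv] : cauchy (simple_integral D (s n) @[n --> \oo]).
  apply: cauchy_exP => e e0.
  have /fine_cvgP[_ /cvgrPdist_lt/(_ e e0)[N _ GN]] := intG0.
  exists (simple_integral D (s N)); exists N => // m /= Nm.
  rewrite -ball_normE /= distrC (le_lt_trans (Icauchy _ _ Nm))//.
  have := GN N (leqnn N); rewrite /= sub0r normrN.
  by apply: le_lt_trans; exact: ler_norm.
exists v, s; split => //.
apply: (squeeze_cvge _ (cvg_cst 0%E) intG0).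
near=> n; rewrite intGle andbT; apply: integral_ge0 => t _.
by rewrite lee_fin.
Unshelve. all: by end_near. Qed.

End dominated.
End BochnerExistence.

(** * Step functions on uniform grids *)

Section StepFunctions.
Context {R : realType} {X : completeNormedModType R}.
Notation mu := (@lebesgue_measure R).
Implicit Types (D : set R) (f g : R -> X) (k : R -> R).

(** The first multiple of 1/(m+1) strictly to the right of [t]. Sampling on the right asks only for
    right continuity, and keeps integrands that are singular at 0 away from their singularity. *)
Definition grid (m : nat) (t : R) : R := (Num.floor (m.+1%:R * t) + 1)%:~R / m.+1%:R.

Lemma grid_gt m t : t < grid m t.
Proof. by rewrite /grid ltr_pdivlMr// mulrC; exact: floorD1_gt. Qed.

Lemma grid_le m t : grid m t <= t + m.+1%:R^-1.
Proof.
rewrite /grid ler_pdivrMr// mulrDl mulVf// intrD lerD2r mulrC.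
exact: floor_le.
Qed.

Lemma grid_dist m t : `|t - grid m t| <= m.+1%:R^-1.
Proof.
rewrite distrC gtr0_norm ?subr_gt0 ?grid_gt// lerBlDl; exact: grid_le.
Qed.

Definition step_function (n m : nat) g t : X :=
  if `|t| < n%:R then g (grid m t) else 0.

Lemma step_function_simple D n m g : measurable D ->
  integrable_simple D (step_function n m g).
Proof.
move=> mD.
pose K := (n * m.+1)%N.
pose J : set int := [set (i : nat)%:Z - K%:Z | i in `I_(K + K).+1].
have finJ : finite_set J by exact/finite_image/finite_II.
pose ev (j : int) := g ((j + 1)%:~R / m.+1%:R).
have inJ (t : R) : `|t| < n%:R -> J (Num.floor (m.+1%:R * t)).
  move=> tn; pose j := Num.floor (m.+1%:R * t).
  have jK : - K%:Z <= j <= K%:Z.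
    have mtK : `|m.+1%:R * t| < K%:R.
      by rewrite normrM ger0_norm// /K natrM mulrC ltr_pM2r.
    move: mtK; rewrite ltr_norml => /andP[Kmt mtK]; apply/andP; split.
      by rewrite floor_ge_int intrN; exact: ltW.
    by rewrite -(ler_int R) (le_trans (floor_le _))// ltW.
  rewrite -/j; move: (j) jK => i iK.
  by exists (absz (i + K%:Z)) => /=; lia.
have rangeS : range (step_function n m g) `<=` [set 0] `|` (ev @` J).
  move=> _ [t _ <-]; rewrite /step_function; case: ifPn => [tn|_]; last by left.
  by right; exists (Num.floor (m.+1%:R * t)) => //; exact: inJ.
have lvl x : step_function n m g @^-1` [set x] =
    ([set t | `|t| < n%:R] `&`
      \bigcup_(j in J `&` [set j | ev j = x]) [set t | Num.floor (m.+1%:R * t) = j])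
    `|` ([set t | ~ `|t| < n%:R] `&` [set t | x = 0]).
  apply/seteqP; split => [t /=|t /= [[tn [j [_ jx] fj]]|[tn ->]]].
  - rewrite /step_function; case: ifPn => [tn <-|tn <-]; [left|right] => //.
    split => //; exists (Num.floor (m.+1%:R * t)) => //; split => //; exact: inJ.
  - by rewrite /step_function tn -jx /ev -[in RHS]fj.
  - by rewrite /step_function (negbTE (introN idP tn)).
have ballE : [set t : R | `|t| < n%:R] = `]- n%:R, n%:R[%classic.
  by apply/seteqP; split => t /=; rewrite in_itv/= ltr_norml.
have mball : measurable [set t : R | `|t| < n%:R] by rewrite ballE.
have mS x : measurable (step_function n m g @^-1` [set x]).
  rewrite lvl; apply: measurableU.
    apply: measurableI => //; apply: fin_bigcup_measurable.
      exact: finite_setIl.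
    move=> j _; rewrite (_ : [set _ | _] =
      `[j%:~R / m.+1%:R, (j + 1)%:~R / m.+1%:R[%classic)//.
    apply/seteqP; split => t /=; rewrite in_itv/= ler_pdivrMr// ltr_pdivlMr// (mulrC t).
      move=> <-; rewrite floor_le/=; exact: floorD1_gt.
    by move=> /floor_def.
  apply: measurableI; first exact: measurableC.
  have [->|x0] := eqVneq x 0; first by rewrite (_ : [set _ | _] = setT)//; apply/seteqP; split.
  rewrite (_ : [set _ | _] = set0)//; apply/seteqP; split => // t /= /eqP.
  by rewrite (negbTE x0).
split => //.
  apply: sub_finite_set rangeS _; rewrite finite_setU; split => //.
  exact: finite_image.
move=> x x0; apply: (@le_lt_trans _ _ (mu `]- n%:R, n%:R[%classic)).
  have mDS : measurable (D `&` step_function n m g @^-1` [set x]).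
    by apply: measurableI; [exact: mD|exact: mS].
  apply: le_measure; rewrite ?inE//.
  rewrite -ballE lvl => t [_ [[]//|[_ /= xE]]].
  by rewrite xE eqxx in x0.
rewrite lebesgue_measure_itv/=; case: ifPn => _; last exact: ltry.
by rewrite -EFinD ltry.
Qed.

(* On the grid point to the right of [t], a function dominated by a nonincreasing
   [k] is at most [k t]. *)
Lemma right_continuous_bochner D f k : measurable D ->
  (forall t, D t -> f c @[c --> t^'+] --> f t) ->
  mu.-integrable D (EFin \o k) ->
  (forall t, D t -> 0 <= k t) ->
  (forall t c, D t -> t < c -> `|f c| <= k t) ->
  exists v, is_bochner D f v /\ weak_integral D f v.
Proof.
move=> mD fcont ki k0 fk.
have sf t : D t -> step_function n n f t @[n --> \oo] --> f t.
  move=> Dt; have ft := fcont t Dt.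
  have gt_cvg : grid n t @[n --> \oo] --> t^'+.
    move=> P [e /= e0 eP]; suff : \forall n \near \oo, P (grid n t) by [].
    near=> n; apply: eP; last exact: grid_gt.
    rewrite /= (le_lt_trans (grid_dist _ _))//.
    by near: n; exact: (near_infty_natSinv_lt (PosNum e0)).
  apply: cvg_trans (cvg_comp _ _ gt_cvg ft).
  apply: near_eq_cvg; near=> n; rewrite /step_function ifT//.
  near: n; exists (Num.bound `|t|) => // n /= tn.
  by rewrite (lt_le_trans (archi_boundP _))// ler_nat.
have si n := step_function_simple n n f mD.
have [v fv] : bochner_integrable D f.
  apply: (bochner_dominated mD si _ ki); first by apply: aeW.
  move=> n t Dt; rewrite /step_function; case: ifPn => _; last by rewrite normr0 k0.
  by apply: fk => //; exact: grid_gt.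
exists v; split => //; apply: is_bochner_weak_integral => // phi [lphi cphi].
apply: (measurable_fun_cvg (h := fun n => phi \o step_function n n f)) => //.
  by move=> n; apply: measurable_funTS; exact: (simple_measurable_fun (si n)).
move=> t Dt; apply: continuous_cvg; [exact: cphi|exact: sf].
Unshelve. all: by end_near. Qed.

End StepFunctions.

(** * Affine changes of variable *)

Section AffineSubstitution.
Context {R : realType}.
Notation mu := (@lebesgue_measure R).

Section affine.
Variables (a b : R).
Hypothesis a0 : a != 0.
Let phi : measurableTypeR R -> measurableTypeR R := fun x => a * x + b.

Let mphi : measurable_fun setT phi.
Proof. by apply: measurable_funD => //; apply: measurable_funM. Qed.

Let mu' : {measure set (measurableTypeR R) -> \bar R} :=
  mscale (NngNum (normr_ge0 a))
    (measure_function_pushforward__canonical__measure_function_Measure mu mphi).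

(** By uniqueness of Lebesgue measure it is enough to compare lengths of half-open intervals. A
    negative [a] exchanges the ends of the preimage, so its closed end is then the left one. *)
Lemma lebesgue_measure_affine (A : set (measurableTypeR R)) : measurable A ->
  mu A = (`|a|%:E * mu (phi @^-1` A))%E.
Proof.
suff : forall B, measurable B -> mu B = mu' B by move=> h /h.
apply: lebesgue_measure_unique => _ [[c d] _ <-] /=.
rewrite /mscale /= /pushforward.
have [dc|cd] := leP d c.
  rewrite set_itv_ge ?bnd_simp -?leNgt//.
  by rewrite preimage_set0 !measure0 mule0.
have [an|ap|] := ltgtP a 0; last by move/eqP; rewrite (negbTE a0).
- rewrite (_ : phi @^-1` _ = `[(d - b) / a, (c - b) / a[%classic); last first.
    apply/seteqP; split => x /=; rewrite !in_itv/= /phi.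
      move=> /andP[cx xd]; rewrite ler_ndivrMr// ltr_ndivlMr//; apply/andP; split; lra.
    rewrite ler_ndivrMr// ltr_ndivlMr// => /andP[cx xd]; apply/andP; split; lra.
  rewrite !lebesgue_measure_itv/= !lte_fin cd ltr_nM2r ?invr_lt0// ltrD2r cd.
  rewrite -!EFinB -EFinM; congr EFin; rewrite ltr0_norm//; field.
  exact: a0.
- rewrite (_ : phi @^-1` _ = `](c - b) / a, (d - b) / a]%classic); last first.
    apply/seteqP; split => x /=; rewrite !in_itv/= /phi.
      move=> /andP[cx xd]; rewrite ler_pdivlMr// ltr_pdivrMr//; apply/andP; split; lra.
    rewrite ler_pdivlMr// ltr_pdivrMr// => /andP[cx xd]; apply/andP; split; lra.
  rewrite !lebesgue_measure_itv/= !lte_fin cd ltr_pM2r ?invr_gt0// ltrD2r cd.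
  rewrite -!EFinB -EFinM; congr EFin; rewrite gtr0_norm//; field.
  exact: a0.
Qed.

Lemma ge0_integral_affine (D : set R) (f : R -> \bar R) : measurable D ->
  measurable_fun D f -> (forall x, D x -> (0 <= f x)%E) ->
  (\int[mu]_(x in D) f x = `|a|%:E * \int[mu]_(x in phi @^-1` D) f (phi x))%E.
Proof.
move=> mD mf f0.
rewrite (eq_measure_integral mu'); last first.
  by move=> A mA _; exact: lebesgue_measure_affine.
rewrite ge0_integral_mscale//; congr (_ * _)%E.
rewrite ge0_integral_pushforward//.
by move=> x /[!inE]; exact: f0.
Qed.

Lemma measurable_affine (D : set R) (f : R -> \bar R) : measurable D ->
  measurable_fun D f -> measurable_fun (phi @^-1` D) (f \o phi).
Proof.
move=> mD mf; apply: measurable_comp mf _ => //; first by move=> _ [x Dx <-].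
exact: measurable_funTS.
Qed.

Lemma integral_affine (D : set R) (f : R -> \bar R) : measurable D ->
  mu.-integrable D f ->
  mu.-integrable (phi @^-1` D) (f \o phi) /\
  (\int[mu]_(x in D) f x = `|a|%:E * \int[mu]_(x in phi @^-1` D) f (phi x))%E.
Proof.
move=> mD /[dup] fi /integrableP[mf flty].
have ap : 0 < `|a| by rewrite normr_gt0.
have fphii : mu.-integrable (phi @^-1` D) (f \o phi).
  apply/integrableP; split; first exact: measurable_affine.
  move: flty; rewrite (ge0_integral_affine (f := abse \o f));
    [|by []|exact: measurableT_comp|by move=> x _ /=].
  by rewrite !ltey; apply: contraNN => /eqP /= ->; rewrite gt0_muley.
split => //.
rewrite integralE [in RHS]integralE muleBr//; last first.
  apply: (integrable_add_def _ fphii).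
  by rewrite -[_ @^-1` _]setTI; exact: mphi.
congr (_ - _)%E; rewrite ge0_integral_affine//.
- by congr (_ * _)%E; apply: eq_integral => x _; rewrite !funeposE.
- exact: measurable_funepos.
- by congr (_ * _)%E; apply: eq_integral => x _; rewrite !funenegE.
- exact: measurable_funeneg.
Qed.

Lemma weak_integral_affine {X : normedModType R} (D : set R) (f : R -> X) (v : X) :
  measurable D -> weak_integral D f v ->
  weak_integral (phi @^-1` D) (f \o phi) (`|a|^-1 *: v).
Proof.
move=> mD fv psi /[dup] dpsi [lpsi _]; have [fi fE] := fv _ dpsi.
have [fphii fphiE] := integral_affine mD fi; split; first exact: fphii.
rewrite (linZ _ _ lpsi) [RHS](_ : _ = ((`|a|^-1)%:E * (psi v)%:E)%E)//.
by rewrite -fE fphiE/= muleA -EFinM mulVf ?mul1e// normr_eq0; exact: a0.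
Qed.

End affine.
End AffineSubstitution.

(** * Almost everywhere differentiability of vector-valued functions *)

Section VectorRademacher.
Context {R : realType} {X : completeNormedModType R}.
Notation mu := (@lebesgue_measure R).

Lemma compact_operator_net (K : X -> X) (B e : R) : compact_operator K -> 0 < e ->
  exists s : seq X, forall b, `|b| <= B -> exists2 c, c \in s & `|K b - c| <= e.
Proof.
move=> [_ Kc] e0.
have bB : bounded_set [set b : X | `|b| <= B].
  by exists B; split; [exact: num_real|move=> x Bx b /= /le_trans; apply; exact: ltW].
have /Kc := bB; rewrite precompactE compact_cover.
move=> /(_ X setT (fun c => ball c e)) [c _|x _|D _ cD].
- exact: ball_open.
- by exists x => //; exact: ballxx.
exists (finmap.enum_fset D) => b bb.
have [|c Dc /=] := cD (K b).
  by apply: subset_closure; exists b.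
by rewrite -ball_normE/= distrC => /ltW; exists c.
Qed.

(** [phi] norms c - d, hence |c - d| = phi(c - d), which differs from phi(a - b) by at most 2 e and
    so is below 3 e. Passing from c, d to a, b costs another 2 e. *)
Lemma functional_dist (phi : X -> R^o) (a b c d : X) (e : R) : dual phi ->
  (forall y, `|phi y| <= `|y|) -> phi (c - d) = `|c - d| ->
  `|a - c| <= e -> `|b - d| <= e -> `|(phi a : R) - phi b| < e -> `|a - b| < 5 * e.
Proof.
move=> [lphi _] phile phicd ac bd; rewrite -[X in `|X|](linB a b lphi) => ab.
have cd : `|c - d| < 3 * e.
  have h1 := le_trans (phile (a - c)) ac; have h2 := le_trans (phile (b - d)) bd.
  have E : phi (c - d) = (phi (a - b) : R) - phi (a - c) + phi (b - d) :> R.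
    rewrite -[_ - _ : R](linB _ _ lphi) -[RHS](linD _ _ lphi); congr (phi _).
    by rewrite opprB (addrC (a - b)) !subrKA.
  rewrite -phicd E; move: (phi _) (phi _) (phi _) h1 h2 ab => x y z.
  by rewrite ltr_norml !ler_norml; lra.
have -> : a - b = (a - c) + (c - d) + (d - b) by rewrite subrKA subrKA.
rewrite (le_lt_trans (ler_normD _ _))//.
have := ler_normD (a - c) (c - d); rewrite (distrC d b); lra.
Qed.

(* The functionals norming the differences of the net points keep apart the pieces
   of the net, so convergence of the scalar quotients forces the vector quotients
   into a single piece up to the mesh. *)
Lemma lipschitz_net_ae_derivable (p : R -> X) (L : R) :
  (forall x y, `|p x - p y| <= L * `|x - y|) ->
  (forall e, 0 < e -> exists s : seq X, exists2 d, 0 < d & forall t h, 0 < `|h| < d ->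
     exists2 c, c \in s & `|h^-1 *: (p (t + h) - p t) - c| <= e) ->
  {ae mu, forall t, derivable p t 1}.
Proof.
move=> pL pnet.
have /choice[s sP] : forall n, exists s : seq X, exists2 d, 0 < d & forall t h,
    0 < `|h| < d -> exists2 c, c \in s & `|h^-1 *: (p (t + h) - p t) - c| <= n.+1%:R^-1.
  by move=> n; apply: pnet; rewrite invr_gt0.
have [phi phiP] := choice (@norming_functional R X).
pose psi n i j := phi (nth 0 (s n) i - nth 0 (s n) j).
have : {ae mu, forall t, forall n i j, derivable (psi n i j \o p : R -> R) t 1}.
  apply: ae_foralln => n; apply: ae_foralln => i; apply: ae_foralln => j.
  apply: (@lipschitz_ae_derivable _ L) => x y /=.
  have [[lphi _] _ phile] := phiP (nth 0 (s n) i - nth 0 (s n) j).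
  rewrite -[X in `|X|](linB (p x) (p y) lphi).
  exact: le_trans (phile _) (pL x y).
apply: aeS => t tder.
apply: cauchy_cvg; apply: cauchy_exP => e e0.
pose q h := h^-1 *: (p (h *: 1 + t) - p t).
(* The factor 5 is the one in [functional_dist], with the mesh of the net as error. *)
have [n nP] : exists n : nat, n.+1%:R^-1 * 5 < e.
  have [n _ /(_ n (leqnn n))] := near_infty_natSinv_lt (PosNum (divr_gt0 e0 (ltr0n R 5))).
  by rewrite /= ltr_pdivlMr//; exists n.
set eta : R := n.+1%:R^-1 in nP.
have eta0 : 0 < eta by rewrite invr_gt0.
have [d d0 dP] := sP n.
have limpsi i j : exists l : R, \forall h \near 0^', `|psi n i j (q h) - l| < eta / 2.
  have [[lphi _] _ phile] := phiP (nth 0 (s n) i - nth 0 (s n) j).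
  have /cvg_ex[l /cvgrPdist_lt/(_ (eta / 2) (divr_gt0 eta0 (ltr0n R 2)))] := tder n i j.
  move=> hl; exists l; apply: filterS hl => h /=; rewrite distrC.
  by rewrite /q /psi -[X in `|X - l|]/(_ *: (_ - _)) -(linB _ _ lphi) -(linZ _ _ lphi).
have [l lP] := choice (fun ij : nat * nat => limpsi ij.1 ij.2).
pose N := size (s n).
(* There are finitely many pairs of net points, so a single punctured neighbourhood of 0 serves all
   their norming functionals. Two quotients there have scalar values within 2 (eta / 2) of each
   other. *)
pose P h := (forall ij : 'I_N * 'I_N,
    `|psi n ij.1 ij.2 (q h) - l (nat_of_ord ij.1, nat_of_ord ij.2)| < eta / 2) /\
  exists2 c, c \in s n & `|q h - c| <= eta.
have nP' : \forall h \near 0^', P h.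
  apply: filterI.
    have := @filter_forall _ ('I_N * 'I_N)%type (fun ij h => `|psi n ij.1 ij.2 (q h) -
      l (nat_of_ord ij.1, nat_of_ord ij.2)| < eta / 2) (0^').
    by apply => -[i j]; exact: (lP (nat_of_ord i, nat_of_ord j)).
  exists d => //= h /=; rewrite sub0r normrN => hd h0.
  by rewrite /q [_ *: 1]mulr1 (addrC h); apply: dP; rewrite normr_gt0 h0.
have [h0 [h0l [c0 c0s h0c]]] := filter_ex nP'.
exists (q h0); apply: filterS nP' => h [hl [c cs hc]].
rewrite -ball_normE/= -/(q h); apply: lt_trans nP; rewrite mulrC.
have ic : (index c (s n) < N)%N by rewrite index_mem.
have ic0 : (index c0 (s n) < N)%N by rewrite index_mem.
pose i := Ordinal ic; pose i0 := Ordinal ic0.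
have [dphi phic phile] := phiP (c0 - c).
apply: (functional_dist dphi phile phic h0c hc).
have := hl (i0, i); have := h0l (i0, i).
rewrite /psi /= !nth_index//; move: (l _) (phi _ _) (phi _ _) => x y z.
by rewrite !ltr_norml; lra.
Qed.

Lemma near_compact_ae_derivable (p : R -> X) (L : R) :
  (forall x y, `|p x - p y| <= L * `|x - y|) ->
  (forall e, 0 < e -> exists (K : X -> X) B d, [/\ compact_operator K, 0 < d &
     forall t h, 0 < `|h| < d ->
       exists2 b, `|b| <= B & `|h^-1 *: (p (t + h) - p t) - K b| <= e]) ->
  {ae mu, forall t, derivable p t 1}.
Proof.
move=> pL pK; apply: (lipschitz_net_ae_derivable pL) => e e0.
have e20 : 0 < e / 2 by rewrite divr_gt0.
have [K [B [d [cK d0 dP]]]] := pK _ e20.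
have [s sP] := compact_operator_net B cK e20.
exists s; exists d => // t h hd; have [b /sP[c cs bc] qb] := dP t h hd; exists c => //.
rewrite -(subrK (K b) (h^-1 *: _)) -addrA [leRHS]splitr.
by rewrite (le_trans (ler_normD _ _))// lerD.
Qed.

End VectorRademacher.

(** * Bounded continuous integrands *)

Section ContinuousBochner.
Context {R : realType} {X : completeNormedModType R}.
Notation mu := (@lebesgue_measure R).
Implicit Type f : R -> X.

Lemma cst_integrable (D : set R) (B : R) : measurable D -> (mu D < +oo)%E -> 0 <= B ->
  mu.-integrable D (EFin \o cst B).
Proof.
move=> mD muD B0; apply: measurable_bounded_integrable => //.
by exists B; split; [exact: num_real|move=> x xB t _ /=; rewrite ger0_norm// ltW].
Qed.

Lemma continuous_bochner (D : set R) f B : measurable D -> (mu D < +oo)%E ->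
  continuous f -> (forall t, `|f t| <= B) ->
  exists v, is_bochner D f v /\ weak_integral D f v.
Proof.
move=> mD muD cf fB; have B0 : 0 <= B by rewrite (le_trans _ (fB 0)).
apply: (right_continuous_bochner (k := cst B)) => //.
  by move=> t _; apply: cvg_at_right_filter; exact: cf.
exact: cst_integrable.
Qed.

Lemma weak_integral_itv_le a b f v B : a <= b -> (forall t, a < t <= b -> `|f t| <= B) ->
  0 <= B -> weak_integral `]a, b] f v -> `|v| <= B * (b - a).
Proof.
move=> ab fB B0 fv.
have muI : mu (`]a, b]%classic : set R) = (b - a)%:E.
  rewrite lebesgue_measure_itv/= lte_fin; case: ltP => [//|ba].
  by have -> : b - a = 0 by lra.
have mI : measurable (`]a, b]%classic : set R) by exact: measurable_itv.
apply: (weak_integral_norm_le (k := cst B) mI _ _ _ fv).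
- by move=> t /=; rewrite in_itv/=; exact: fB.
- by apply: cst_integrable => //; have := ltry (b - a); rewrite -muI.
- rewrite -[leLHS]/(\int[mu]_(t in `]a, b]) cst B%:E t)%E integral_cst//.
  by rewrite EFinM le_eqVlt; apply/orP; left; apply/eqP; congr (_ * _)%E; exact: muI.
Qed.

Lemma weak_integral_oc a b f v :
  weak_integral `[a, b] f v -> weak_integral `]a, b] f v.
Proof.
move=> fv phi dphi; have [fi fE] := fv _ dphi.
have fi' : mu.-integrable `]a, b] (EFin \o (phi \o f)).
  apply: (integrableS _ _ _ fi) => //; try exact: measurable_itv.
  by move=> t /=; rewrite !in_itv/= => /andP[/ltW -> ->].
split=> //; rewrite -fE; apply: integral_itv_obnd_cbnd.
exact: measurable_int fi'.
Qed.

End ContinuousBochner.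

(** * The Gamma function and the convolution of power kernels *)

Section PowerKernels.
Context {R : realType}.
Notation mu := (@lebesgue_measure R).
Implicit Types (a w t : R).

Lemma measurable_powR_EFin (D : set R) a : measurable_fun D (fun t => (t `^ a)%:E).
Proof. by apply/measurable_EFinP; apply: measurable_funTS; exact: measurable_powR. Qed.

Lemma integral_powR_closed a e w : 0 < a -> 0 < e -> e < w ->
  (\int[mu]_(t in `[e, w]) (t `^ (a - 1))%:E)%E = ((w `^ a - e `^ a) / a)%:E.
Proof.
move=> a0 e0 ew.
have gt0 t : e <= t -> t \in `]0, +oo[.
  by rewrite in_itv/= andbT; exact: lt_le_trans.
have cpow t : e <= t -> {for t, continuous (@powR R ^~ a)}.
  move=> et; apply: differentiable_continuous; apply/derivable1_diffP.
  exact: derivable_powR (gt0 t et).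
have aI : (a%:E * \int[mu]_(t in `[e, w]) (t `^ (a - 1))%:E)%E = (w `^ a - e `^ a)%:E.
  rewrite -ge0_integralZl_EFin//; [|by move=> t _; rewrite lee_fin powR_ge0
                                   |exact: measurable_powR_EFin|exact: ltW].
  rewrite (@continuous_FTC2 _ (fun t => a * t `^ (a - 1)) (@powR R ^~ a))//.
  - apply: derivable_within_continuous => t; rewrite in_itv/= => /andP[et _].
    by apply: derivableM => //; exact: derivable_powR (gt0 t et).
  - split.
    + move=> t; rewrite in_itv/= => /andP[/ltW et _].
      exact: derivable_powR (gt0 t et).
    + by apply: cvg_at_right_filter; exact: cpow.
    + by apply: cvg_at_left_filter; apply: cpow; exact: ltW.
  - move=> t; rewrite in_itv/= => /andP[/ltW et _].
    by rewrite powR_derive1//; exact: gt0.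
rewrite mulrC EFinM -aI muleA -EFinM mulVf ?gt_eqF// mul1e.
by [].
Qed.

Lemma integral_powR a w : 0 < a -> 0 < w ->
  (\int[mu]_(t in `]0%R, w]) (t `^ (a - 1))%:E)%E = (w `^ a / a)%:E.
Proof.
move=> a0 w0.
(* The offset 2 keeps [e n < w] strict also at n = 0. *)
pose e (n : nat) := w / n.+2%:R.
have e0 n : 0 < e n by rewrite divr_gt0.
have ew n : e n < w by rewrite /e ltr_pdivrMr// ltr_pMr// ltr1n.
pose F n := `[e n, w]%classic : set R.
have FE : `](0 : R), w]%classic = \bigcup_n F n.
  apply/seteqP; split => t /=; last first.
    by move=> [n _]; rewrite /F /= !in_itv/= => /andP[/(lt_le_trans (e0 n)) -> ->].
  rewrite in_itv/= => /andP[t0 tw]; exists (Num.bound (w / t)) => //.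
  rewrite /F /= in_itv/= tw andbT /e ler_pdivrMr// -ler_pdivrMl// mulrC.
  rewrite (le_trans (ltW (archi_boundP _)))//; first by rewrite divr_ge0// ltW.
  by rewrite ler_nat leqW// leqW.
have ndF : nondecreasing_seq F.
  move=> m n mn; apply/subsetPset => t; rewrite /F /= !in_itv/= => /andP[et ->].
  by rewrite andbT (le_trans _ et)// /e ler_pM2l// lef_pV2 ?posrE// ler_nat.
have e_cvg : e n @[n --> \oo] --> 0^'+.
  move=> P [d /= d0 dP].
  suff : \forall n \near \oo, P (e n) by [].
  exists (Num.bound (w / d)) => // n /= wn; apply: dP => //=.
  rewrite sub0r normrN gtr0_norm// /e ltr_pdivrMr// -ltr_pdivrMl// mulrC.
  rewrite (lt_le_trans (archi_boundP _))//; first by rewrite divr_ge0// ltW.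
  by rewrite ler_nat (leq_trans wn)// leqW// leqW.
have lim1 : (\int[mu]_(t in F n) (t `^ (a - 1))%:E)%E @[n --> \oo] -->
    (\int[mu]_(t in `]0%R, w]) (t `^ (a - 1))%:E)%E.
  rewrite FE; apply: ge0_nondecreasing_set_cvg_integral => //.
  - by move=> n; exact: measurable_itv.
  - by move=> n; exact: measurable_powR_EFin.
  - by move=> n t _; rewrite lee_fin powR_ge0.
have lim2 : (\int[mu]_(t in F n) (t `^ (a - 1))%:E)%E @[n --> \oo] --> (w `^ a / a)%:E.
  rewrite (_ : (fun n => _) = (fun n => ((w `^ a - e n `^ a) / a)%:E)); last first.
    by apply/funext => n; rewrite integral_powR_closed.
  apply: cvg_EFin; first exact: nearW.
  rewrite -[X in _ --> X / a]subr0; apply: cvgM; last exact: cvg_cst.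
  apply: cvgB; first exact: cvg_cst.
  exact: (cvg_comp _ _ e_cvg (powR_cvg0 a0)).
exact: cvg_unique lim1 lim2.
Qed.

(** As a - 1 <= 0, the kernel is at most t^(a-1) on ]0, 1] and at most exp(-nu t) beyond; the latter
    is a multiple of the exponential density. *)
Lemma exp_kernel_integrable a nu : 0 < a -> a <= 1 -> 0 < nu ->
  mu.-integrable `]0, +oo[ (fun t => (t `^ (a - 1) * expR (- nu * t))%:E).
Proof.
move=> a0 a1 nu0.
have mk (D : set R) : measurable_fun D (fun t => t `^ (a - 1) * expR (- nu * t)).
  apply: measurable_funTS; apply: measurable_funM; first exact: measurable_powR.
  by apply: measurableT_comp => //; exact: measurable_funM.
have ipow : mu.-integrable setT ((fun t => (t `^ (a - 1))%:E) \_ `](0 : R), 1]).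
  rewrite -integrable_mkcond//; apply/integrableP; split.
    exact: measurable_powR_EFin.
  under eq_integral do rewrite gee0_abs ?lee_fin ?powR_ge0//.
  by rewrite integral_powR// ltry.
have iexp := @integrable_exponential_pdf R nu nu0.
have isum := integrableD measurableT ipow (integrableZl measurableT (nu^-1) iexp).
apply: le_integrable (integrableS measurableT _ _ isum) => //.
  by apply/measurable_EFinP; exact: mk.
move=> t /=; rewrite in_itv/= andbT => t0.
have nu_exp : nu^-1 * exponential_pdf nu t = expR (- nu * t).
  rewrite exponential_pdfE ?ltW// mulrA mulVf ?mul1r// gt_eqF//.
rewrite -EFinM nu_exp ger0_norm; last by rewrite mulr_ge0 ?powR_ge0 ?expR_ge0.
rewrite patchE; case: ifPn => tin.
  rewrite -EFinD gee0_abs ?lee_fin; last by rewrite addr_ge0 ?powR_ge0 ?expR_ge0.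
  rewrite (@le_trans _ _ (t `^ (a - 1)))//; last by rewrite lerDl expR_ge0.
  rewrite -[leRHS]mulr1 ler_wpM2l ?powR_ge0// -expR0 ler_expR.
  by rewrite mulNr oppr_le0 mulr_ge0// ltW.
rewrite add0e gee0_abs ?lee_fin ?expR_ge0//.
rewrite -[leRHS]mul1r ler_wpM2r ?expR_ge0// -[leRHS](powRr0 t).
have t1 : 1 <= t.
  by rewrite leNgt; apply: contra tin => t1; rewrite inE/= in_itv/= t0 ltW.
by rewrite ler_powR// subr_le0.
Qed.

Lemma Gamma_gt0 a : 0 < a -> a <= 1 -> 0 < Gamma a.
Proof.
move=> a0 a1; rewrite /Gamma /Rintegral -lte_fin.
have ki := exp_kernel_integrable a0 a1 ltr01.
rewrite fineK; last first.
  apply: integrable_fin_num => //.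
  by apply: eq_integrable ki => // t _; rewrite mulN1r.
apply: (@lt_le_trans _ _ (\int[mu]_(t in `]0%R, 1%R]) (t `^ (a - 1) * expR (-1))%:E)%E).
  under eq_integral do rewrite mulrC EFinM.
  rewrite ge0_integralZl_EFin//; [|by move=> t _; rewrite lee_fin powR_ge0
                                   |exact: measurable_powR_EFin].
  by rewrite integral_powR// -EFinM lte_fin mulr_gt0 ?expR_gt0// divr_gt0 ?powR_gt0.
have mk (D : set R) : measurable_fun D (fun t => (t `^ (a - 1) * expR (- t))%:E).
  apply/measurable_EFinP/measurable_funTS; apply: measurable_funM.
    exact: measurable_powR.
  by apply: measurableT_comp => //; exact: measurableT_comp.
apply: (@le_trans _ _ (\int[mu]_(t in `]0%R, 1%R]) (t `^ (a - 1) * expR (- t))%:E)%E).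
  apply: ge0_le_lower_integral => t /=; rewrite in_itv/= => /andP[t0 t1].
  by rewrite !lee_fin mulr_ge0 ?powR_ge0 ?expR_ge0//= ler_wpM2l ?powR_ge0// ler_expR lerN2.
apply: ge0_subset_integral => //.
- exact: mk.
- by move=> t _; rewrite lee_fin mulr_ge0 ?powR_ge0 ?expR_ge0.
- by move=> t /=; rewrite !in_itv/= => /andP[->].
Qed.

Lemma integral_exp nu : 0 < nu ->
  (\int[mu]_(t in `]0%R, +oo[) (expR (- nu * t))%:E)%E = (nu^-1)%:E.
Proof.
move=> nu0.
have nu_exp t : 0 < t -> expR (- nu * t) = nu^-1 * exponential_pdf nu t.
  by move=> t0; rewrite exponential_pdfE ?ltW// mulrA mulVf ?mul1r// gt_eqF.
under eq_integral.
  move=> t; rewrite inE/= in_itv/= andbT => t0.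
  rewrite nu_exp// EFinM; over.
have mpdf := @measurable_exponential_pdf R nu.
have pdf0 t : (0 <= (exponential_pdf nu t)%:E)%E.
  by rewrite lee_fin exponential_pdf_ge0// ltW.
rewrite ge0_integralZl_EFin//; last 2 first.
- by apply/measurable_EFinP; exact: measurable_funTS.
- by rewrite invr_ge0 ltW.
rewrite [X in (_ * X)%E](_ : _ = 1%E) ?mule1//.
rewrite integral_itv_obnd_cbnd//; last first.
  by apply/measurable_EFinP; exact: measurable_funTS.
rewrite -(integral_exponential_pdf nu0) integral_mkcond; apply: eq_integral => t _; rewrite patchE.
case: ifPn => // /negP; rewrite inE/= in_itv/= andbT => /negP; rewrite -ltNge => t0.
by rewrite lt0_exponential_pdf.
Qed.



Notation D0 := (`]0%R, +oo[%classic : set R).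

Lemma scale_preimage a : 0 < a -> (fun x => a * x + 0) @^-1` D0 = D0.
Proof.
by move=> a0; apply/seteqP; split => x /=; rewrite !in_itv/= !andbT addr0 pmulr_rgt0.
Qed.

Lemma ge0_integral_scale a (f : R -> \bar R) : 0 < a -> measurable_fun D0 f ->
  (forall x, 0 < x -> (0 <= f x)%E) ->
  (\int[mu]_(x in D0) f x = a%:E * \int[mu]_(x in D0) f (a * x)%R)%E.
Proof.
move=> a0 mf f0; rewrite (@ge0_integral_affine _ a 0)//.
- rewrite gtr0_norm// scale_preimage//; congr (_ * _)%E.
  by apply: eq_integral => x _; rewrite addr0.
- by rewrite gt_eqF.
- by move=> x /=; rewrite in_itv/= andbT; exact: f0.
Qed.

Lemma tonelli_D0 (h : R * R -> R) : measurable_fun setT h -> (forall p, 0 <= h p) ->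
  (\int[mu]_(t in D0) \int[mu]_(r in D0) (h (t, r))%:E =
   \int[mu]_(r in D0) \int[mu]_(t in D0) (h (t, r))%:E)%E.
Proof.
move=> mh h0.
pose H (p : measurableTypeR R * measurableTypeR R) : \bar R :=
  (\1_D0 p.1 * \1_D0 p.2 * h p)%:E.
have mH : measurable_fun setT H.
  apply/measurable_EFinP; apply: measurable_funM => //; apply: measurable_funM.
    apply: (measurableT_comp (f := (\1_D0 : measurableTypeR R -> R)) (g := fst)).
      exact: measurable_indic.
    exact: measurable_fst.
  apply: (measurableT_comp (f := (\1_D0 : measurableTypeR R -> R)) (g := snd)).
    exact: measurable_indic.
  exact: measurable_snd.
have H0 p : (0 <= H p)%E by rewrite lee_fin !mulr_ge0.
transitivity (\int[mu]_t \int[mu]_r H (t, r))%E.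
  rewrite integral_mkcond; apply: eq_integral => t _; rewrite patchE.
  case: ifPn => tD; last first.
    by rewrite integral0_eq// => r _; rewrite /H/= indicE (negbTE tD) !mul0r.
  rewrite integral_mkcond; apply: eq_integral => r _; rewrite patchE /H/=.
  by case: ifPn => rD; rewrite !indicE tD ?rD ?(negbTE rD) ?mul1r ?mul0r.
rewrite fubini_tonelli//; apply/esym.
rewrite integral_mkcond; apply: eq_integral => t _; rewrite patchE.
case: ifPn => tD; last first.
  by rewrite integral0_eq// => r _; rewrite /H/= !indicE (negbTE tD) mulr0 mul0r.
rewrite integral_mkcond; apply: eq_integral => r _; rewrite patchE /H/=.
by case: ifPn => rD; rewrite !indicE tD ?rD ?(negbTE rD) ?mul1r ?mul0r.
Qed.

(* The substitution s = t r turns the double integral into a product. *)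
Lemma kernel_convolution a (g : R -> R) : 0 < a -> measurable_fun setT g ->
  (forall x, 0 <= g x) ->
  (\int[mu]_(t in D0) ((t `^ (a - 1))%:E * \int[mu]_(s in D0) (s `^ (- a) * g (t + s)%R)%:E)
   = \int[mu]_(r in D0) (r `^ (- a) * (1 + r)^-1)%:E * \int[mu]_(t in D0) (g t)%:E)%E.
Proof.
move=> a0 mg g0.
have mgc (D : set R) (h : R -> R) : measurable_fun setT h -> measurable_fun D (g \o h).
  by move=> mh; apply: measurable_funTS; exact: measurableT_comp.
have inner t : 0 < t -> ((t `^ (a - 1))%:E * \int[mu]_(s in D0) (s `^ (- a) * g (t + s)%R)%:E =
    \int[mu]_(r in D0) (r `^ (- a) * g ((1 + r) * t)%R)%:E)%E.
  move=> t0; rewrite (@ge0_integral_scale t)//; last 2 first.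
  - apply/measurable_EFinP; apply: measurable_funM.
      by apply: measurable_funTS; exact: measurable_powR.
    by apply: mgc; exact: measurable_funD.
  - by move=> s s0; rewrite lee_fin mulr_ge0 ?powR_ge0.
  rewrite muleA -EFinM -ge0_integralZl_EFin//; last 3 first.
  - by move=> s _; rewrite lee_fin mulr_ge0 ?powR_ge0.
  - apply/measurable_EFinP; apply: measurable_funM.
      apply: measurable_funTS; apply: (measurableT_comp (f := @powR R ^~ (- a))).
        exact: measurable_powR.
      exact: measurable_funM.
    by apply: mgc; apply: measurable_funD => //; exact: measurable_funM.
  - by rewrite mulr_ge0 ?powR_ge0// ltW.
  apply: eq_integral => r; rewrite inE/= in_itv/= andbT => r0.
  rewrite -EFinM; congr EFin.
  have e1 : t `^ (a - 1) * t * t `^ (- a) = 1.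
    by rewrite (mulrC _ t) mulr_powRB1 ?ltW// powRN divff// gt_eqF// powR_gt0.
  rewrite powRM ?ltW// (_ : t + t * r = (1 + r) * t); last by ring.
  by rewrite !mulrA e1 mul1r.
transitivity (\int[mu]_(t in D0) \int[mu]_(r in D0) (r `^ (- a) * g ((1 + r) * t)%R)%:E)%E.
  by apply: eq_integral => t; rewrite inE/= in_itv/= andbT; exact: inner.
rewrite (tonelli_D0 (h := fun p => p.2 `^ (- a) * g ((1 + p.2) * p.1)))//; last 2 first.
- apply: measurable_funM.
    exact: measurableT_comp (measurable_powR _) measurable_snd.
  apply: measurableT_comp => //; apply: measurable_funM; last exact: measurable_fst.
  by apply: measurable_funD => //; exact: measurable_snd.
- by move=> p; rewrite mulr_ge0 ?powR_ge0.
have intg0 : (0 <= \int[mu]_(t in D0) (g t)%:E)%E.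
  by apply: integral_ge0 => t _; rewrite lee_fin.
rewrite -ge0_integralZr//; last 2 first.
- apply/measurable_EFinP; apply: measurable_funM.
    by apply: measurable_funTS; exact: measurable_powR.
  apply: (@eq_measurable_fun _ _ _ _ _ (fun r : measurableTypeR R => (1 + r) `^ (-1))).
    by move=> r; rewrite inE/= in_itv/= andbT => r0; rewrite powR_inv1// addr_ge0// ltW.
  apply: measurable_funTS; apply: (measurableT_comp (f := @powR R ^~ (-1))).
    exact: measurable_powR.
  exact: measurable_funD.
- by move=> r; rewrite /= in_itv/= andbT => r0; rewrite lee_fin mulr_ge0 ?powR_ge0// invr_ge0 addr_ge0// ltW.
apply: eq_integral => r; rewrite inE/= in_itv/= andbT => r0.
have r1 : 0 < 1 + r by rewrite addr_gt0.
under eq_integral do rewrite EFinM.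
rewrite ge0_integralZl_EFin; [|by []|by move=> t _; rewrite lee_fin
  |by apply/measurable_EFinP; apply: mgc; exact: measurable_funM|by rewrite powR_ge0].
rewrite (@ge0_integral_scale (1 + r) (EFin \o g));
  [|by []|by apply/measurable_EFinP; exact: measurable_funTS|by move=> x _; rewrite lee_fin].
by rewrite [RHS]muleA -EFinM -mulrA mulVf ?gt_eqF// mulr1.
Qed.

Lemma Gamma_integral a : 0 < a -> a <= 1 ->
  (\int[mu]_(t in D0) (t `^ (a - 1) * expR (- t))%:E)%E = (Gamma a)%:E.
Proof.
move=> a0 a1; rewrite /Gamma /Rintegral fineK//; apply: integrable_fin_num => //.
by apply: eq_integrable (exp_kernel_integrable a0 a1 ltr01) => // t _; rewrite mulN1r.
Qed.

(** The convolution identity for g(t) = exp(-t): on the left exp(-(t + s)) splits and the double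
    integral factors into the two Gamma values, on the right the integral of g is 1. This identifies
    the constant of the identity for every other g. *)
Lemma Gamma_reflection a : 0 < a -> a < 1 ->
  (\int[mu]_(r in D0) (r `^ (- a) * (1 + r)^-1)%:E = (Gamma a * Gamma (1 - a))%:E)%E.
Proof.
move=> a0 a1.
have mexp (D : set R) : measurable_fun D (fun t : R => expR (- t)).
  by apply: measurable_funTS; apply: measurableT_comp => //; exact: measurableT_comp.
have := @kernel_convolution a (fun t => expR (- t)) a0 (mexp _) (fun t => expR_ge0 _).
have -> : (\int[mu]_(t in D0) (expR (- t))%:E)%E = 1%E.
  have := @integral_exp 1 ltr01; rewrite invr1 => <-.
  by apply: eq_integral => t _; rewrite mulN1r.
rewrite mule1 => <-.
transitivity (\int[mu]_(t in D0) ((Gamma (1 - a))%:E * (t `^ (a - 1) * expR (- t))%:E))%E.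
  apply: eq_integral => t; rewrite inE/= in_itv/= andbT => t0.
  rewrite (_ : (\int[mu]_(s in D0) _)%E = ((expR (- t))%:E * (Gamma (1 - a))%:E)%E); last first.
    have a'0 : 0 < 1 - a by rewrite subr_gt0.
    have a'1 : 1 - a <= 1 by rewrite gerBl ltW.
    rewrite -(Gamma_integral a'0 a'1) -ge0_integralZl_EFin; last 4 first.
    - by [].
    - by move=> s _; rewrite lee_fin mulr_ge0 ?powR_ge0 ?expR_ge0.
    - apply/measurable_EFinP; apply: measurable_funM; last exact: mexp.
      by apply: measurable_funTS; exact: measurable_powR.
    - exact: expR_ge0.
    apply: eq_integral => s _; rewrite -EFinM; congr EFin.
    by rewrite opprD expRD mulrCA; congr (_ * (_ `^ _ * _)); ring.
  by rewrite -!EFinM; congr EFin; ring.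
rewrite ge0_integralZl_EFin; last 4 first.
- by [].
- by move=> s _; rewrite lee_fin mulr_ge0 ?powR_ge0 ?expR_ge0.
- apply/measurable_EFinP; apply: measurable_funM; last exact: mexp.
  by apply: measurable_funTS; exact: measurable_powR.
- by rewrite ltW// Gamma_gt0 ?subr_gt0// gerBl ltW.
rewrite Gamma_integral; [|exact: a0|exact: ltW].
by rewrite -EFinM; congr EFin; exact: mulrC.
Qed.

(** Signed version of the convolution identity. Adding the majorant e(r) = B exp(-nu r) makes [psi]
    nonnegative on ]0, +oo[; the nonnegative identity holds for psi + e and for e, and all the
    integrals are finite, so the two may be subtracted. *)
Lemma Gamma_convolution a (psi J : R -> R) (B nu : R) : 0 < a -> a < 1 -> 0 < nu ->
  measurable_fun D0 psi -> (forall r, 0 < r -> `|psi r| <= B * expR (- nu * r)) ->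
  (forall t, 0 < t -> (\int[mu]_(s in D0) (s `^ (- a) * psi (t + s))%:E)%E = (J t)%:E) ->
  mu.-integrable D0 (fun t => (t `^ (a - 1) * J t)%:E) ->
  (\int[mu]_(t in D0) (t `^ (a - 1) * J t)%:E =
   (Gamma a * Gamma (1 - a))%:E * \int[mu]_(t in D0) (psi t)%:E)%E.
Proof.
move=> a0 a1 nu0 mpsi psiB JE Ji.
pose e r := B * expR (- nu * r).
have B0 : 0 <= B.
  by have := le_trans (normr_ge0 _) (psiB 1 ltr01); rewrite pmulr_lge0 ?expR_gt0.
have e0 r : 0 <= e r by rewrite mulr_ge0 ?expR_ge0.
have me : measurable_fun setT e.
  apply: measurable_funM => //; apply: measurableT_comp => //; exact: measurable_funM.
pose g := (fun r => psi r + e r) \_ D0.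
have mg : measurable_fun setT g.
  apply/(measurable_restrictT _ (measurable_itv _)); apply: measurable_funD => //.
  exact: measurable_funTS.
have gE r : 0 < r -> g r = psi r + e r.
  by move=> r0; rewrite /g patchE mem_set//= in_itv/= andbT.
have g0 r : 0 <= g r.
  rewrite /g patchE; case: ifPn => //; rewrite inE/= in_itv/= andbT => r0.
  by have := psiB r r0; rewrite ler_norml /e; lra.
have a'0 : 0 < 1 - a by rewrite subr_gt0.
have a'1 : 1 - a <= 1 by rewrite gerBl ltW.
have k1 := exp_kernel_integrable a'0 a'1 nu0.
have oppa : 1 - a - 1 = - a by ring.
have k_e : mu.-integrable D0 (fun s => (s `^ (- a) * e s)%:E).
  apply: eq_integrable (integrableZl _ B k1) => // s _.
  by rewrite -EFinM; congr EFin; rewrite oppa /e; ring.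
pose c := fine (\int[mu]_(s in D0) (s `^ (- a) * e s)%:E).
have cE : (\int[mu]_(s in D0) (s `^ (- a) * e s)%:E)%E = c%:E.
  by rewrite /c fineK//; exact: integrable_fin_num.
have eD t s : e (t + s) = expR (- nu * t) * e s.
  by rewrite /e mulrDr expRD; ring.
have k_et t : mu.-integrable D0 (fun s => (s `^ (- a) * e (t + s))%:E).
  apply: eq_integrable (integrableZl _ (expR (- nu * t)) k_e) => // s _.
  by rewrite -EFinM eD; congr EFin; ring.
have JeE t : (\int[mu]_(s in D0) (s `^ (- a) * e (t + s))%:E)%E = (expR (- nu * t) * c)%:E.
  rewrite EFinM -cE -integralZl//; apply: eq_integral => s _.
  by rewrite -EFinM eD; congr EFin; ring.
have k_psi t : 0 < t -> mu.-integrable D0 (fun s => (s `^ (- a) * psi (t + s))%:E).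
  move=> t0; apply: le_integrable (k_et t) => //.
    apply/measurable_EFinP; apply: measurable_funM.
      by apply: measurable_funTS; exact: measurable_powR.
    apply: (@measurable_comp _ _ _ _ _ _ D0 psi) => //.
    - by move=> _ [s /= + <-]; rewrite !in_itv/= !andbT; exact: addr_gt0.
    - by apply: measurable_funTS; exact: measurable_funD.
  move=> s /=; rewrite in_itv/= andbT => s0.
  rewrite lee_fin !normrM ler_wpM2l// (le_trans (psiB _ _)) ?addr_gt0//.
  by rewrite -normrM ler_norm.
have JgE t : 0 < t ->
    (\int[mu]_(s in D0) (s `^ (- a) * g (t + s))%:E)%E = (J t + expR (- nu * t) * c)%:E.
  move=> t0; rewrite EFinD -JE// -JeE -integralD_EFin//; last 2 first.
    exact: k_psi. exact: k_et.
  apply: eq_integral => s; rewrite inE/= in_itv/= andbT => s0.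
  by rewrite gE ?addr_gt0// -EFinD mulrDr.
have k2 := exp_kernel_integrable a0 (ltW a1) nu0.
have k_c : mu.-integrable D0 (fun t => (t `^ (a - 1) * (expR (- nu * t) * c))%:E).
  apply: eq_integrable (integrableZl _ c k2) => // s _.
  by rewrite -EFinM; congr EFin; ring.
have C1 := kernel_convolution a0 mg g0.
have C2 := kernel_convolution a0 me e0.
rewrite Gamma_reflection// in C1; rewrite Gamma_reflection// in C2.
have ei : mu.-integrable D0 (EFin \o e).
  apply: eq_integrable (integrableZl _ B (exp_kernel_integrable ltr01 (lexx 1) nu0)) => // s.
  rewrite inE/= in_itv/= andbT => s0.
  by rewrite subrr powRr0 mul1r -EFinM.
have psii : mu.-integrable D0 (EFin \o psi).
  apply: le_integrable ei => //; first exact/measurable_EFinP.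
  move=> s /=; rewrite in_itv/= andbT => s0; rewrite lee_fin.
  by rewrite (le_trans (psiB _ _))// ler_norm.
have intg : (\int[mu]_(t in D0) (g t)%:E =
    \int[mu]_(t in D0) (psi t)%:E + \int[mu]_(t in D0) (e t)%:E)%E.
  rewrite -integralD_EFin//; apply: eq_integral => s.
  by rewrite inE/= in_itv/= andbT => s0; rewrite gE// EFinD.
have C1' : (\int[mu]_(t in D0) (t `^ (a - 1) * J t)%:E +
    \int[mu]_(t in D0) (t `^ (a - 1) * (expR (- nu * t) * c))%:E =
    (Gamma a * Gamma (1 - a))%:E * \int[mu]_(t in D0) (g t)%:E)%E.
  rewrite -C1 -integralD_EFin//; apply: eq_integral => t.
  rewrite inE/= in_itv/= andbT => t0.
  by rewrite JgE// -EFinM -EFinD; congr EFin; ring.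
have C2' : (\int[mu]_(t in D0) (t `^ (a - 1) * (expR (- nu * t) * c))%:E =
    (Gamma a * Gamma (1 - a))%:E * \int[mu]_(t in D0) (e t)%:E)%E.
  rewrite -C2; apply: eq_integral => t.
  rewrite inE/= in_itv/= andbT => t0.
  by rewrite JeE// -EFinM.
have fin_ex (f : R -> R) : mu.-integrable D0 (EFin \o f) ->
    exists x, (\int[mu]_(t in D0) (f t)%:E)%E = x%:E.
  by move=> fi; exists (fine (\int[mu]_(t in D0) (f t)%:E)%E); rewrite fineK//; exact: integrable_fin_num.
have [x xE] := fin_ex _ Ji; have [y yE] := fin_ex _ psii; have [z zE] := fin_ex _ ei.
move: C1'; rewrite C2' intg xE yE zE -!EFinM => -[h]; congr EFin.
move: (Gamma a * Gamma (1 - a)) h => C h.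
by apply: (addIr (C * z)); rewrite h mulrDr.
Qed.

End PowerKernels.

Lemma powR_nonincr (R : realType) (a t c : R) : a <= 0 -> 0 < t -> t <= c -> c `^ a <= t `^ a.
Proof.
move=> a0 t0 tc; rewrite -(opprK a) (powRN c) (powRN t) lef_pV2 ?posrE ?powR_gt0//; last first.
  exact: lt_le_trans tc.
by rewrite ge0_ler_powR ?nnegrE ?oppr_ge0// ?ltW// (lt_le_trans t0).
Qed.

(** * Fractional powers of the generator of a stable semigroup *)

Section StableSemigroup.
Context {R : realType} {X : completeNormedModType R}.
Notation mu := (@lebesgue_measure R).
Notation D0 := (`]0%R, +oo[%classic : set R).
Variables (T : R -> X -> X) (M nu : R).
Hypotheses (hT : c0_semigroup T) (M1 : 1 <= M) (nu0 : 0 < nu).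
Hypothesis TM : forall t x, 0 <= t -> `|T t x| <= M * expR (- nu * t) * `|x|.

Let M0 : 0 <= M. Proof. exact: le_trans M1. Qed.

Lemma semigroup_bounded_linear t : 0 <= t -> bounded_linear (T t).
Proof. by move=> t0; have [bT _ _ _] := hT; exact: bT. Qed.

Lemma semigroup_linear t : 0 <= t -> linear (T t).
Proof. by move=> /semigroup_bounded_linear[]. Qed.

Lemma semigroup0 x : T 0 x = x.
Proof. by have [_ T0 _ _] := hT. Qed.

Lemma semigroupD s t x : 0 <= s -> 0 <= t -> T (s + t) x = T s (T t x).
Proof. by move=> s0 t0; have [_ _ TD _] := hT; exact: TD. Qed.

Lemma semigroup_comm s t x : 0 <= s -> 0 <= t -> T s (T t x) = T t (T s x).
Proof. by move=> s0 t0; rewrite -!semigroupD// addrC. Qed.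

Lemma semigroup_le t x : 0 <= t -> `|T t x| <= M * `|x|.
Proof.
move=> t0; rewrite (le_trans (TM _ t0))// ler_wpM2r//.
rewrite -[leRHS]mulr1 ler_wpM2l// -expR0 ler_expR mulNr oppr_le0.
by rewrite mulr_ge0// ltW.
Qed.

Lemma semigroup_cvg0 x e : 0 < e ->
  exists2 d, 0 < d & forall t, 0 <= t < d -> `|T t x - x| < e.
Proof.
move=> e0; have [_ _ _ /(_ x) T0] := hT.
have /cvgrPdist_lt/(_ e e0)[d /= d0 dP] := T0.
exists d => // t /andP[]; rewrite le_eqVlt => /predU1P[<- _|t0 td].
  by rewrite semigroup0 subrr normr0.
by rewrite distrC; apply: dP => //=; rewrite sub0r normrN gtr0_norm.
Qed.

Lemma semigroup_dist s t x : 0 <= s -> 0 <= t ->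
  `|T s x - T t x| <= M * `|T `|s - t| x - x|.
Proof.
move=> s0 t0; wlog st : s t s0 t0 / s <= t.
  move=> h; have [/h|/ltW/h] := leP s t; first exact.
  by rewrite distrC (distrC t s); exact.
rewrite distrC (distrC s) ger0_norm ?subr_ge0//.
rewrite -{1}(subrKC s t) semigroupD ?subr_ge0//.
rewrite -(linB _ _ (semigroup_linear s0)); exact: semigroup_le.
Qed.

(* The semigroup frozen on the negative axis, to get a total continuous map. *)
Definition extT t := T (Num.max 0 t).

Lemma extTE t : 0 <= t -> extT t = T t.
Proof. by move=> t0; rewrite /extT max_r. Qed.

Lemma extT_cont (f : R -> X) : continuous f -> continuous (fun t => extT t (f t)).
Proof.
move=> cf t; apply/cvgrPdist_lt => e e0.
have M20 : 0 < 2 * M by rewrite mulr_gt0// (lt_le_trans _ M1).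
have eM : 0 < e / (2 * M) by rewrite divr_gt0.
have [d d0 dP] := semigroup_cvg0 (f t) eM.
have /cvgrPdist_lt/(_ _ eM) cft := cf t.
near=> s.
have m0 r : 0 <= Num.max 0 r :> R by rewrite le_max lexx.
have -> : extT t (f t) - extT s (f s) =
    (extT t (f t) - extT s (f t)) + extT s (f t - f s).
  have lT : linear (extT s) := semigroup_linear (m0 s).
  by rewrite (linB _ _ lT) addrA subrK.
rewrite (le_lt_trans (ler_normD _ _))// [ltRHS]splitr.
have eE : M * (e / (2 * M)) = e / 2.
  by field; rewrite gt_eqF// (lt_le_trans _ M1).
rewrite ltrD//.
  rewrite (le_lt_trans (semigroup_dist _ _ _))// -eE ltr_pM2l ?(lt_le_trans _ M1)//.
  apply: dP; rewrite normr_ge0/=.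
  apply: (@le_lt_trans _ _ `|t - s|); last by near: s; exact: cvgr_dist_lt.
  have := ler_norm (s - t); rewrite distrC; have := ler_norm (t - s).
  by case: (leP 0 t) => ?; case: (leP 0 s) => ?; rewrite ler_norml; lra.
rewrite (le_lt_trans (semigroup_le _ _))// -eE ltr_pM2l ?(lt_le_trans _ M1)//.
by near: s.
Unshelve. all: by end_near. Qed.

Section FractionalPower.
Variable a : R.
Hypotheses (a0 : 0 < a) (a1 : a <= 1).
Notation J := (fracpow_neg T a).

Let kern t := t `^ (a - 1) * expR (- nu * t).

Let kern_norm x t : 0 < t -> `|t `^ (a - 1) *: T t x| <= M * `|x| * kern t.
Proof.
move=> t0; rewrite normrZ ger0_norm ?powR_ge0// /kern.
rewrite (_ : M * _ * _ = t `^ (a - 1) * (M * expR (- nu * t) * `|x|)); last by ring.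
by rewrite ler_wpM2l ?powR_ge0// TM// ltW.
Qed.

(** For a <= 1 the majorant t^(a-1) exp(-nu t) is nonincreasing, which is the domination demanded by
    [right_continuous_bochner]. Multiplying by [Gamma a] clears the normalization, so that later
    identities concern the bare integral. *)
Lemma frac_weak_integral x :
  weak_integral D0 (fun t => t `^ (a - 1) *: T t x) (Gamma a *: J x).
Proof.
have Ga := Gamma_gt0 a0 a1.
have [v [bv wv]] : exists v, is_bochner D0 (fun t => t `^ (a - 1) *: T t x) v /\
    weak_integral D0 (fun t => t `^ (a - 1) *: T t x) v.
  apply: (right_continuous_bochner (k := fun t => M * `|x| * kern t)) => //.
  - move=> t /=; rewrite in_itv/= andbT => t0.
    apply: cvgZ.
      have cp : {for t, continuous (@powR R ^~ (a - 1))}.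
        apply: differentiable_continuous; apply/derivable1_diffP.
        by apply: derivable_powR; rewrite in_itv/= t0.
      exact: cvg_at_right_filter cp.
    have cT : {for t, continuous (fun s => extT s x)}.
      by apply: (@extT_cont (cst x)) => s; exact: cvg_cst.
    have <- : extT t x = T t x by rewrite extTE// ltW.
    apply: cvg_trans (cvg_at_right_filter cT).
    apply: near_eq_cvg; near=> c; rewrite extTE//.
    by rewrite (le_trans (ltW t0))//; near: c; exact: nbhs_right_ge.
  - apply: eq_integrable (integrableZl _ (M * `|x|) (exp_kernel_integrable a0 a1 nu0)) => //.
  - by move=> t; rewrite /= in_itv/= andbT => t0; rewrite !mulr_ge0 ?powR_ge0 ?expR_ge0.
  - move=> t c; rewrite /= in_itv/= andbT => t0 tc.
    rewrite (le_trans (kern_norm _ (lt_trans t0 tc)))// ler_wpM2l ?mulr_ge0//.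
    rewrite /kern ler_pM ?powR_ge0 ?expR_ge0//.
      by rewrite powR_nonincr ?subr_le0// ltW.
    by rewrite ler_expR !mulNr lerN2 ler_pM2l// ltW.
suff -> : Gamma a *: J x = v by [].
rewrite /fracpow_neg gt_eqF// scalerA divff ?scale1r ?gt_eqF//.
apply: (weak_integral_unique _ wv); apply: (bochner_weak_integral _ _ bv) => //.
move=> phi dphi; have [phii _] := wv _ dphi.
by have /measurable_int/measurable_EFinP := phii.
Unshelve. all: by end_near. Qed.

Lemma frac_unique x v : weak_integral D0 (fun t => t `^ (a - 1) *: T t x) (Gamma a *: v) ->
  J x = v.
Proof.
move=> wv; have := weak_integral_unique (frac_weak_integral x) wv.
by apply: scalerI; rewrite gt_eqF// Gamma_gt0.
Qed.

Lemma frac_linear : linear J.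
Proof.
move=> b x y; apply: frac_unique; rewrite scalerDr scalerA mulrC -scalerA.
have mD : measurable D0 by exact: measurable_itv.
have := weak_integralD mD (weak_integralZ b mD (frac_weak_integral x)) (frac_weak_integral y).
apply: eq_weak_integral => // t /=; rewrite in_itv/= andbT => t0.
rewrite (linD _ _ (semigroup_linear (ltW t0))) (linZ _ _ (semigroup_linear (ltW t0))).
by rewrite scalerDr !scalerA mulrC.
Qed.

Lemma frac_bounded_linear : bounded_linear J.
Proof.
have Ga := Gamma_gt0 a0 a1.
have ki := exp_kernel_integrable a0 a1 nu0.
pose c := fine (\int[mu]_(t in D0) (kern t)%:E)%E.
apply: (@bounded_linear_intro _ _ _ _ ((Gamma a)^-1 * (M * c))); first exact: frac_linear.
move=> x; rewrite -mulrA ler_pdivlMl//.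
rewrite -[X in X * _]gtr0_norm// -normrZ.
apply: (weak_integral_norm_le _ _ _ _ (frac_weak_integral x) (k := fun t => M * `|x| * kern t)) => //.
- by move=> t /=; rewrite in_itv/= andbT; exact: kern_norm.
- by apply: eq_integrable (integrableZl _ (M * `|x|) ki).
- under eq_integral do rewrite EFinM.
  rewrite integralZl// (_ : (\int[mu]_(t in D0) _)%E = c%:E); last first.
    by rewrite /c fineK//; exact: integrable_fin_num.
  by rewrite -EFinM lee_fin mulrAC.
Qed.

Lemma frac_comm (K : X -> X) x : bounded_linear K ->
  (forall t, 0 <= t -> K (T t x) = T t (K x)) -> J (K x) = K (J x).
Proof.
move=> /[dup] bK [lK _] KT; apply: frac_unique; rewrite -(linZ _ _ lK).
apply: (eq_weak_integral _ _ (weak_integral_linear bK (frac_weak_integral x))) => //.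
move=> t /=; rewrite in_itv/= andbT => t0.
by rewrite (linZ _ _ lK) KT// ltW.
Qed.

End FractionalPower.

Lemma Gamma1 : Gamma 1 = 1 :> R.
Proof.
apply: EFin_inj; rewrite -Gamma_integral//.
have := @integral_exp R 1 ltr01; rewrite invr1 => <-.
by apply: eq_integral => t _; rewrite subrr powRr0 mul1r mulN1r.
Qed.

Notation J1 := (fracpow_neg T 1).

Lemma frac1_weak_integral x : weak_integral D0 (T^~ x) (J1 x).
Proof.
have := frac_weak_integral ltr01 (lexx 1) x; rewrite Gamma1 scale1r.
by apply: eq_weak_integral => // t _; rewrite subrr powRr0 scale1r.
Qed.

(** Tested against phi, the composition is the double integral of t^(a-1) s^(-a) phi(T(t + s) x), to
    which [Gamma_convolution] applies with psi(r) = phi(T r x). The two normalizing Gamma factors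
    cancel its constant. *)
Lemma frac_comp a x : 0 < a -> a < 1 ->
  fracpow_neg T a (fracpow_neg T (1 - a) x) = J1 x.
Proof.
move=> a0 a1; apply: eq_functional => phi /[dup] dphi [lphi _].
have a'0 : 0 < 1 - a by rewrite subr_gt0.
have a'1 : 1 - a <= 1 by rewrite gerBl ltW.
have Ga := Gamma_gt0 a0 (ltW a1); have Ga' := Gamma_gt0 a'0 a'1.
set y := fracpow_neg T (1 - a) x.
have cancel (g g' p q : R) : 0 < g -> 0 < g' -> g' * (g * p) = g * g' * q -> p = q.
  move=> g0 g'0 h; apply: (@mulfI _ (g * g')); first by rewrite gt_eqF// mulr_gt0.
  by rewrite -h; ring.
have [B B0 phiB] := bounded_linear_bound dphi.
have [pi1 pE1] := frac_weak_integral a0 (ltW a1) y dphi.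
have [pi2 pE2] := frac1_weak_integral x dphi.
have lin_phi z (b : R) : (phi (b *: z) : R) = b * phi z by exact: (linZ _ _ lphi).
have := @Gamma_convolution _ a (fun r => phi (T r x)) (fun t => Gamma (1 - a) * phi (T t y))
  (B * (M * `|x|)) nu a0 a1 nu0.
have -> : (\int[mu]_(t in D0) (t `^ (a - 1) * (Gamma (1 - a) * phi (T t y)))%:E)%E =
    ((Gamma (1 - a) * (Gamma a * phi (fracpow_neg T a y)))%:E).
  rewrite EFinM -lin_phi -pE1 -integralZl//.
  by apply: eq_integral => t _; rewrite lin_phi -EFinM; congr EFin; ring.
rewrite pE2 -EFinM => conv.
have h : Gamma (1 - a) * (Gamma a * phi (fracpow_neg T a y)) =
    Gamma a * Gamma (1 - a) * phi (J1 x) :> R.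
  apply: EFin_inj; apply: conv.
  - by have /measurable_int/measurable_EFinP := pi2.
  - move=> r r0; rewrite (le_trans (phiB _))// -mulrA ler_pM2l//.
    by rewrite (le_trans (TM _ (ltW r0)))// mulrAC.
  - move=> t t0.
    have bT := semigroup_bounded_linear (ltW t0).
    have [_] := weak_integral_linear bT (frac_weak_integral a'0 a'1 x) dphi.
    rewrite (linZ _ _ (semigroup_linear (ltW t0))) lin_phi => <-.
    apply: eq_integral => s; rewrite inE/= in_itv/= andbT => s0; congr EFin.
    rewrite (linZ _ _ (semigroup_linear (ltW t0))) lin_phi semigroupD ?ltW//.
    by congr (_ `^ _ * _); ring.
  - apply: eq_integrable (integrableZl _ (Gamma (1 - a)) pi1) => // t _ /=.
    by rewrite lin_phi -EFinM; congr EFin; ring.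
exact: cancel Ga Ga' h.
Qed.

(** [T h] moves the integral that represents [J1 x] from ]0, +oo[ to ]h, +oo[, so the difference is
    what remains over ]0, h]. This gives both the relation to the generator and the approximation of
    [J1] by [T h] composed with [J1]. *)
Lemma frac1_shift h x : 0 < h ->
  weak_integral `]0%R, h] (T^~ x) (J1 x - T h (J1 x)).
Proof.
move=> h0 phi /[dup] dphi [lphi _].
have mD : measurable D0 by exact: measurable_itv.
have [i1 E1] := frac1_weak_integral x dphi.
have D0U : D0 = `]0%R, h] `|` `]h, +oo[ :> set R.
  apply/seteqP; split => t /=; rewrite !in_itv/= !andbT.
    by move=> t0; have [th|th] := leP t h; [left; rewrite t0|right].
  by move=> [/andP[]//|]; exact: lt_trans.
have sub1 : `]0%R, h] `<=` D0 by rewrite D0U => t; left.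
have sub2 : `]h, +oo[ `<=` D0 by rewrite D0U => t; right.
have i3 : mu.-integrable `]h, +oo[ (EFin \o (phi \o T^~ x)).
  by apply: (integrableS _ _ _ i1) => //; exact: measurable_itv.
have i2 : mu.-integrable `]0%R, h] (EFin \o (phi \o T^~ x)).
  by apply: (integrableS _ _ _ i1) => //; exact: measurable_itv.
split => //.
have E3 : (\int[mu]_(t in `]h, +oo[) (phi (T t x))%:E)%E = (phi (T h (J1 x)))%:E.
  have bT := semigroup_bounded_linear (ltW h0).
  have [_ <-] := weak_integral_linear bT (frac1_weak_integral x) dphi.
  have [_ ->] := integral_affine (a := 1) h (oner_neq0 _) (measurable_itv _) i3.
  rewrite normr1 mul1e.
  rewrite (_ : (fun _ => _) @^-1` _ = D0); last first.
    by apply/seteqP; split => t /=; rewrite !in_itv/= !andbT mul1r ltrDr.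
  apply: eq_integral => t; rewrite inE/= in_itv/= andbT => t0.
  by rewrite mul1r addrC semigroupD// ltW.
have : (\int[mu]_(t in D0) (phi (T t x))%:E = \int[mu]_(t in `]0%R, h]) (phi (T t x))%:E +
   \int[mu]_(t in `]h, +oo[) (phi (T t x))%:E)%E.
  rewrite D0U; apply: integral_setU => //.
  - by rewrite -D0U; exact: measurable_int i1.
  - apply/disj_setPS => t [] /=; rewrite !in_itv/= andbT => /andP[_ th].
    by rewrite ltNge th.
rewrite E1 E3 (linB _ _ lphi).
rewrite -(@fineK _ (\int[mu]_(t in `]0%R, h]) (phi (T t x))%:E)%E); last first.
  exact: integrable_fin_num.
by rewrite -EFinD => -[->]; congr EFin; rewrite -[RHS]/((_ + _ : R) - _) addrK.
Qed.

Lemma weak_integral_near (f : R -> X) (h e : R) (x v : X) : 0 < h ->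
  (forall t, 0 < t <= h -> `|f t - x| <= e) ->
  weak_integral `]0%R, h] f v -> `|h^-1 *: v - x| <= e.
Proof.
move=> h0 fx fv.
have mI : measurable (`]0%R, h]%classic : set R) by exact: measurable_itv.
have muI : mu (`]0%R, h]%classic : set R) = h%:E.
  by rewrite lebesgue_measure_itv/= lte_fin h0 oppr0 adde0.
have ci (c : R) : mu.-integrable `]0%R, h] (EFin \o cst c).
  apply: measurable_bounded_integrable => //.
    by have := ltry h; rewrite -muI.
  exists `|c|; split; first exact: num_real.
  by move=> y cy t _ /=; exact: ltW.
have cint (c : R) : (\int[mu]_(t in `]0%R, h]) (cst c t)%:E = (c * h)%:E)%E.
  rewrite -[LHS]/(\int[mu]_(t in `]0%R, h]) cst c%:E t)%E integral_cst//.
  by rewrite EFinM; congr (_ * _)%E; exact: muI.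
have wc : weak_integral `]0%R, h] (cst x) (h *: x).
  move=> phi [lphi _]; split; first exact: (ci (phi x)).
  by rewrite (linZ _ _ lphi) (cint (phi x)) mulrC.
have hv : `|v - h *: x| <= e * h.
  apply: (weak_integral_norm_le (k := cst e) mI _ (ci e) _ (weak_integralB mI fv wc)).
    by move=> t /=; rewrite in_itv/=; exact: fx.
  by rewrite cint.
rewrite (_ : h^-1 *: v - x = h^-1 *: (v - h *: x)); last first.
  by rewrite scalerBr scalerA mulVf ?scale1r// gt_eqF.
by rewrite normrZ gtr0_norm ?invr_gt0// mulrC ler_pdivrMr.
Qed.

Lemma frac1_near x e : 0 < e -> exists2 d, 0 < d & forall h, 0 < h < d ->
  `|h^-1 *: (J1 x - T h (J1 x)) - x| <= e.
Proof.
move=> e0; have [d d0 dP] := semigroup_cvg0 x e0; exists d => // h /andP[h0 hd].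
apply: weak_integral_near h0 _ (frac1_shift x h0) => t /andP[t0 th].
by rewrite ltW// dP// ltW//= (le_lt_trans th).
Qed.

(** * The operator A and its inverse *)

Section Generator.
Variables (DA : set X) (A : X -> X).
Hypotheses (hA : linear_operator DA A) (hgen : neg_generates DA A T).

(** By the shift formula the quotient of the orbit of [J1 x] at 0 is minus the mean of [T s x] over
    ]0, t], which tends to -x. Thus [J1] is a right inverse of [A]. *)
Lemma frac1_domain x : DA (J1 x) /\ A (J1 x) = x.
Proof.
suff /hgen[? /oppr_inj] : t^-1 *: (T t (J1 x) - J1 x) @[t --> 0^'+] --> - x by [].
apply/cvgrPdist_le => e e0; have [d d0 dP] := frac1_near x e0.
exists d => // t /= td t0; rewrite sub0r normrN gtr0_norm// in td.
rewrite -scalerN opprB addrC; apply: dP.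
by rewrite t0.
Qed.

(** [J1] is also a left inverse: since it commutes with [T t], its values on the quotients at [y]
    tend to -y by the shift formula, and to [J1 (- A y)] by continuity. *)
Lemma generator_inj y : DA y -> J1 (A y) = y.
Proof.
move=> DAy.
have /hgen lim : DA y /\ - A y = - A y by [].
have [lJ cJ] := frac_bounded_linear ltr01 (lexx 1).
have lim1 : J1 (t^-1 *: (T t y - y)) @[t --> 0^'+] --> J1 (- A y).
  by apply: continuous_cvg => //; exact: cJ.
have lim2 : J1 (t^-1 *: (T t y - y)) @[t --> 0^'+] --> - y.
  apply/cvgrPdist_le => e e0; have [d d0 dP] := frac1_near y e0.
  exists d => // t /= td t0; rewrite sub0r normrN gtr0_norm// in td.
  rewrite (linZ _ _ lJ) (linB _ _ lJ).
  rewrite (frac_comm ltr01 (lexx 1) (semigroup_bounded_linear (ltW t0))); last first.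
    by move=> s s0; rewrite semigroup_comm// ltW.
  by rewrite -scalerN opprB addrC; apply: dP; rewrite t0.
have : J1 (- A y) = - y by exact: cvg_unique lim1 lim2.
by rewrite (linN _ lJ) => /oppr_inj.
Qed.

End Generator.

Lemma opnorm_ge {V W : normedModType R} (K : V -> W) x :
  bounded_linear K -> `|K x| <= opnorm K * `|x|.
Proof.
move=> /[dup] [[lK _]] /bounded_linear_bound[c c0 cP].
have [->|x0] := eqVneq x 0; first by rewrite (lin0 lK) !normr0 mulr0.
have x0' : 0 < `|x| by rewrite normr_gt0.
rewrite -ler_pdivrMr// mulrC -[X in X * _]gtr0_norm ?invr_gt0// -normrZ -(linZ _ _ lK).
apply: ub_le_sup.
  exists c => _ [y /= y1 <-]; rewrite (le_trans (cP y))// -[leRHS]mulr1.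
  by rewrite ler_pM2l.
exists (`|x|^-1 *: x) => //=.
by rewrite normrZ gtr0_norm ?invr_gt0// mulVf// gt_eqF.
Qed.

Lemma opnorm_ge0 {V W : normedModType R} (K : V -> W) : bounded_linear K -> 0 <= opnorm K.
Proof.
move=> /[dup] [[lK _]] /bounded_linear_bound[c c0 cP].
apply: ub_le_sup.
  exists c => _ [y /= y1 <-]; rewrite (le_trans (cP y))// -[leRHS]mulr1.
  by rewrite ler_pM2l.
by exists 0; rewrite /= ?normr0 ?ler01// (lin0 lK) normr0.
Qed.

(** * The inverse of I - T(omega) *)

Section PeriodResolvent.
Variable omega : R.
Hypothesis omega0 : 0 < omega.
Notation Rinv := (inverse_op (fun x => x - T omega x)).

Let q := expR (- nu * omega).

Let q01 : 0 < q < 1.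
Proof. by rewrite expR_gt0 -expR0 ltr_expR mulNr oppr_lt0 mulr_gt0. Qed.

Let iterT (n : nat) x := T (n%:R * omega) x.

Let iterT_le n x : `|iterT n x| <= M * q ^+ n * `|x|.
Proof.
have n0 : 0 <= n%:R * omega by rewrite mulr_ge0// ltW.
by rewrite (le_trans (TM _ n0))// /q -expRM_natl mulrCA.
Qed.

Let iterTS n x : iterT n.+1 x = T omega (iterT n x).
Proof.
by rewrite /iterT -natr1 mulrDl mul1r addrC semigroupD ?mulr_ge0// ltW.
Qed.

(** Neumann series. [T omega] may have norm above 1 because of [M], but its n-th power T(n omega) is
    at most M q^n with q = exp(-nu omega) < 1, so the series converges; its partial sums telescope
    under I - T(omega). *)
Lemma period_resolvent_ex y : exists2 x, x - T omega x = y & `|x| <= M / (1 - q) * `|y|.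
Proof.
have /andP[q0 q1] := q01.
have [lT cT] := semigroup_bounded_linear (ltW omega0).
pose S := series (iterT^~ y).
have Sq n : `|S n| <= M / (1 - q) * `|y|.
  apply: (@le_trans _ _ (series (geometric (M * `|y|) q) n)).
    rewrite /S /series /= (le_trans (ler_norm_sum _ _ _))// ler_sum// => i _.
    by rewrite (le_trans (iterT_le _ _))// mulrAC.
  rewrite geometric_seriesE ?lt_eqF// mulrAC ler_pM2r ?invr_gt0 ?subr_gt0//.
  by rewrite -[leRHS]mulr1 ler_wpM2l ?mulr_ge0// gerBl exprn_ge0// (ltW q0).
have /cvg_ex[x Sx] : cvgn S.
  apply: normed_cvg; apply: (@series_le_cvg _ _ (geometric (M * `|y|) q)).
  - by move=> n /=.
  - by move=> n; rewrite /= mulr_ge0 ?mulr_ge0 ?exprn_ge0// ltW.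
  - by move=> n; rewrite /= (le_trans (iterT_le _ _))// mulrAC.
  - by apply: is_cvg_geometric_series; rewrite ger0_norm// ltW.
exists x; last first.
  apply/ler_addgt0Pr => e e0.
  have /cvgrPdist_le/(_ e e0)[N _ /(_ N (leqnn N)) SN] := Sx.
  rewrite -(subrK (S N) x) (le_trans (ler_normD _ _))// addrC lerD//.
have TS n : S n - T omega (S n) = y - iterT n y.
  elim: n => [|n IH].
    by rewrite /S /series /= big_geq// (lin0 lT) subrr /iterT mul0r semigroup0 subrr.
  rewrite /S /series /= big_nat_recr//= -/(series _ _) -/(S n).
  rewrite (linD _ _ lT) opprD addrACA IH -iterTS.
  by rewrite addrA subrK.
have lim1 : S n - T omega (S n) @[n --> \oo] --> x - T omega x.
  by apply: cvgB => //; apply: continuous_cvg => //; exact: cT.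
have lim2 : S n - T omega (S n) @[n --> \oo] --> y.
  rewrite (_ : (fun n => _) = (fun n => y - iterT n y)); last exact/funext.
  rewrite -[X in _ --> X]subr0; apply: cvgB; first exact: cvg_cst.
  apply/cvgrPdist_le => e e0.
  have qn : M * q ^+ n * `|y| @[n --> \oo] --> M * 0 * `|y|.
    apply: cvgM; last exact: cvg_cst.
    apply: cvgM; first exact: cvg_cst.
    by apply: cvg_expr; rewrite ger0_norm// ltW.
  rewrite mulr0 mul0r in qn.
  have /cvgrPdist_le/(_ e e0) := qn; apply: filterS => n.
  rewrite !sub0r !normrN; apply: le_trans.
  by rewrite (le_trans (iterT_le _ _))// ler_norm.
exact: cvg_unique lim1 lim2.
Qed.

(** The difference z is fixed by [T omega], hence |z| <= M q^n |z| for all n. Injectivity is what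
    identifies the preimage chosen by [inverse_op]. *)
Lemma period_resolvent_inj x y : x - T omega x = y - T omega y -> x = y.
Proof.
have lT := semigroup_linear (ltW omega0); have /andP[q0 q1] := q01.
move=> xy; pose z := x - y.
have zT : T omega z = z.
  rewrite /z (linB _ _ lT); apply/eqP; rewrite eq_sym subr_eq addrAC eq_sym subr_eq.
  by move/eqP: xy; rewrite subr_eq addrAC eq_sym subr_eq [y + _]addrC.
have ziter n : iterT n z = z.
  by elim: n => [|n IH]; [rewrite /iterT mul0r semigroup0|rewrite iterTS IH zT].
apply/eqP; rewrite -subr_eq0 -/z -normr_le0 leNgt; apply/negP => z0.
have qn : M * q ^+ n @[n --> \oo] --> M * 0.
  apply: cvgM; first exact: cvg_cst.
  by apply: cvg_expr; rewrite ger0_norm// ltW.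
rewrite mulr0 in qn.
have /cvgrPdist_lt/(_ 1 ltr01)[N _ /(_ N (leqnn N))] := qn.
rewrite /= sub0r normrN ger0_norm ?mulr_ge0 ?exprn_ge0 ?(ltW q0)//.
apply/negP; rewrite -leNgt -(ler_pM2r z0) mul1r -{1}(ziter N).
exact: iterT_le.
Qed.

Lemma period_resolventK y : Rinv y - T omega (Rinv y) = y.
Proof.
have [x xy _] := period_resolvent_ex y.
exact: (xgetPex 0 (ex_intro (fun x => x - T omega x = y) x xy)).
Qed.

Lemma period_resolventKr x : Rinv (x - T omega x) = x.
Proof. by apply: period_resolvent_inj; rewrite period_resolventK. Qed.

Lemma period_resolvent_comm K x : linear K ->
  (forall x, K (T omega x) = T omega (K x)) -> K (Rinv x) = Rinv (K x).
Proof.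
move=> lK KT; apply: period_resolvent_inj.
by rewrite period_resolventK -KT -(linB _ _ lK) period_resolventK.
Qed.

Lemma period_resolvent_bounded_linear : bounded_linear Rinv.
Proof.
have lT := semigroup_linear (ltW omega0).
apply: (@bounded_linear_intro _ _ _ _ (M / (1 - q))).
  move=> a x y; apply: period_resolvent_inj.
  rewrite period_resolventK (linD _ _ lT) (linZ _ _ lT) opprD addrACA.
  by rewrite -scalerBr !period_resolventK.
move=> y; have [x xy xle] := period_resolvent_ex y.
by rewrite -{1}xy period_resolventKr.
Qed.

End PeriodResolvent.

(** * Analyticity and the domain of A *)

Section AnalyticDomain.
Variables (DA : set X) (A : X -> X).
Hypotheses (hgen : neg_generates DA A T) (hana : analytic_semigroup T).

(** The complex derivative of the extension at [t], taken along positive real increments and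
    evaluated at (x, 0), has as first component the right derivative of the orbit at [t]. Its
    existence is membership in the domain of the generator. *)
Lemma analytic_domain t x : 0 < t -> DA (T t x).
Proof.
move=> t0; have [theta [S [th [_ SE _ hol _]]]] := hana.
have tsec : sector theta (t%:C)%C.
  split => //=; rewrite normr0 mulr_gt0//.
  have /andP[th0 th1] := th.
  by rewrite -tan0 ltr_tan// in_itv/=; lra.
have [S' [_ _ S'P]] := hol _ tsec.
suff /hgen[] : h^-1 *: (T h (T t x) - T t x) @[h --> 0^'+] --> (S' (x, 0)).1 by [].
(* The error of the derivative is uniform relative to |p|, so [e] is divided by |(x, 0)|; adding 1
   covers x = 0. *)
apply/cvgrPdist_le => e e0; pose e' := e / (`|(x, 0 : X)| + 1).
have n1 : 0 < `|(x, 0 : X)| + 1 by rewrite ltr_wpDl.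
have e'0 : 0 < e' by rewrite divr_gt0.
have [d d0 dP] := S'P _ e'0.
exists d => // h /= hd h0; rewrite sub0r normrN gtr0_norm// in hd.
have := dP (h%:C)%C; rewrite /= expr0n addr0 sqrtr_sqr gtr0_norm// => /(_ hd (x, 0)).
have -> : ((t%:C + h%:C) = (t + h)%:C)%C by rewrite raddfD.
rewrite !SE//; last by rewrite addr_gt0.
move=> le.
have le1 : `|T (t + h) x - T t x - h *: (S' (x, 0)).1| <= e' * h * `|(x, 0 : X)|.
  apply: le_trans le; rewrite prod_normE/= le_max; apply/orP; left.
  by rewrite /cscale /= scale0r subr0.
rewrite distrC -(ler_pM2l h0) -[X in X * `|_|](gtr0_norm h0) -normrZ scalerBr.
rewrite scalerA divff ?gt_eqF// scale1r -(semigroupD _ (ltW h0) (ltW t0)) (addrC h t).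
rewrite (le_trans le1)// -mulrA mulrCA ler_pM2l// /e' -mulrA ger_pMr//.
by rewrite mulrC ler_pdivrMr// mul1r lerDl.
Qed.

End AnalyticDomain.

(** * The operators A^alpha T(t) *)

Section AlphaPower.
Variables (DA : set X) (A : X -> X) (alpha : R).
Hypotheses (hA : linear_operator DA A) (hgen : neg_generates DA A T).
Hypothesis hana : analytic_semigroup T.
Hypothesis halpha : 0 <= alpha < 1.
Notation J := (fracpow_neg T alpha).
Notation J' := (fracpow_neg T (1 - alpha)).

Let alpha1 : alpha < 1. Proof. by case/andP: halpha. Qed.

Let oneB0 : 0 < 1 - alpha. Proof. by rewrite subr_gt0. Qed.

Let oneB1 : 1 - alpha <= 1. Proof. by rewrite gerBl; case/andP: halpha. Qed.

(** The integral formula concerns positive exponents; at 0 the power is the identity by definition.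
    The basic facts on [J] are therefore proved by cases. *)
Let alpha_cases : alpha = 0 \/ 0 < alpha.
Proof. by case/andP: halpha; rewrite le_eqVlt => /predU1P[<-|]; [left|right]. Qed.

Lemma fracpow_neg0 : fracpow_neg T 0 = id.
Proof. by apply/funext => x; rewrite /fracpow_neg eqxx. Qed.

Lemma alpha_bounded_linear : bounded_linear J.
Proof.
have [->|a0] := alpha_cases; last by apply: frac_bounded_linear => //; exact: ltW.
by rewrite fracpow_neg0; split => // x; exact: cvg_id.
Qed.

Lemma alphac_bounded_linear : bounded_linear J'.
Proof. exact: frac_bounded_linear. Qed.

Lemma alpha_comp x : J (J' x) = J1 x.
Proof.
have [->|a0] := alpha_cases; last exact: frac_comp.
by rewrite fracpow_neg0 subr0.
Qed.

Lemma alpha_comm K x : bounded_linear K ->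
  (forall t x, 0 <= t -> K (T t x) = T t (K x)) -> J (K x) = K (J x).
Proof.
move=> bK KT; have [->|a0] := alpha_cases; first by rewrite fracpow_neg0.
by apply: frac_comm => //; [exact: ltW|move=> t; exact: KT].
Qed.

(** A^{alpha-1} A^{-alpha} = A^{-1}, and A^{-1} is injective because A undoes it. *)
Lemma alpha_inj x y : J x = J y -> x = y.
Proof.
have [->|a0] := alpha_cases; first by rewrite fracpow_neg0.
move=> Jxy.
have J1xy : J1 x = J1 y.
  have a'1 : 1 - alpha < 1 by rewrite gtrBl.
  have aE : 1 - (1 - alpha) = alpha by ring.
  have h z := frac_comp z oneB0 a'1; rewrite aE in h.
  have factor (f g k : X -> X) : (forall z, f (g z) = k z) -> g x = g y -> k x = k y.
    by move=> fg gxy; rewrite -!fg gxy.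
  refine (factor _ _ _ h Jxy).
have [_ <-] := frac1_domain hgen x; have [_ <-] := frac1_domain hgen y.
by rewrite J1xy.
Qed.

Lemma alphaK x : fracpow T alpha (J x) = x.
Proof.
apply: alpha_inj.
exact: (xgetPex 0 (ex_intro (fun y => J y = J x) x erefl)).
Qed.

Lemma fracnormE x : fracnorm T alpha (J x) = `|x|.
Proof. by rewrite /fracnorm alphaK. Qed.

Definition alphaT t x := fracpow T alpha (T t x).

(** By analyticity [T t x] lies in D(A), so it equals A^{-1} A T(t) x = A^{-alpha} A^{alpha-1} A
    T(t) x. It is thus in the range of [J], where [fracpow] is a true inverse. *)
Lemma alphaTK t x : 0 < t -> J (alphaT t x) = T t x.
Proof.
move=> t0; rewrite /alphaT.
have DAx : DA (T t x) by exact: analytic_domain.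
by rewrite -{1 2}(generator_inj hgen DAx) -alpha_comp alphaK.
Qed.

Lemma alphaT_linear t : 0 < t -> linear (alphaT t).
Proof.
move=> t0 a x y; apply: alpha_inj; have [lJ _] := alpha_bounded_linear.
by rewrite alphaTK// lJ !alphaTK// (semigroup_linear (ltW t0)).
Qed.

Lemma alphaTD s t x : 0 < s -> 0 <= t -> alphaT (s + t) x = alphaT s (T t x).
Proof. by move=> s0 t0; rewrite /alphaT semigroupD// ltW. Qed.

Section bound.
Variable Malpha : R.
Hypothesis Malpha0 : 0 < Malpha.
Hypothesis hAT : forall t x, 0 < t ->
  `|fracpow T alpha (T t x)| <= Malpha * t `^ (- alpha) * `|x|.

(** For s near t, A^alpha T(s) = A^alpha T(t/2) T(s - t/2): a fixed bounded operator after a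
    strongly continuous family. *)
Lemma alphaT_cont (f : R -> X) t : continuous f -> 0 < t ->
  {for t, continuous (fun s => alphaT s (f s))}.
Proof.
move=> cf t0; have t20 : 0 < t / 2 by rewrite divr_gt0.
have cg : continuous (fun s => extT (s - t / 2) (f s)).
  have cg' : continuous (fun r => extT r (f (r + t / 2))).
    apply: (@extT_cont (fun r => f (r + t / 2))) => r.
    apply: continuous_comp; last exact: cf.
    by apply: cvgD; [exact: cvg_id|exact: cvg_cst].
  move=> s.
  have := continuous_comp (f := fun s => s - t / 2)
    (g := fun r => extT r (f (r + t / 2))) (x := s) _ (cg' (s - t / 2)).
  rewrite (_ : _ \o _ = fun s => extT (s - t / 2) (f s)); last first.
    by apply/funext => u /=; rewrite subrK.
  by apply; apply: cvgB; [exact: cvg_id|exact: cvg_cst].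
have bE : bounded_linear (alphaT (t / 2)).
  apply: (@bounded_linear_intro _ _ _ _ (Malpha * (t / 2) `^ (- alpha))).
    exact: alphaT_linear.
  by move=> x; exact: hAT.
have cE : {for t, continuous (fun s => alphaT (t / 2) (extT (s - t / 2) (f s)))}.
  by apply: (continuous_comp (cg t)); case: bE => _; exact.
apply: cvg_trans; last first.
  rewrite (_ : alphaT t (f t) = alphaT (t / 2) (extT (t - t / 2) (f t))).
    exact: cE.
  rewrite extTE; last by lra.
  by rewrite -alphaTD//; [congr (alphaT _ _); ring|lra].
apply: near_eq_cvg; near=> s.
have s2 : t / 2 <= s.
  by apply: ltW; near: s; apply: lt_nbhsr; lra.
rewrite extTE ?subr_ge0// -alphaTD ?subr_ge0//; congr (alphaT _ _); ring.
Unshelve. all: by end_near. Qed.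

Lemma powRN_integral w : 0 < w ->
  (\int[mu]_(t in `]0%R, w]) (t `^ (- alpha))%:E)%E = (w `^ (1 - alpha) / (1 - alpha))%:E.
Proof.
move=> w0; rewrite -integral_powR//.
have e : - alpha = 1 - alpha - 1 by ring.
by apply: eq_integral => t _; rewrite -e.
Qed.

Lemma powRN_integrable w c : 0 < w ->
  mu.-integrable `]0%R, w] (EFin \o (fun t => c * t `^ (- alpha))).
Proof.
move=> w0.
have pi : mu.-integrable `]0%R, w] (EFin \o (fun t => t `^ (- alpha))).
  apply/integrableP; split; first exact: measurable_powR_EFin.
  under eq_integral do rewrite /= ger0_norm ?powR_ge0//.
  by rewrite powRN_integral// ltry.
by apply: eq_integrable (integrableZl _ c pi) => // t _.
Qed.

(* Integrating A^alpha T(s) directly makes the closedness of A^alpha unnecessary: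
   apply A^{-alpha} to the result and use its injectivity. *)
Lemma alphaT_weak_integral (f : R -> X) (w B : R) : 0 < w -> continuous f ->
  (forall t, `|f t| <= B) ->
  exists z, weak_integral `]0%R, w] (fun s => alphaT s (f s)) z.
Proof.
move=> w0 cf fB; have B0 : 0 <= B by rewrite (le_trans _ (fB 0)).
have [|||||z [_ wz]] := @right_continuous_bochner _ _ `]0%R, w]
  (fun s => alphaT s (f s)) (fun t => Malpha * B * t `^ (- alpha)).
- exact: measurable_itv.
- move=> t /=; rewrite in_itv/= => /andP[t0 _].
  by apply: cvg_at_right_filter; exact: alphaT_cont.
- exact: powRN_integrable.
- by move=> t _; rewrite mulr_ge0 ?powR_ge0// mulr_ge0// ltW.
- move=> t c /=; rewrite in_itv/= => /andP[t0 _] tc.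
  rewrite (le_trans (hAT _ (lt_trans t0 tc)))// mulrAC ler_pM ?powR_ge0//.
  + by rewrite mulr_ge0// ltW.
  + by rewrite ler_wpM2l// ltW.
  + by rewrite powR_nonincr ?oppr_le0 ?(ltW tc)//; case/andP: halpha.
by exists z.
Qed.

(** Integrating [Malpha] s^(-alpha) over ]0, w] produces the factor w^(1-alpha) / (1 - alpha) of
    (H6). *)
Lemma alphaT_integral_dist (f g : R -> X) (w c : R) (y z : X) : 0 < w ->
  (forall t, `|f t - g t| <= c) ->
  weak_integral `]0%R, w] (fun s => alphaT s (f s)) y ->
  weak_integral `]0%R, w] (fun s => alphaT s (g s)) z ->
  `|y - z| <= Malpha * (w `^ (1 - alpha) / (1 - alpha)) * c.
Proof.
move=> w0 fg wy wz; have c0 : 0 <= c by rewrite (le_trans _ (fg 0)).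
have mI : measurable (`]0%R, w]%classic : set R) by exact: measurable_itv.
apply: (weak_integral_norm_le (k := fun t => Malpha * c * t `^ (- alpha)) mI _ _ _
  (weak_integralB mI wy wz)).
- move=> t /=; rewrite in_itv/= => /andP[t0 _].
  rewrite -(linB _ _ (alphaT_linear t0)) (le_trans (hAT _ t0))// mulrAC.
  by rewrite ler_wpM2r ?powR_ge0// ler_wpM2l// ltW.
- exact: powRN_integrable.
- under eq_integral do rewrite EFinM.
  rewrite ge0_integralZl_EFin//; last 3 first.
  + by move=> t _; rewrite lee_fin powR_ge0.
  + exact: measurable_powR_EFin.
  + by rewrite mulr_ge0// ltW.
  by rewrite powRN_integral// -EFinM lee_fin mulrAC.
Qed.

End bound.
End AlphaPower.

Lemma extT_continuous_shift (f : R -> X) c : continuous f ->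
  continuous (fun s => extT s (f (c - s))).
Proof.
move=> cf; apply: (@extT_cont (fun s => f (c - s))) => s.
by apply: continuous_comp; [apply: cvgB; [exact: cvg_cst|exact: cvg_id]|exact: cf].
Qed.

(** * Convolution with the semigroup *)

Section Convolution.

(** In the variable c - s this is the integral of T(c - s) f(s) over [c - r, c[. The length [r] and
    the end point [c] are kept separate: splitting changes the first, difference quotients only the
    second. *)
Definition conv (f : R -> X) (r c : R) : X :=
  xget 0 [set v | weak_integral `]0%R, r] (fun s => T s (f (c - s))) v].

Lemma conv_weak_integral f B r c : continuous f -> (forall t, `|f t| <= B) ->
  weak_integral `]0%R, r] (fun s => T s (f (c - s))) (conv f r c).
Proof.
move=> cf fB; have B0 : 0 <= B by rewrite (le_trans _ (fB 0)).
have [||||v [_ wv]] := @continuous_bochner _ _ `]0%R, r] (fun s => extT s (f (c - s))) (M * B).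
- exact: measurable_itv.
- by rewrite lebesgue_measure_itv/=; case: ifPn => // _; rewrite -EFinB ltry.
- exact: extT_continuous_shift.
- move=> t; rewrite (le_trans (semigroup_le _ _)) ?le_max ?lexx//.
  by rewrite ler_wpM2l.
have wv' : weak_integral `]0%R, r] (fun s => T s (f (c - s))) v.
  apply: (eq_weak_integral _ _ wv) => [|s]; first exact: measurable_itv.
  by rewrite /= in_itv/= => /andP[s0 _]; rewrite extTE// ltW.
exact: (xgetPex 0 (ex_intro (fun v => weak_integral `]0%R, r] (fun s => T s (f (c - s))) v) v wv')).
Qed.

Lemma conv_le f B r c : continuous f -> 0 <= r -> (forall t, `|f t| <= B) ->
  `|conv f r c| <= M * B * r.
Proof.
move=> cf r0 fB; have B0 : 0 <= B by rewrite (le_trans _ (fB 0)).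
have wc := conv_weak_integral r c cf fB.
rewrite -[X in _ * X]subr0; apply: weak_integral_itv_le wc => //; last by rewrite mulr_ge0.
move=> t /andP[/ltW t0 _]; rewrite (le_trans (semigroup_le _ t0))//.
by rewrite ler_wpM2l.
Qed.

(** On ]a, a + b] the factor T(a) comes out and the remaining integral is shifted back to ]0, b]. *)
Lemma conv_split f B a b c : continuous f -> (forall t, `|f t| <= B) -> 0 < a -> 0 < b ->
  conv f (a + b) c = conv f a c + T a (conv f b (c - a)).
Proof.
move=> cf fB a0 b0.
have mI u v : measurable (`]u, v]%classic : set R) by exact: measurable_itv.
have Iab : `]0%R, a + b]%classic = `]0%R, a] `|` `]a, a + b] :> set R.
  apply/seteqP; split => t /=; rewrite !in_itv/=.
    by move=> /andP[t0 tab]; have [ta|ta] := leP t a; [left; rewrite t0|right].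
  by move=> [|] /andP[h1 h2]; apply/andP; split; lra.
apply: (@weak_integral_setU _ _ `]0%R, a] `]a, a + b] (fun s => T s (f (c - s)))) => //.
- by apply/disj_setPS => t [] /=; rewrite !in_itv/= => /andP[_ h1] /andP[h2 _]; lra.
- by rewrite -Iab; exact: conv_weak_integral cf fB.
- exact: conv_weak_integral cf fB.
have wb := weak_integral_linear (semigroup_bounded_linear (ltW a0))
  (conv_weak_integral b (c - a) cf fB).
have := weak_integral_affine (- a) (oner_neq0 R) (mI _ _) wb.
rewrite normr1 invr1 scale1r (_ : _ @^-1` _ = `]a, a + b]%classic); last first.
  by apply/seteqP; split => t /=; rewrite !in_itv/= mul1r => /andP[h1 h2]; apply/andP; split; lra.
apply: eq_weak_integral => // t /=; rewrite in_itv/= mul1r => /andP[h1 h2].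
rewrite -semigroupD ?(ltW a0)//; last by lra.
by congr (T _ (f _)); ring.
Qed.

Lemma lipschitz_cont (f : R -> X) L :
  (forall x y, `|f x - f y| <= L * `|x - y|) -> continuous f.
Proof.
move=> fL t; apply/cvgrPdist_lt => e e0.
have L0 : 0 <= L by have := fL 1 0; rewrite subr0 normr1 mulr1; exact: le_trans.
have L1 : 0 < L + 1 by rewrite ltr_wpDl.
near=> s; rewrite (le_lt_trans (fL _ _))//.
have : `|t - s| < e / (L + 1).
  by near: s; apply: cvgr_dist_lt; [exact: cvg_id|rewrite divr_gt0].
rewrite ltr_pdivlMr// => ts; rewrite (le_lt_trans _ ts)// mulrC ler_wpM2l//.
by rewrite lerDl.
Unshelve. all: by end_near. Qed.

Lemma quotient_cont (f : R -> X) (h : R) :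
  continuous f -> continuous (fun s : R => h^-1 *: (f (s + h) - f s)).
Proof.
move=> cf s; apply: cvgZ; first exact: cvg_cst.
apply: cvgB; last exact: cf.
by apply: continuous_comp; [apply: cvgD; [exact: cvg_id|exact: cvg_cst]|exact: cf].
Qed.

Lemma quotient_le (f : R -> X) L h s : (forall x y, `|f x - f y| <= L * `|x - y|) ->
  h != 0 -> `|h^-1 *: (f (s + h) - f s)| <= L.
Proof.
move=> fL h0; rewrite normrZ normfV ler_pdivrMl ?normr_gt0// mulrC.
by have := fL (s + h) s; have -> : s + h - s = h by ring.
Qed.

(** [conv] is linear in [f] and commutes with translations, so quotients pass to [f], where the
    Lipschitz constant bounds them. *)
Lemma conv_quotient f B r t h : continuous f -> (forall t, `|f t| <= B) ->
  h^-1 *: (conv f r (t + h) - conv f r t) =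
  conv (fun s => h^-1 *: (f (s + h) - f s)) r t.
Proof.
move=> cf fB; have mI : measurable (`]0%R, r]%classic : set R) by exact: measurable_itv.
have gB s : `|h^-1 *: (f (s + h) - f s)| <= `|h^-1| * (B + B).
  by rewrite normrZ ler_wpM2l// (le_trans (ler_normB _ _))// lerD.
apply: (weak_integral_unique _ (conv_weak_integral r t (quotient_cont (h := h) cf) gB)).
have := weak_integralZ h^-1 mI (weak_integralB mI
  (conv_weak_integral r (t + h) cf fB) (conv_weak_integral r t cf fB)).
apply: eq_weak_integral => // s; rewrite /= in_itv/= => /andP[/ltW s0 _].
have lT := semigroup_linear s0.
by rewrite (linZ _ _ lT) (linB _ _ lT) addrAC.
Qed.

Lemma conv_lipschitz f B L r x y : (forall t, `|f t| <= B) -> 0 <= r ->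
  (forall x y, `|f x - f y| <= L * `|x - y|) ->
  `|conv f r x - conv f r y| <= M * L * r * `|x - y|.
Proof.
move=> fB r0 fL; have cf := lipschitz_cont fL.
have [->|xy] := eqVneq x y; first by rewrite !subrr !normr0 mulr0.
have h0 : x - y != 0 by rewrite subr_eq0.
rewrite mulrC -ler_pdivrMl ?normr_gt0// -normfV -normrZ.
rewrite -{2}(subrKC y x) (conv_quotient r y (x - y) cf fB).
by apply: conv_le => //; [exact: quotient_cont|move=> t; exact: quotient_le].
Qed.

End Convolution.

(** * Compactness and differentiability of the two parts of the solution *)

Section AlmostEverywhereDerivable.
Hypothesis hcpt : compact_semigroup T.

(** The quotient of [J1 o w] is [J1 b] with |b| <= L. By [frac1_shift] it differs from
    [T eps (J1 b)] by the integral of T(s) b over ]0, eps], at most M L eps. *)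
Lemma frac1_ae_derivable (w : R -> X) L : (forall x y, `|w x - w y| <= L * `|x - y|) ->
  {ae mu, forall t, derivable (J1 \o w) t 1}.
Proof.
move=> wL.
have L0 : 0 <= L by have := wL 1 0; rewrite subr0 normr1 mulr1; exact: le_trans.
have bJ : bounded_linear J1 := frac_bounded_linear ltr01 (lexx 1).
have [lJ _] := bJ; have [c c0 Jc] := bounded_linear_bound bJ.
apply: (@near_compact_ae_derivable _ _ _ (c * L)) => [x y|e e0].
  by rewrite /= -(linB _ _ lJ) (le_trans (Jc _))// -mulrA ler_pM2l.
have ML : 0 < M * L + 1 by rewrite ltr_wpDl// mulr_ge0.
pose eps := e / (M * L + 1).
have eps0 : 0 < eps by rewrite divr_gt0.
(* The bound on the quotients of [w] holds for every nonzero increment, so the radius 1 is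
   arbitrary. *)
exists (T eps), (c * L), 1; split=> //; first exact: hcpt.
move=> t h /andP[h0 _]; rewrite normr_gt0 in h0.
pose b := h^-1 *: (w (t + h) - w t).
have bL : `|b| <= L := quotient_le t wL h0.
exists (J1 b); first by rewrite (le_trans (Jc _))// ler_pM2l.
rewrite /= -(linB _ _ lJ) -(linZ _ _ lJ) -/b.
apply: le_trans (weak_integral_itv_le (B := M * L) (ltW eps0) _ _ (frac1_shift b eps0)) _.
- move=> s /andP[/ltW s0 _]; rewrite (le_trans (semigroup_le _ s0))//.
  by rewrite ler_wpM2l.
- by rewrite mulr_ge0.
- by rewrite subr0 /eps mulrCA ger_pMr// ler_pdivrMr// mul1r lerDl.
Qed.

(** Splitting the convolution of the quotients of [f] at eps leaves T(eps) applied to a bounded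
    convolution and a piece over ]0, eps] of norm at most M L eps. [K] stands for (I -
    T(omega))^{-1}; commuting with the semigroup, it lets T(eps) be the outermost operator. *)
Lemma conv_ae_derivable (K : X -> X) f B L r : bounded_linear K ->
  (forall t x, 0 <= t -> K (T t x) = T t (K x)) -> 0 < r ->
  (forall t, `|f t| <= B) -> (forall x y, `|f x - f y| <= L * `|x - y|) ->
  {ae mu, forall t, derivable (fun t => K (conv f r t)) t 1}.
Proof.
move=> bK KT r0 fB fL; have cf := lipschitz_cont fL.
have L0 : 0 <= L by have := fL 1 0; rewrite subr0 normr1 mulr1; exact: le_trans.
have [lK _] := bK; have [c c0 Kc] := bounded_linear_bound bK.
apply: (@near_compact_ae_derivable _ _ _ (c * (M * L * r))) => [x y|e e0].
  rewrite -(linB _ _ lK) (le_trans (Kc _))// -(mulrA c) ler_pM2l//.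
  exact: conv_lipschitz (ltW r0) fL.
have ML : 0 < c * (M * L) + 1 by rewrite ltr_wpDl// !mulr_ge0// ltW.
(* [r / 2] keeps r - eps positive for the splitting; the other term makes c M L eps <= e, the added
   1 covering L = 0. *)
pose eps := Num.min (r / 2) (e / (c * (M * L) + 1)).
have eps0 : 0 < eps by rewrite lt_min !divr_gt0.
have epsr : 0 < r - eps by rewrite subr_gt0 gt_min; apply/orP; left; lra.
exists (T eps), (c * (M * L * r)), 1; split=> //; first exact: hcpt.
move=> t h /andP[h0 _]; rewrite normr_gt0 in h0.
pose b s := h^-1 *: (f (s + h) - f s).
have cb : continuous b := quotient_cont (h := h) cf.
have bL s : `|b s| <= L := quotient_le s fL h0.
exists (K (conv b (r - eps) (t - eps))).
  rewrite (le_trans (Kc _))// ler_pM2l// (le_trans (conv_le _ cb (ltW epsr) bL))//.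
  by rewrite ler_wpM2l ?mulr_ge0// gerBl ltW.
rewrite -(linB _ _ lK) -(linZ _ _ lK) (conv_quotient r t h cf fB) -/b -KT ?(ltW eps0)//.
rewrite -{1}(subrKC eps r) (conv_split t cb bL eps0 epsr) -(linB _ _ lK) addrK.
rewrite (le_trans (Kc _))//.
apply: (@le_trans _ _ (c * (M * L * eps))).
  by rewrite ler_pM2l// conv_le// ltW.
have : eps <= e / (c * (M * L) + 1) by rewrite ge_min lexx orbT.
rewrite ler_pdivlMr// => epse; apply: le_trans epse.
by rewrite mulrA mulrC ler_pM2l// lerDl.
Qed.

End AlmostEverywhereDerivable.

Lemma subrBB (a b c d : X) : a - b - (c - d) = (a - c) - (b - d).
Proof. by rewrite !opprD addrACA. Qed.

(** * Picard iteration *)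

Section Picard.
Variables (U : Type) (S : set (U -> X)) (Phi : (U -> X) -> U -> X) (kappa : R).
Hypothesis kappa01 : 0 <= kappa < 1.
Hypothesis S_stable : forall y, S y -> S (Phi y).
Hypothesis S_closed : forall (ys : nat -> U -> X) y, (forall n, S (ys n)) ->
  (forall t, ys n t @[n --> \oo] --> y t) -> S y.
Hypothesis Phi_contracts : forall y z c, S y -> S z -> (forall t, `|y t - z t| <= c) ->
  forall t, `|Phi y t - Phi z t| <= kappa * c.

(** Uniform distance is expressed by constants bounding pointwise distances, and the iterates
    converge pointwise by completeness of X. The rate kappa^n D is uniform, which allows [Phi] to
    pass to the limit. *)
Lemma picard_fixed_point y0 c0 : S y0 -> (forall t, `|Phi y0 t - y0 t| <= c0) ->
  exists2 y, S y & forall t, Phi y t = y t.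
Proof.
move=> Sy0 y0c; have /andP[k0 k1] := kappa01.
(* [D] solves kappa D + c0 = D, so it bounds the distance of all iterates from [y0]. *)
pose ys n := iter n Phi y0; pose D := c0 / (1 - kappa).
have Sys n : S (ys n) by elim: n => // n; exact: S_stable.
have k1' : 0 < 1 - kappa by rewrite subr_gt0.
have DE : kappa * D + c0 = D by rewrite /D; field; rewrite gt_eqF.
have ys0 m t : `|ys m t - y0 t| <= D.
  elim: m t => [|m IH] t.
    rewrite subrr normr0 divr_ge0 ?(ltW k1')//.
    exact: le_trans (y0c t).
  have -> : ys m.+1 t - y0 t = (Phi (ys m) t - Phi y0 t) + (Phi y0 t - y0 t).
    by rewrite subrKA.
  rewrite (le_trans (ler_normD _ _))// -[leRHS]DE lerD//.
  exact: Phi_contracts.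
have ysn n m t : `|ys (n + m)%N t - ys n t| <= kappa ^+ n * D.
  elim: n t => [|n IH] t; first by rewrite add0n expr0 mul1r.
  by rewrite exprS -mulrA; apply: Phi_contracts.
have kD0 : kappa ^+ n * D @[n --> \oo] --> (0 : R).
  rewrite -[X in _ --> X](mul0r D); apply: cvgM; last exact: cvg_cst.
  by apply: cvg_expr; rewrite ger0_norm.
have ysc t : cvgn (ys ^~ t).
  apply: cauchy_cvg; apply: cauchy_exP => e e0.
  have /cvgrPdist_lt/(_ e e0)[N _ /(_ N (leqnn N))] := kD0.
  rewrite /= sub0r normrN => kN; exists (ys N t).
  exists N => // n /= Nn; rewrite -ball_normE/= distrC -(subnKC Nn).
  by rewrite (le_lt_trans (ysn _ _ _))// (le_lt_trans (ler_norm _)).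
pose y t := lim (ys n t @[n --> \oo]).
have Sy : S y by apply: S_closed Sys _ => t; exact: ysc.
have yd n t : `|y t - ys n t| <= kappa ^+ n * D.
  have : `|ys (m + n)%N t - ys n t| @[m --> \oo] --> `|y t - ys n t|.
    apply: cvg_norm; apply: cvgB; last exact: cvg_cst.
    rewrite (cvg_shiftn n (ys ^~ t)); exact: ysc.
  move=> /ler_cvg_to/(_ (cvg_cst (kappa ^+ n * D))); apply.
  by apply: nearW => m; rewrite addnC.
exists y => // t; apply/eqP; rewrite -subr_eq0 -normr_le0.
apply/ler_addgt0Pr => e e0; rewrite add0r.
have e20 : 0 < e / 2 by rewrite divr_gt0.
have /cvgrPdist_lt/(_ _ e20)[N _ /(_ N (leqnn N))] := kD0.
rewrite /= sub0r normrN => kN; have {}kN := le_lt_trans (ler_norm _) kN.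
have -> : Phi y t - y t = (Phi y t - Phi (ys N) t) + (Phi (ys N) t - y t) by rewrite subrKA.
rewrite (le_trans (ler_normD _ _))// [leRHS]splitr lerD//.
  rewrite (le_trans (Phi_contracts Sy (Sys N) (yd N) t))//.
  rewrite (le_trans _ (ltW kN))// ler_piMl ?(ltW k1)//.
  by rewrite (le_trans _ (yd N t)).
rewrite distrC (le_trans (yd N.+1 t))// exprS -mulrA.
rewrite (le_trans _ (ltW kN))// ler_piMl ?(ltW k1)//.
by rewrite (le_trans _ (yd N t)).
Qed.

End Picard.

Lemma periodic_lipschitz_bounded (y : R -> X) omega L : 0 < omega ->
  (forall t, y (t + omega) = y t) -> (forall s t, `|y s - y t| <= L * `|s - t|) ->
  forall t, `|y t| <= `|y 0| + L * omega.
Proof.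
move=> o0 yper yL t.
have L0 : 0 <= L by have := yL 1 0; rewrite subr0 normr1 mulr1; exact: le_trans.
have ypern (n : nat) s : y (s + n%:R * omega) = y s.
  by elim: n => [|n IH]; rewrite ?mul0r ?addr0// -natr1 mulrDl mul1r addrA yper.
have yperz (k : int) s : y (s + k%:~R * omega) = y s.
  case: k => n; first exact: ypern.
  by rewrite -[RHS](ypern n.+1) NegzE mulrNz -(ypern n.+1) mulNr subrK ypern.
pose r := t - (Num.floor (t / omega))%:~R * omega.
have -> : y t = y r by rewrite -(yperz (Num.floor (t / omega)) r) /r subrK.
have r0 : 0 <= r by rewrite subr_ge0 -ler_pdivlMr// floor_le.
have ro : r <= omega.
  rewrite /r lerBlDl; have := ltW (floorD1_gt (t / omega)).
  by rewrite ler_pdivrMr// intrD mulrDl mul1r.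
rewrite -(subrK (y 0) (y r)) addrC (le_trans (ler_normD _ _))// lerD2l.
rewrite (le_trans (yL _ _))// ler_wpM2l// subr0 ger0_norm//.
Qed.

(** * The fixed point equation *)

Section DelayFixedPoint.
(** To be read with E(s) = A^alpha T(s), J' = A^{alpha-1}, K = (I - T(omega))^{-1} and w = M_alpha
    omega^(1-alpha) / (1 - alpha); [F] and [G] stand for F and AG in the unknown y = A^alpha u. *)
Variables (omega xi tau L1 L2 w : R) (F : R -> X -> X -> X) (G : R -> X -> X).
Variables (E : R -> X -> X) (J' K : X -> X).
Hypotheses (omega0 : 0 < omega) (w0 : 0 <= w) (L10 : 0 < L1).
Hypothesis hF : forall s t x x' y y',
  `|F s x x' - F t y y'| <= L1 * (`|s - t| + `|x - y| + `|x' - y'|).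
Hypothesis hG : forall s t x y, `|G s x - G t y| <= L2 * (`|s - t| + `|x - y|).
Hypothesis hFper : forall t x y, F (t + omega) x y = F t x y.
Hypothesis hGper : forall t x, G (t + omega) x = G t x.
Hypotheses (bJ' : bounded_linear J') (bK : bounded_linear K).
Hypothesis E_integral : forall (f : R -> X) B, continuous f -> (forall t, `|f t| <= B) ->
  exists z, weak_integral `]0%R, omega] (fun s => E s (f s)) z.
Hypothesis E_dist : forall (f g : R -> X) c y z, (forall t, `|f t - g t| <= c) ->
  weak_integral `]0%R, omega] (fun s => E s (f s)) y ->
  weak_integral `]0%R, omega] (fun s => E s (g s)) z -> `|y - z| <= w * c.
Hypothesis small : opnorm K * (2 * L1 + L2) * w + opnorm J' * L2 < 1.

Let L2_ge0 : 0 <= L2.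
Proof.
have := hG 1 0 0 0; rewrite subrr normr0 addr0 subr0 normr1 mulr1.
exact: le_trans.
Qed.

Let AG (y : R -> X) t := G t (y (t - xi)).

Let rhs (y : R -> X) s := F s (y s) (y (s - tau)) - AG y s.

Let AG_lip (y : R -> X) L : (forall s t, `|y s - y t| <= L * `|s - t|) ->
  forall s t, `|AG y s - AG y t| <= L2 * (1 + L) * `|s - t|.
Proof.
move=> yL s t; rewrite (le_trans (hG _ _ _ _))// -mulrA.
rewrite ler_wpM2l// mulrDl mul1r lerD2l (le_trans (yL _ _))//.
by have -> : s - xi - (t - xi) = s - t by ring.
Qed.

Let rhs_lip (y : R -> X) L : (forall s t, `|y s - y t| <= L * `|s - t|) ->
  forall s t, `|rhs y s - rhs y t| <= (L1 + L2 + (2 * L1 + L2) * L) * `|s - t|.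
Proof.
move=> yL s t; rewrite /rhs; rewrite subrBB (le_trans (ler_normB _ _))//.
have h2 := AG_lip yL s t.
have h1 := hF s t (y s) (y (s - tau)) (y t) (y (t - tau)).
have e : s - tau - (t - tau) = s - t by ring.
have := yL s t; have := yL (s - tau) (t - tau); rewrite e => h3 h4.
have : L1 * (`|s - t| + `|y s - y t| + `|y (s - tau) - y (t - tau)|) <=
    L1 * (`|s - t| + L * `|s - t| + L * `|s - t|) by rewrite ler_pM2l// !lerD.
move: h1 h2 => h1 h2 h5; apply: le_trans (lerD (le_trans h1 h5) h2) _.
by rewrite le_eqVlt; apply/orP; left; apply/eqP; ring.
Qed.

Let AG_dist (y z : R -> X) c : (forall t, `|y t - z t| <= c) ->
  forall t, `|AG y t - AG z t| <= L2 * c.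
Proof.
move=> yz t; rewrite (le_trans (hG _ _ _ _))// subrr normr0 add0r.
by rewrite ler_wpM2l.
Qed.

Let rhs_dist (y z : R -> X) c : (forall t, `|y t - z t| <= c) ->
  forall t, `|rhs y t - rhs z t| <= (2 * L1 + L2) * c.
Proof.
move=> yz t; rewrite /rhs subrBB (le_trans (ler_normB _ _))// mulrDl lerD ?AG_dist//.
have := hF t t (y t) (y (t - tau)) (z t) (z (t - tau)).
rewrite subrr normr0 add0r => /le_trans; apply.
rewrite [2 * _]mulrC -mulrA ler_pM2l// mulr_natl mulr2n lerD//.
Qed.

Let AG_periodic (y : R -> X) t : (forall t, y (t + omega) = y t) -> AG y (t + omega) = AG y t.
Proof.
by move=> yp; rewrite /AG addrAC yp hGper.
Qed.

Let rhs_periodic (y : R -> X) t : (forall t, y (t + omega) = y t) ->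
  rhs y (t + omega) = rhs y t.
Proof.
by move=> yp; rewrite /rhs AG_periodic// addrAC !yp hFper.
Qed.

(** [kappa] is the left-hand side of (H6). If y is L-Lipschitz, its image under the fixed point map
    is (kappa0 + kappa L)-Lipschitz, [kappa0] coming from the explicit dependence of F and G on
    time; [Lstar] is the value of L that this reproduces. *)
Let kappa := opnorm K * (2 * L1 + L2) * w + opnorm J' * L2.
Let kappa0 := opnorm K * (L1 + L2) * w + opnorm J' * L2.
Let Lstar := kappa0 / (1 - kappa).

Let opnorm_ge0' : 0 <= opnorm K /\ 0 <= opnorm J'.
Proof. by split; apply: opnorm_ge0. Qed.

Let kappa01 : 0 <= kappa < 1.
Proof.
have [h1 h2] := opnorm_ge0'.
rewrite small andbT /kappa addr_ge0 ?mulr_ge0//.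
by rewrite addr_ge0// mulr_ge0// ltW.
Qed.

Let LstarE : kappa0 + kappa * Lstar = Lstar.
Proof.
have /andP[_ k1] := kappa01.
by rewrite /Lstar; field; rewrite subr_eq0 gt_eqF.
Qed.

Let S := [set y : R -> X | (forall t, y (t + omega) = y t) /\
  forall s t, `|y s - y t| <= Lstar * `|s - t|].

Let zint (y : R -> X) t : X :=
  xget 0 [set z | weak_integral `]0%R, omega] (fun s => E s (rhs y (t - s))) z].

Let rhs_bounded y : S y -> exists B, forall t, `|rhs y t| <= B.
Proof.
move=> [yp yL].
have := periodic_lipschitz_bounded omega0 (fun t => rhs_periodic t yp) (rhs_lip yL).
by move=> h; exists (`|rhs y 0| + (L1 + L2 + (2 * L1 + L2) * Lstar) * omega).
Qed.

Let rhs_cont y : S y -> continuous (rhs y).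
Proof. by move=> [yp yL]; exact: lipschitz_cont (rhs_lip yL). Qed.

Let zintP y t : S y ->
  weak_integral `]0%R, omega] (fun s => E s (rhs y (t - s))) (zint y t).
Proof.
move=> Sy; have [B rB] := rhs_bounded Sy.
have cr : continuous (fun s => rhs y (t - s)).
  move=> s; apply: (continuous_comp (f := fun s => t - s) (g := rhs y)).
    by apply: cvgB; [exact: cvg_cst|exact: cvg_id].
  exact: (rhs_cont Sy).
have [z wz] := E_integral cr
  (fun s => rB (t - s)).
exact: (xgetPex 0 (ex_intro (fun z => weak_integral `]0%R, omega]
  (fun s => E s (rhs y (t - s))) z) z wz)).
Qed.

Let Phi y t := J' (AG y t) + K (zint y t).

(** One estimate for two uses: y = y' at different times gives the Lipschitz bound, different
    functions at the same time give the contraction. *)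
Let Phi_dist (y y' : R -> X) t t' a b : S y -> S y' ->
  `|AG y t - AG y' t'| <= a -> (forall s, `|rhs y (t - s) - rhs y' (t' - s)| <= b) ->
  `|Phi y t - Phi y' t'| <= opnorm K * w * b + opnorm J' * a.
Proof.
move=> Sy Sy' ha hb; have [lJ' _] := bJ'; have [lR _] := bK; have [h1 h2] := opnorm_ge0'.
rewrite /Phi opprD addrACA -(linB _ _ lJ') -(linB _ _ lR) addrC.
rewrite (le_trans (ler_normD _ _))// lerD//.
  rewrite (le_trans (opnorm_ge _ bK))// -!mulrA ler_wpM2l//.
  exact: E_dist hb (zintP t Sy) (zintP t' Sy').
by rewrite (le_trans (opnorm_ge _ bJ'))// ler_wpM2l.
Qed.

Let Phi_stable y : S y -> S (Phi y).
Proof.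
move=> Sy; have [yp yL] := Sy; split.
  move=> t; rewrite /Phi AG_periodic//; congr (_ + K _); congr xget.
  apply/seteqP; split => z /=; apply: eq_weak_integral; try exact: measurable_itv.
    by move=> s _; rewrite addrAC rhs_periodic.
  by move=> s _; rewrite addrAC rhs_periodic.
move=> s t; have := Phi_dist (t := s) (t' := t) Sy Sy (AG_lip yL s t).
move=> /(_ ((L1 + L2 + (2 * L1 + L2) * Lstar) * `|s - t|)) h.
apply: le_trans (h _) _.
  move=> r; rewrite (le_trans (rhs_lip yL _ _))//.
  by have -> : s - r - (t - r) = s - t by ring.
rewrite -[in leRHS]LstarE le_eqVlt; apply/orP; left; apply/eqP.
rewrite /kappa /kappa0; ring.
Qed.

Let Phi_contracts (y z : R -> X) c : S y -> S z -> (forall t, `|y t - z t| <= c) ->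
  forall t, `|Phi y t - Phi z t| <= kappa * c.
Proof.
move=> Sy Sz yz t.
have := Phi_dist Sy Sz (AG_dist yz t) (fun s => rhs_dist yz (t - s)).
move=> /le_trans; apply; rewrite le_eqVlt; apply/orP; left; apply/eqP.
rewrite /kappa; ring.
Qed.

Let S_closed (ys : nat -> R -> X) y : (forall n, S (ys n)) ->
  (forall t, ys n t @[n --> \oo] --> y t) -> S y.
Proof.
move=> Sys ysy; split.
  move=> t; have e : (fun n => ys n (t + omega)) = ys ^~ t.
    by apply/funext => n; have [-> _] := Sys n.
  have h := ysy (t + omega); rewrite e in h.
  exact: cvg_unique h (ysy t).
move=> s t; have : `|ys n s - ys n t| @[n --> \oo] --> `|y s - y t|.
  by apply: cvg_norm; apply: cvgB.
move=> /ler_cvg_to/(_ (cvg_cst (Lstar * `|s - t|))); apply.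
by apply: nearW => n; have [_] := Sys n; exact.
Qed.

Lemma delay_fixed_point : exists y z : R -> X, exists L, [/\
    forall t, y (t + omega) = y t,
    forall s t, `|y s - y t| <= L * `|s - t|,
    forall s t, `|G s (y (s - xi)) - G t (y (t - xi))| <= L * `|s - t|,
    forall s t, `|rhs y s - rhs y t| <= L * `|s - t| &
    (forall t, rhs y (t + omega) = rhs y t) /\
    forall t, y t = J' (G t (y (t - xi))) + K (z t) /\
      weak_integral `]0%R, omega] (fun s => E s (rhs y (t - s))) (z t)].
Proof.
have kappa00 : 0 <= kappa0.
  have [h1 h2] := opnorm_ge0'.
  rewrite /kappa0 addr_ge0 ?mulr_ge0//.
  by rewrite addr_ge0// ltW.
have S0 : S (cst 0).
  split=> // s t; rewrite subrr normr0 mulr_ge0// divr_ge0// subr_ge0.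
  by case/andP: kappa01 => _ /ltW.
have [Pp PL] := Phi_stable S0.
(* The iteration starts at 0, where the first defect is [Phi 0]; being periodic and Lipschitz, it is
   bounded. *)
pose B := `|Phi (cst 0) 0| + Lstar * omega.
have [|y Sy yP] := picard_fixed_point kappa01 Phi_stable S_closed Phi_contracts S0 (c0 := B).
  by move=> t; rewrite subr0; exact: (periodic_lipschitz_bounded omega0 Pp PL t).
have [yp yL] := Sy.
have weaken (f : R -> X) L' L : L' <= L -> (forall s t, `|f s - f t| <= L' * `|s - t|) ->
    forall s t, `|f s - f t| <= L * `|s - t|.
  by move=> LL' fL s t; rewrite (le_trans (fL s t))// ler_wpM2r.
pose L' := L2 * (1 + Lstar); pose L'' := L1 + L2 + (2 * L1 + L2) * Lstar.
exists y, (zint y), (Num.max Lstar (Num.max L' L'')); split.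
- exact: yp.
- by apply: weaken yL; rewrite le_max lexx.
- by apply: weaken (AG_lip yL); rewrite !le_max lexx orbT.
- by apply: weaken (rhs_lip yL); rewrite !le_max lexx !orbT.
- split=> t; first exact: rhs_periodic.
  by rewrite -{1}yP; split=> //; exact: zintP.
Qed.

End DelayFixedPoint.

Lemma derive1_cvg (p : R -> X) t : derivable p t 1 ->
  h^-1 *: (p (t + h) - p t) @[h --> 0^'] --> derive1 p t.
Proof.
move=> dp; rewrite derive1E /derive.
rewrite (_ : (fun h => h^-1 *: (p (t + h) - p t)) =
  (fun h : R => h^-1 *: ((p \o shift t) (h *: 1) - p t))); last first.
  by apply/funext => h /=; rewrite [_ *: 1]mulr1 (addrC t).
exact: dp.
Qed.

(** Freezing the semigroup at negative times makes the integrand continuous on the whole line, hence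
    Bochner integrable on the period. The reflection s |-> t - s and the removal of one end point
    identify its value with [conv]. *)
Lemma conv_bochner (f : R -> X) B omega t : 0 < omega -> continuous f -> (forall t, `|f t| <= B) ->
  is_bochner `[t - omega, t] (fun s => T (t - s) (f s)) (conv f omega t).
Proof.
move=> omega0 cf fB; have B0 : 0 <= B by rewrite (le_trans _ (fB 0)).
have mI u v : measurable (`[u, v]%classic : set R) by exact: measurable_itv.
have cg : continuous (fun s : R => extT (t - s) (f s)).
  have cg' : continuous (fun r : R => extT r (f (t - r))) := extT_continuous_shift cf.
  move=> s; have := continuous_comp (f := fun s => t - s) (g := fun r => extT r (f (t - r)))
    (x := s) _ (cg' (t - s)).
  rewrite (_ : _ \o _ = fun s => extT (t - s) (f s)); last first.
    by apply/funext => r /=; rewrite subKr.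
  by apply; apply: cvgB; [exact: cvg_cst|exact: cvg_id].
have [||v [bv wv]] := @continuous_bochner _ _ `[t - omega, t] _ (M * B) (mI _ _) _ cg.
- by rewrite lebesgue_measure_itv/=; case: ifPn => // _; rewrite -EFinB ltry.
- move=> s; rewrite (le_trans (semigroup_le _ _)) ?le_max ?lexx//.
  by rewrite ler_wpM2l.
suff -> : conv f omega t = v.
  by apply: eq_is_bochner bv => s; rewrite /= in_itv/= => /andP[_ st]; rewrite extTE ?subr_ge0.
apply: (weak_integral_unique (conv_weak_integral omega t cf fB)).
have N10 : -1 != 0 :> R by rewrite oppr_eq0 oner_neq0.
have := weak_integral_affine t N10 (mI _ _) wv.
rewrite normrN normr1 invr1 scale1r (_ : _ @^-1` _ = `[0, omega]%classic); last first.
  by apply/seteqP; split => s /=; rewrite !in_itv/= mulN1r => /andP[h1 h2]; apply/andP; split; lra.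
move=> /weak_integral_oc; apply: eq_weak_integral; first exact: measurable_itv.
move=> s; rewrite /= in_itv/= mulN1r => /andP[s0 _].
by rewrite (_ : t - (- s + t) = s) ?extTE ?(ltW s0)// [- s + t]addrC//; ring.
Qed.

(** * Variation of constants for the periodic part *)

Section PeriodicConvolution.
Variables (omega : R) (f : R -> X) (B : R).
Hypotheses (omega0 : 0 < omega) (cf : continuous f) (fB : forall t, `|f t| <= B).
Hypothesis fper : forall t, f (t + omega) = f t.
Notation Rinv := (inverse_op (fun x => x - T omega x)).
Let p t := Rinv (conv f omega t).

(** Cut the convolution of length omega + h ending at t + h once at h and once at omega. By
    periodicity the pieces of length h agree, so [conv f omega (t + h)] is T(h) [conv f omega t]
    plus I - T(omega) applied to [conv f h (t + h)]; then apply (I - T(omega))^{-1}. *)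
Lemma resolvent_conv_step t h : 0 < h -> p (t + h) = T h (p t) + conv f h (t + h).
Proof.
move=> h0; have e1 := conv_split (t + h) cf fB h0 omega0.
have e2 := conv_split (t + h) cf fB omega0 h0.
have per : conv f h (t + h - omega) = conv f h (t + h).
  have e : (fun s => T s (f (t + h - omega - s))) = (fun s => T s (f (t + h - s))).
    by apply/funext => s; rewrite -fper; congr (T s (f _)); ring.
  by rewrite /conv e.
rewrite per addrC e1 addrK in e2.
have v_eq : conv f omega (t + h) =
    T h (conv f omega t) + (conv f h (t + h) - T omega (conv f h (t + h))).
  by rewrite addrA (addrC (T h _)) e2 addrK.
have [lR _] := period_resolvent_bounded_linear omega0.
rewrite /p v_eq (linD _ _ lR) (period_resolventKr omega0); congr (_ + _).
apply/esym; apply: (period_resolvent_comm omega0) => [|x].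
  exact: semigroup_linear (ltW h0).
by rewrite semigroup_comm// ltW.
Qed.

Lemma resolvent_conv_equation (DA : set X) (A : X -> X) (t : R) : neg_generates DA A T ->
  derivable p t 1 -> DA (p t) /\ derive1 p t + A (p t) = f t.
Proof.
move=> hgen dp.
suff /hgen[DAp Ap] : h^-1 *: (T h (p t) - p t) @[h --> 0^'+] --> derive1 p t - f t.
  by split=> //; rewrite -[A (p t)]opprK -Ap opprB addrC subrK.
have dq : h^-1 *: (p (t + h) - p t) @[h --> 0^'+] --> derive1 p t.
  by apply: cvg_dnbhs_at_right; exact: derive1_cvg.
(* The mean of T(s) f(t + h - s) over ]0, h] tends to f(t), since s and h - s are both at most h. *)
have cq : h^-1 *: conv f h (t + h) @[h --> 0^'+] --> f t.
  apply/cvgrPdist_le => e e0.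
  have M_gt0 : 0 < M := lt_le_trans ltr01 M1.
  have e20 : 0 < e / 2 by rewrite divr_gt0.
  have eM : 0 < e / 2 / M by rewrite divr_gt0.
  have [d1 d10 d1P] := semigroup_cvg0 (f t) e20.
  have /cvgrPdist_lt/(_ _ eM)[d2 /= d20 d2P] := @cf t.
  exists (Num.min d1 d2); first by rewrite /= lt_min d10.
  move=> h /=; rewrite sub0r normrN => /[swap] h0; rewrite gtr0_norm// lt_min => /andP[hd1 hd2].
  rewrite distrC; apply: weak_integral_near h0 _ (conv_weak_integral h (t + h) cf fB).
  move=> s /andP[s0 sh].
  have -> : T s (f (t + h - s)) - f t = T s (f (t + h - s) - f t) + (T s (f t) - f t).
    by rewrite (linB _ _ (semigroup_linear (ltW s0))) subrKA.
  rewrite (le_trans (ler_normD _ _))// [leRHS]splitr lerD//.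
    rewrite (le_trans (semigroup_le _ (ltW s0)))// mulrC -ler_pdivlMr// distrC.
    by apply/ltW/d2P; rewrite /= ltr_norml; apply/andP; split; lra.
  by apply/ltW/d1P; rewrite (ltW s0)/=; exact: le_lt_trans hd1.
apply: cvg_trans (cvgB dq cq); apply: near_eq_cvg; near=> h.
have h0 : 0 < h by near: h; exact: nbhs_right_gt.
rewrite -[(_ - _) h]/(_ *: _ - _ *: _) -scalerBr (resolvent_conv_step t h0).
by rewrite addrAC addrK.
Unshelve. all: by end_near. Qed.

End PeriodicConvolution.

(** The simple functions approximating u' are forward quotients of increment 1/(n+1), sampled on a
    grid of mesh 1/(n+1)^2: moving to the grid point changes the quotient by at most 2 L / (n+1),
    and everything is dominated by L. *)
Lemma lipschitz_L1loc_derive1 (u : R -> X) L :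
  (forall x y, `|u x - u y| <= L * `|x - y|) ->
  {ae mu, forall t, derivable u t 1} -> L1loc (derive1 u).
Proof.
move=> uL uder a b.
have L0 : 0 <= L by have := uL 1 0; rewrite subr0 normr1 mulr1; exact: le_trans.
pose g n c := n.+1%:R *: (u (c + n.+1%:R^-1) - u c).
(* Chosen so that (m n) + 1 = (n + 1)^2. *)
pose m n := (n * n.+2)%N.
have mE n : (m n).+1%:R = n.+1%:R * n.+1%:R :> R.
  by rewrite -natrM; congr (_%:R); rewrite /m; nia.
have mI : measurable (`[a, b]%classic : set R) by exact: measurable_itv.
have gL n c : `|g n c| <= L.
  have := quotient_le (h := n.+1%:R^-1) c uL.
  by rewrite invrK; apply; rewrite invr_eq0 pnatr_eq0.
apply: (bochner_dominated (s := fun n => step_function n.+1 (m n) (g n)) (k := cst L) mI).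
- by move=> n; exact: step_function_simple.
- apply: aeS uder => t dt _; have du := derive1_cvg dt.
  apply/cvgrPdist_le => e e0.
  have e20 : 0 < e / 2 by rewrite divr_gt0.
  have L2 : 0 < 2 * L + 1 by rewrite ltr_wpDl// mulr_ge0.
  have eL : 0 < e / 2 / (2 * L + 1) by rewrite divr_gt0.
  have /cvgrPdist_le/(_ _ e20)[d /= d0 dP] := du.
  near=> n; have n0 : 0 < n.+1%:R^-1 :> R by rewrite invr_gt0.
  rewrite /step_function ifT; last first.
    near: n; exists (Num.bound `|t|) => // n /= tn.
    by rewrite (lt_le_trans (archi_boundP _))// ler_nat ltnW.
  have -> : derive1 u t - g n (grid (m n) t) =
      (derive1 u t - g n t) + (g n t - g n (grid (m n) t)) by rewrite subrKA.
  rewrite (le_trans (ler_normD _ _))// [leRHS]splitr lerD//.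
    have := dP n.+1%:R^-1; rewrite invrK; apply; last by rewrite gt_eqF.
    rewrite /ball_/= sub0r normrN gtr0_norm//; near: n.
    exact: (near_infty_natSinv_lt (PosNum d0)).
  have ne : n.+1%:R^-1 < e / 2 / (2 * L + 1).
    by near: n; exact: (near_infty_natSinv_lt (PosNum eL)).
  have gd : `|t - grid (m n) t| <= n.+1%:R^-1 * n.+1%:R^-1.
    by rewrite -invfM -mE; exact: grid_dist.
  rewrite /g -scalerBr normrZ ger0_norm// subrBB.
  set c := grid (m n) t in gd *.
  have le2 : `|u (t + n.+1%:R^-1) - u (c + n.+1%:R^-1)| + `|u t - u c| <=
      2 * L * (n.+1%:R^-1 * n.+1%:R^-1).
    rewrite -mulrA mulr_natl mulr2n lerD//.
      rewrite (le_trans (uL _ _))// ler_wpM2l//.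
      by have -> : t + n.+1%:R^-1 - (c + n.+1%:R^-1) = t - c by ring.
    by rewrite (le_trans (uL _ _))// ler_wpM2l.
  rewrite (le_trans (ler_wpM2l _ (ler_normB _ _)))// (le_trans (ler_wpM2l _ le2))//.
  rewrite mulrCA mulVKf ?pnatr_eq0// mulrC.
  rewrite ltr_pdivlMr// in ne; rewrite (le_trans _ (ltW ne))// ler_wpM2l// ?(ltW n0)//.
  by rewrite lerDl.
- apply: cst_integrable => //.
  by rewrite lebesgue_measure_itv/=; case: ifPn => // _; rewrite -EFinB ltry.
- by move=> n t _; rewrite /step_function; case: ifP => _; rewrite ?normr0.
Unshelve. all: by end_near. Qed.

(** * The neutral equation *)

Section NeutralProblem.
Variables (DA : set X) (A : X -> X) (omega xi tau alpha : R).
Variables (G : R -> X -> X) (F : R -> X -> X -> X) (Malpha L1 L2 : R).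
Hypotheses (hA : linear_operator DA A) (hgen : neg_generates DA A T).
Hypothesis hcpt : compact_semigroup T.
Hypothesis hana : analytic_semigroup T.
Hypothesis omega0 : 0 < omega.
Hypothesis halpha : 0 <= alpha < 1.
Hypothesis Malpha0 : 0 < Malpha.
Hypothesis hAT : forall t x, 0 < t ->
  `|fracpow T alpha (T t x)| <= Malpha * t `^ (- alpha) * `|x|.
Hypothesis hG : maps_into_X1 DA T alpha G.
Hypothesis hGper : forall t x, fracdom T alpha x -> G (t + omega) x = G t x.
Hypothesis hFper : forall t x0 x1, fracdom T alpha x0 -> fracdom T alpha x1 ->
  F (t + omega) x0 x1 = F t x0 x1.
Hypothesis L1_gt0 : 0 < L1.
Hypothesis H4 : forall t1 t2 x0 x1 y0 y1,
  fracdom T alpha x0 -> fracdom T alpha x1 ->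
  fracdom T alpha y0 -> fracdom T alpha y1 ->
  `|F t2 x0 x1 - F t1 y0 y1|
  <= L1 * (`|t2 - t1| + fracnorm T alpha (x0 - y0) + fracnorm T alpha (x1 - y1)).
Hypothesis H5 : forall t1 t2 x y, fracdom T alpha x -> fracdom T alpha y ->
  `|A (G t2 x) - A (G t1 y)| <= L2 * (`|t2 - t1| + fracnorm T alpha (x - y)).
Notation J := (fracpow_neg T alpha).
Notation J' := (fracpow_neg T (1 - alpha)).
Notation Rinv := (inverse_op (fun x => x - T omega x)).
Hypothesis H6 : opnorm Rinv * Malpha * (2 * L1 + L2) * (omega `^ (1 - alpha) / (1 - alpha))
  + opnorm J' * L2 < 1.

Let domJ x : fracdom T alpha (J x). Proof. by exists x. Qed.

Let lJ : linear J. Proof. by case: (alpha_bounded_linear halpha). Qed.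

Let normJB x y : fracnorm T alpha (J x - J y) = `|x - y|.
Proof. by rewrite -(linB _ _ lJ) (fracnormE hgen halpha). Qed.

Let bR : bounded_linear Rinv := period_resolvent_bounded_linear omega0.

Let F' t a b := F t (J a) (J b).

Let G' t a := A (G t (J a)).

Let F'_lip s t x x' y y' :
  `|F' s x x' - F' t y y'| <= L1 * (`|s - t| + `|x - y| + `|x' - y'|).
Proof. by rewrite -(normJB x y) -(normJB x' y'); exact: H4. Qed.

Let G'_lip s t x y : `|G' s x - G' t y| <= L2 * (`|s - t| + `|x - y|).
Proof. by rewrite -(normJB x y); exact: H5. Qed.

Let w := Malpha * (omega `^ (1 - alpha) / (1 - alpha)).

Let w_ge0 : 0 <= w.
Proof.
rewrite /w mulr_ge0 ?(ltW Malpha0)// divr_ge0 ?powR_ge0// subr_ge0.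
by case/andP: halpha => _ /ltW.
Qed.

Let small : opnorm Rinv * (2 * L1 + L2) * w + opnorm J' * L2 < 1.
Proof.
apply: le_lt_trans H6; rewrite /w; move: (opnorm Rinv) (_ / _) (opnorm J') => p q r.
by rewrite le_eqVlt; apply/orP; left; apply/eqP; ring.
Qed.

Lemma fixed_point : exists y z : R -> X, exists L,
  let f s := F' s (y s) (y (s - tau)) - G' s (y (s - xi)) in
  [/\ forall t, y (t + omega) = y t,
    forall s t, `|y s - y t| <= L * `|s - t|,
    forall s t, `|G' s (y (s - xi)) - G' t (y (t - xi))| <= L * `|s - t|,
    forall s t, `|f s - f t| <= L * `|s - t| &
    (forall t, f (t + omega) = f t) /\
    forall t, y t = J' (G' t (y (t - xi))) + Rinv (z t) /\
      weak_integral `]0%R, omega] (fun s => alphaT alpha s (f (t - s))) (z t)].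
Proof.
have F'per t x y : F' (t + omega) x y = F' t x y by exact: hFper (domJ x) (domJ y).
have G'per t x : G' (t + omega) x = G' t x by rewrite /G' hGper.
apply: (delay_fixed_point xi tau omega0 w_ge0 L1_gt0 F'_lip G'_lip F'per G'per
  (alphac_bounded_linear halpha) bR _ _ small).
- move=> f B; exact: (alphaT_weak_integral hgen hana halpha Malpha0 hAT omega0).
- move=> f g c y z; exact: (alphaT_integral_dist hgen hana halpha Malpha0 hAT omega0).
Qed.

(** Put u = A^{-alpha} y and apply A^{-alpha} to the fixed point equation: A^{-alpha} A^{alpha-1} AG
    = G, the integral of A^alpha T(s) f(t - s) becomes the convolution, and (I - T(omega))^{-1}
    commutes with A^{-alpha}. *)
Lemma solution_data : exists u : R -> X, exists B L,
  let f s := F s (u s) (u (s - tau)) - A (G s (u (s - xi))) in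
  [/\ periodic_continuous T alpha omega u,
    forall s t, `|u s - u t| <= L * `|s - t|,
    forall s t, `|A (G s (u (s - xi))) - A (G t (u (t - xi)))| <= L * `|s - t|,
    (forall s t, `|f s - f t| <= L * `|s - t|) /\ (forall t, `|f t| <= B) &
    (forall t, f (t + omega) = f t) /\
    forall t, DA (G t (u (t - xi))) /\ u t = G t (u (t - xi)) + Rinv (conv f omega t)].
Proof.
have [y [z [L [yp yL gL fL [fp yE]]]]] := fixed_point.
have [c c0 Jc] := bounded_linear_bound (alpha_bounded_linear halpha).
have L0 : 0 <= L by have := yL 1 0; rewrite subr0 normr1 mulr1; exact: le_trans.
have LL : L <= Num.max L (c * L) by rewrite le_max lexx.
have cLL : c * L <= Num.max L (c * L) by rewrite le_max lexx orbT.
pose f s := F' s (y s) (y (s - tau)) - G' s (y (s - xi)).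
have cf : continuous f := lipschitz_cont fL.
have fB := periodic_lipschitz_bounded omega0 fp fL.
have weaken (g : R -> X) : (forall s t, `|g s - g t| <= L * `|s - t|) ->
    forall s t, `|g s - g t| <= Num.max L (c * L) * `|s - t|.
  by move=> gL' s t; rewrite (le_trans (gL' s t))// ler_wpM2r.
exists (J \o y), (`|f 0| + L * omega), (Num.max L (c * L)); split.
- split=> [t|t|t] /=; [exact: domJ| |by rewrite yp].
  have : `|y s - y t| @[s --> t] --> `|y t - y t|.
    by apply: cvg_norm; apply: cvgB; [exact: (lipschitz_cont yL)|exact: cvg_cst].
  rewrite subrr normr0; apply: cvg_trans.
  by apply: near_eq_cvg; apply: nearW => s; exact: esym (normJB _ _).
- move=> s t /=; rewrite -(linB _ _ lJ) (le_trans (Jc _))//.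
  apply: (@le_trans _ _ (c * (L * `|s - t|))); first by rewrite ler_pM2l.
  by rewrite mulrA ler_wpM2r.
- exact: weaken gL.
- by split; [exact: weaken fL|exact: fB].
- split=> [|t]; first exact: fp.
  split; first exact: hG (domJ _).
  have [yt wt] := yE t.
  have [lR _] := bR.
  have zE : J (z t) = conv f omega t.
    apply: (weak_integral_unique _ (conv_weak_integral omega t cf fB)).
    apply: (eq_weak_integral _ _ (weak_integral_linear (alpha_bounded_linear halpha) wt)).
      exact: measurable_itv.
    move=> s; rewrite /= in_itv/= => /andP[s0 _].
    exact: (alphaTK hgen hana halpha _ s0).
  rewrite [LHS]/= yt (linD _ _ lJ) (alpha_comp halpha) (generator_inj hgen (hG _ (domJ _))).
  congr (_ + _); rewrite (alpha_comm halpha _ bR) ?zE// => s x s0.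
  by rewrite (period_resolvent_comm omega0 x (semigroup_linear s0))// => x'; rewrite semigroup_comm// ltW.
Qed.

(** Differentiability of u comes from both summands of u = A^{-1} AG + p, but the neutral term u - G
    is p itself. So the equation is p' + A p = f with AG added to both sides, and holds wherever p
    is derivable. *)
Lemma strong_solution_ex : exists u, strong_solution DA A T alpha G F omega xi tau u.
Proof.
have [u [B [L]]] := solution_data.
set f := fun s => _; move=> /= [uper uL gL [fL fB] [fp uE]].
have cf : continuous f := lipschitz_cont fL.
pose p t := Rinv (conv f omega t); pose w' t := A (G t (u (t - xi))).
have uE' t : u t = J1 (w' t) + p t.
  by have [DAG ->] := uE t; rewrite (generator_inj hgen DAG).
have pE : (fun s => u s - G s (u (s - xi))) = p.
  by apply/funext => s; have [_ ->] := uE s; rewrite addrAC subrr add0r.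
have gder := frac1_ae_derivable hcpt gL.
have Rcomm t x : 0 <= t -> Rinv (T t x) = T t (Rinv x).
  move=> t0; rewrite (period_resolvent_comm omega0 x (semigroup_linear t0))// => x'.
  by rewrite semigroup_comm// ltW.
have pder := conv_ae_derivable hcpt bR Rcomm omega0 fB fL.
have uder : {ae mu, forall t, derivable u t 1}.
  apply: aeS (aeI gder pder) => t [dg dp].
  rewrite (_ : u = (J1 \o w') + p); first exact: derivableD.
  by apply/funext => s; exact: uE'.
exists u; split.
- split=> // t; exists (conv f omega t); last by have [] := uE t.
  exact: conv_bochner cf fB.
- exact: uder.
- exact: lipschitz_L1loc_derive1 uL uder.
- apply: aeS pder => t dp; rewrite pE.
  have [DAp eqp] := resolvent_conv_equation omega0 cf fB fp hgen dp.
  have [DAG ut] := uE t; have [_ /(_ 1 _ _ DAG DAp)] := hA.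
  rewrite !scale1r -ut => -[DAu Au]; split=> //.
  rewrite Au addrCA eqp /f addrC subrK//.
Qed.

End NeutralProblem.
End StableSemigroup.

Theorem theorem4p2 (R : realType) (X : completeNormedModType R)
    (DA : set X) (A : X -> X) (T : R -> X -> X)
    (omega xi tau alpha : R)
    (G : R -> X -> X) (F : R -> X -> X -> X)
    (Malpha L1 L2 : R)
    (hX : reflexive_space X)
    (hA : linear_operator DA A) (hAclosed : closed_operator DA A)
    (hT : c0_semigroup T) (hgen : neg_generates DA A T)
    (hstab : exponentially_stable T) (hcpt : compact_semigroup T)
    (hana : analytic_semigroup T)
    (homega : 0 < omega) (hxi : 0 < xi) (htau : 0 < tau)
    (halpha : 0 <= alpha < 1)
    (hMalpha : 0 < Malpha)
    (hAT : forall t x, 0 < t ->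
       `|fracpow T alpha (T t x)| <= Malpha * t `^ (- alpha) * `|x|)
    (hG : maps_into_X1 DA T alpha G)
    (hGcont : continuous_Xa_X1 A T alpha G)
    (hFcont : continuous_XaXa_X T alpha F)
    (hGper : forall t x, fracdom T alpha x -> G (t + omega) x = G t x)
    (hFper : forall t x0 x1, fracdom T alpha x0 -> fracdom T alpha x1 ->
       F (t + omega) x0 x1 = F t x0 x1)
    (hL1 : 0 < L1)
    (H4 : forall t1 t2 x0 x1 y0 y1,
       fracdom T alpha x0 -> fracdom T alpha x1 ->
       fracdom T alpha y0 -> fracdom T alpha y1 ->
       `|F t2 x0 x1 - F t1 y0 y1|
       <= L1 * (`|t2 - t1| + fracnorm T alpha (x0 - y0)
                           + fracnorm T alpha (x1 - y1)))
    (H5zero : forall t, G t 0 = 0)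
    (H5 : forall t1 t2 x y, fracdom T alpha x -> fracdom T alpha y ->
       `|A (G t2 x) - A (G t1 y)|
       <= L2 * (`|t2 - t1| + fracnorm T alpha (x - y)))
    (H6 : opnorm (inverse_op (fun x => x - T omega x)) * Malpha
            * (2 * L1 + L2) * (omega `^ (1 - alpha) / (1 - alpha))
          + opnorm (fracpow_neg T (1 - alpha)) * L2 < 1) :
  exists u : R -> X,
    strong_solution DA A T alpha G F omega xi tau u.
Proof.
have [M [nu [M1 nu0 TM]]] := hstab.
exact: (strong_solution_ex hT M1 nu0 TM xi tau hA hgen hcpt hana homega halpha hMalpha hAT
  hG hGper hFper hL1 H4 H5 H6).
Qed.
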